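(* Let $f: D_{n_0}^{\mathbf n,\mathbf p}(\mu)\to D_{n_0}^{\mathbf n,\mathbf p}(\mu)$ be a biholomorphic mapping of a generalized Fock-Bargmann-Hartogs domain onto itself with $f(0)=0$. Then there exist a permutation $\sigma\in S_l$ with $n_{\sigma(j)}=n_j$ and $p_{\sigma(j)}=p_j$ for all $1\le j\le l$, a unitary matrix $A\in\mathcal U(n_0)$, and unitary matrices $\Gamma_j\in\mathcal U(n_j)$ $(1\le j\le l)$ such that $$f(z,w_{(1)},\dots,w_{(l)})=\big(zA,\;w_{(\sigma(1))}\Gamma_1,\;\dots,\;w_{(\sigma(l))}\Gamma_l\big)$$ for all $(z,w_{(1)},\dots,w_{(l)})\in D_{n_0}^{\mathbf n,\mathbf p}(\mu)$.
   Context: For a positive integer $n_0$, $\mathbf n=(n_1,\dots,n_l)$ with positive integer entries, $\mathbf p=(p_1,\dots,p_l)$ with positive real entries, and $\mu>0$, the generalized Fock-Bargmann-Hartogs domain is $$D_{n_0}^{\mathbf n,\mathbf p}(\mu)=\Big\{(z,w_{(1)},\dots,w_{(l)})\in\mathbb C^{n_0}\times\mathbb C^{n_1}\times\cdots\times\mathbb C^{n_l}:\ \sum_{j=1}^l\|w_{(j)}\|^{2p_j}<e^{-\mu\|z\|^2}\Big\},$$ where $\|\cdot\|$ is the standard Hermitian norm. Standing assumption: $p_i\ne1$ for $2\le i\le l$ ($p_1$ may or may not equal $1$). Vectors are row vectors, $\mathcal U(k)$ is the group of $k\times k$ unitary matrices, and $S_l$ is the symmetric group on $\{1,\dots,l\}$.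 *)

(* Defs.v *)
From HB Require Import structures.
From mathcomp Require Import all_boot all_order all_algebra all_fingroup.
From mathcomp Require Import spectral complex.
From mathcomp Require Import all_classical all_reals all_analysis.
Import Order.TTheory GRing.Theory Num.Theory.
Import numFieldNormedType.Exports.

Set Implicit Arguments.
Unset Strict Implicit.
Unset Printing Implicit Defensive.

Local Open Scope complex_scope.
Local Open Scope classical_set_scope.
Local Open Scope ring_scope.

(* The norm `|v| of the library on 'rV[R[i]]_k is the sup norm; it only serves
   to define the topology and differentiability. *)
Definition hermitian_norm (R : realType) (k : nat) (v : 'rV[R[i]]_k) : R :=
  Num.sqrt (\sum_(i < k) ComplexField.Normc.normc (v ord0 i) ^+ 2).

(* Complex numbers are R[i]. C^n0 x C^(n 0) x ... x C^(n (l-1)) is represented by pairs (z, w), where w is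
   a single row vector made of l blocks; the block w_(j) is [submxrow w j]. *)
Definition FBH_domain (R : realType) (n0 l : nat) (n : 'I_l -> nat)
    (p : 'I_l -> R) (mu : R) :
    set ('rV[R[i]]_n0 * 'rV[R[i]]_(\sum_(j < l) n j)) :=
  [set x | \sum_(j < l) hermitian_norm (submxrow x.2 j) `^ (2 * p j)
             < expR (- mu * hermitian_norm x.1 ^+ 2)].

Arguments FBH_domain {R} n0 {l} n p mu.

(* Meant for an open set D: [differentiable] is Frechet differentiability over
   the field R[i] and depends only on the germ of f at x, so the values of f
   outside D are irrelevant. *)
Definition holomorphic_on (R : realType) (V W : normedModType R[i])
    (D : set V) (f : V -> W) : Prop :=
  forall x, D x -> differentiable f x.

Definition biholomorphic (R : realType) (V W : normedModType R[i])
    (D : set V) (D' : set W) (f : V -> W) : Prop :=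
  [/\ set_bij D D' f,
      holomorphic_on D f
    & exists2 g : W -> V, (forall x, D x -> g (f x) = x)
                        & holomorphic_on D' g].

(* Main.v *)
(* A biholomorphic self-map f with f(0) = 0 preserves C^n0 x {0} by Liouville's
   theorem, say f(z, 0) = (phi z, 0); let B(z) be the derivative of the w-part
   of f at (z, 0) in the directions w. The gauge
   rho(z, w) = (sum_j |w_j|^(2 p_j)) e^(mu |z|^2), for which D = {rho < 1}, is
   log-plurisubharmonic, so the Schwarz lemma on the discs t |-> (z, t w) gives
   rho(phi z, B(z) w) <= 1 whenever rho(z, w) <= 1. The same for the inverse map
   gives rho(phi z, B(z) w) = 1 whenever rho(z, w) = 1, and the equality case of
   the maximum principle yields f(z, w) = (phi z, B(z) w) on D.

   Linear maps preserving {sum_j |w_j|^(2 p_j) = 1} have determinant of modulus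
   at most 1, whence |det B(z)| = e^(k (|z|^2 - |phi z|^2)) for some k > 0. If
   the derivative of phi increased some length at a point, the holomorphic
   function det B times a suitable exponential would have a strict local maximum
   there; so phi does not increase lengths, nor does its inverse, thus
   |phi z| = |z|, and the vector-valued function phi(t z)/t of constant norm is
   constant: phi is linear and unitary.

   The gauge identity bounds the entries of B(z) by Gaussians in z; letting z
   tend to infinity, B(z) is block triangular with respect to the size of the
   exponents, its diagonal part is a contraction with contractive inverse, so
   the off-diagonal part vanishes, and B is constant. Finally, for p <> 1 the
   strict Clarkson inequality in the l^(2p)-sum of the blocks of exponent p shows
   that distinct blocks have images with disjoint supports.

   Functions are only assumed complex differentiable at each point; the maximum
   principle comes from Goursat's bisection argument, and extends to the weights
   prod_i |h_i|^(a_i) e^(Re L) with real a_i >= 0 by rounding exponents. *)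
Require Import Defs.
From HB Require Import structures.
From mathcomp Require Import all_boot all_order all_algebra all_fingroup.
From mathcomp Require Import spectral complex ring lra.
From mathcomp Require Import all_classical all_reals all_analysis.
Set Implicit Arguments.
Unset Strict Implicit.
Unset Printing Implicit Defensive.

Import Order.TTheory GRing.Theory Num.Theory.
Import numFieldNormedType.Exports.
Local Open Scope complex_scope.
Local Open Scope classical_set_scope.
Local Open Scope ring_scope.

(** The domain is unbounded, so Cartan's linearity theorem for bounded circular domains does not
    apply directly; linearity has to be extracted from the equality cases of the maximum principle.
    For real exponents the gauge is in general not smooth where a block vanishes, so it is never
    differentiated: it is bounded below by products of real powers of moduli of holomorphic
    functions. Difference quotients such as the w-part of f(z, t w)/t are only known to be
    continuous at t = 0. The function theory is therefore set up on discs with a puncture at the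
    centre, where the mean value over circles still makes sense. B(z) is at first a mere pointwise
    derivative. Its holomorphy in z follows from the linearity of f in w, which turns B(z) w into a
    value of f up to a scalar factor. At exponent 1 Clarkson's inequality degenerates to the
    parallelogram identity, and unitary maps can mix blocks. At most one block has exponent 1, so it
    is alone among the blocks of its exponent. *)

Lemma continuous_at_dist {R : realType} (f : R -> R) (x : R) :
  (forall e, 0 < e -> exists2 d, 0 < d &
     forall x', `|x' - x| < d -> `|f x' - f x| <= e) ->
  {for x, continuous f}.
Proof.
move=> H; apply/cvgrPdist_le => e e0.
have [d d0 Hd] := H _ e0.
near=> t; rewrite distrC; apply: Hd; rewrite distrC.
by near: t; apply: cvgr_dist_lt.
Unshelve. all: by end_near. Qed.

(** * Integrals of continuous functions over segments *)

Section SegmentIntegral.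
Context {R : realType}.
Implicit Types (g h : R -> R) (a b c m : R).

Definition segI g a b : R := \int[lebesgue_measure]_(x in `[a, b]) g x.

Lemma segment_integrable g a b : (forall x, a <= x <= b -> {for x, continuous g}) ->
  lebesgue_measure.-integrable `[a, b] (EFin \o g).
Proof.
move=> cg; apply: continuous_compact_integrable; first exact: segment_compact.
by apply: continuous_in_subspaceT => x /set_mem /=; rewrite in_itv/= => /cg.
Qed.

Lemma segI_split g a b c : (forall x, a <= x <= b -> {for x, continuous g}) ->
  a <= c <= b -> segI g a b = segI g a c + segI g c b.
Proof.
move=> cg /andP[ac cb]; rewrite /segI.
have ig := segment_integrable cg.
have := Rintegral_itvB ig; move=> /(_ c); rewrite !bnd_simp => /(_ ac cb) /eqP.
rewrite subr_eq => /eqP ->; rewrite addrC; congr (_ + _).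
rewrite Rintegral_itv_obnd_cbnd//; apply: integrableS ig => //.
by move=> x /=; rewrite !in_itv/= => /andP[cx ->]; rewrite (le_trans ac (ltW cx)).
Qed.

Lemma segI_add g h a b : (forall x, a <= x <= b -> {for x, continuous g}) ->
  (forall x, a <= x <= b -> {for x, continuous h}) ->
  segI (fun x => g x + h x) a b = segI g a b + segI h a b.
Proof. by move=> cg ch; rewrite /segI RintegralD//; exact: segment_integrable. Qed.

Lemma segI_cst m a b : a <= b -> segI (fun=> m) a b = m * (b - a).
Proof.
move=> ab; rewrite /segI Rintegral_cst//= lebesgue_measure_itv/= lte_fin.
have [//|ba] := ltP a b.
by have -> : a = b; [lra | rewrite /= subrr mulr0].
Qed.

Lemma segI_le g h a b : (forall x, a <= x <= b -> {for x, continuous g}) ->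
  (forall x, a <= x <= b -> {for x, continuous h}) ->
  (forall x, a <= x <= b -> g x <= h x) -> segI g a b <= segI h a b.
Proof.
move=> cg ch gh; apply: le_Rintegral => //.
- exact: segment_integrable.
- exact: segment_integrable.
Qed.

Lemma segI_le_cst g a b m : a <= b ->
  (forall x, a <= x <= b -> {for x, continuous g}) ->
  (forall x, a <= x <= b -> g x <= m) -> segI g a b <= m * (b - a).
Proof.
move=> ab cg gm; rewrite -segI_cst//; apply: segI_le => // x _; exact: cvg_cst.
Qed.

Lemma segI_ge_cst g a b m : a <= b ->
  (forall x, a <= x <= b -> {for x, continuous g}) ->
  (forall x, a <= x <= b -> m <= g x) -> m * (b - a) <= segI g a b.
Proof.
move=> ab cg gm; rewrite -segI_cst//; apply: segI_le => // x _; exact: cvg_cst.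
Qed.

Lemma segI_opp g a b : (forall x, a <= x <= b -> {for x, continuous g}) ->
  a <= b -> segI (fun x => - g x) a b = - segI g a b.
Proof.
move=> cg ab; apply/eqP; rewrite -addr_eq0; apply/eqP.
apply: eq_trans (esym (segI_add (g := fun x => - g x) (h := g) _ cg)) _.
  by move=> x /cg cx; exact: continuousN.
rewrite /segI (@eq_Rintegral _ _ _ _ _ (fun=> 0)); last first.
  by move=> x _; rewrite addNr.
by rewrite -/(segI _ _ _) segI_cst// mul0r.
Qed.

End SegmentIntegral.

(** * Goursat's theorem for closed one-forms *)

Section Goursat.
Context {R : realType}.
Implicit Types (p q : R -> R -> R) (x y : R).

(** Differentiability in two real variables at a single point, with explicit radii. No continuity of
    the partial derivatives is asked for, hence Goursat's argument instead of Green's formula. *)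
Definition affine_approx p x y (p1 p2 : R) := forall e, 0 < e -> exists2 d, 0 < d &
  forall x' y', `|x' - x| < d -> `|y' - y| < d ->
    `|p x' y' - p x y - p1 * (x' - x) - p2 * (y' - y)| <=
      e * (`|x' - x| + `|y' - y|).

(* The form [p dx + q dy] is differentiable at [(x, y)] with [p_y = q_x]. *)
Definition closed_form_at p q x y := exists p1 m q2 : R,
  affine_approx p x y p1 m /\ affine_approx q x y m q2.

Lemma affine_approx_bound p x y (p1 p2 : R) : affine_approx p x y p1 p2 ->
  exists2 d, 0 < d & forall x' y', `|x' - x| < d -> `|y' - y| < d ->
   `|p x' y' - p x y| <= (1 + `|p1| + `|p2|) * (`|x' - x| + `|y' - y|).
Proof.
move=> /(_ 1 ltr01)[d d0 H]; exists d => // x' y' hx hy.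
have h := H _ _ hx hy.
have -> : p x' y' - p x y = (p x' y' - p x y - p1 * (x' - x) - p2 * (y' - y)) +
   (p1 * (x' - x) + p2 * (y' - y)) by ring.
apply: le_trans (ler_normD _ _) _.
apply: (@le_trans _ _ (1 * (`|x' - x| + `|y' - y|) +
   (`|p1| * `|x' - x| + `|p2| * `|y' - y|))).
  apply: lerD; first exact: h.
  by rewrite -!normrM; exact: ler_normD.
have := normr_ge0 p1; have := normr_ge0 p2.
have := normr_ge0 (x' - x); have := normr_ge0 (y' - y).
by move=> ? ? ? ?; nra.
Qed.

Lemma affine_approx_contl p x y (p1 p2 : R) : affine_approx p x y p1 p2 ->
  {for x, continuous (p^~ y)}.
Proof.
move=> /affine_approx_bound[d d0 H].
set M := 1 + `|p1| + `|p2|.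
have M0 : 0 < M by rewrite /M -addrA ltr_pwDl// addr_ge0.
apply: continuous_at_dist => e e0; exists (Num.min d (e / M)).
  by rewrite lt_min d0 divr_gt0.
move=> x'; rewrite lt_min => /andP[h1 h2].
have := H x' y h1; rewrite subrr normr0 addr0 => /(_ d0) /le_trans; apply.
by rewrite mulrC -ler_pdivlMr// ltW.
Qed.

Lemma affine_approx_contr p x y (p1 p2 : R) : affine_approx p x y p1 p2 ->
  {for y, continuous (p x)}.
Proof.
move=> /affine_approx_bound[d d0 H].
set M := 1 + `|p1| + `|p2|.
have M0 : 0 < M by rewrite /M -addrA ltr_pwDl// addr_ge0.
apply: continuous_at_dist => e e0; exists (Num.min d (e / M)).
  by rewrite lt_min d0 divr_gt0.
move=> y'; rewrite lt_min => /andP[h1 h2].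
have := H x y'; rewrite subrr normr0 add0r => /(_ d0 h1) /le_trans; apply.
by rewrite mulrC -ler_pdivlMr// ltW.
Qed.

(** The counterclockwise circulation of [p dx + q dy]: bottom minus top edge, then right minus left
    edge. *)
Definition boundary_integral p q x1 x2 y1 y2 :=
  (segI (p^~ y1) x1 x2 - segI (p^~ y2) x1 x2) +
  (segI (q x2) y1 y2 - segI (q x1) y1 y2).

Definition closed_form_on p q (X1 X2 Y1 Y2 : R) :=
  forall x y, X1 <= x <= X2 -> Y1 <= y <= Y2 -> closed_form_at p q x y.

Lemma closed_form_contl p q X1 X2 Y1 Y2 x y : closed_form_on p q X1 X2 Y1 Y2 ->
  X1 <= x <= X2 -> Y1 <= y <= Y2 -> {for x, continuous (p^~ y)}.
Proof. by move=> pq hx hy; have [p1 [m [q2 [/affine_approx_contl]]]] := pq _ _ hx hy. Qed.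

Lemma closed_form_contr p q X1 X2 Y1 Y2 x y : closed_form_on p q X1 X2 Y1 Y2 ->
  X1 <= x <= X2 -> Y1 <= y <= Y2 -> {for y, continuous (q x)}.
Proof. by move=> pq hx hy; have [p1 [m [q2 [_ /affine_approx_contr]]]] := pq _ _ hx hy. Qed.

Lemma boundary_integral_splitx p q X1 X2 Y1 Y2 x1 x x2 y1 y2 :
  closed_form_on p q X1 X2 Y1 Y2 -> let Phi := boundary_integral p q in
  X1 <= x1 -> x2 <= X2 -> Y1 <= y1 -> y2 <= Y2 ->
  x1 <= x <= x2 -> y1 <= y2 -> Phi x1 x2 y1 y2 = Phi x1 x y1 y2 + Phi x x2 y1 y2.
Proof.
move=> pq Phi h1 h2 h3 h4 hx hy; rewrite /Phi /boundary_integral.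
have e1 : segI (p^~ y1) x1 x2 = segI (p^~ y1) x1 x + segI (p^~ y1) x x2.
  by apply: segI_split => // t ht; apply: (closed_form_contl pq); lra.
have e2 : segI (p^~ y2) x1 x2 = segI (p^~ y2) x1 x + segI (p^~ y2) x x2.
  by apply: segI_split => // t ht; apply: (closed_form_contl pq); lra.
by rewrite e1 e2; ring.
Qed.

Lemma boundary_integral_splity p q X1 X2 Y1 Y2 x1 x2 y1 y y2 :
  closed_form_on p q X1 X2 Y1 Y2 -> let Phi := boundary_integral p q in
  X1 <= x1 -> x2 <= X2 -> Y1 <= y1 -> y2 <= Y2 ->
  x1 <= x2 -> y1 <= y <= y2 -> Phi x1 x2 y1 y2 = Phi x1 x2 y1 y + Phi x1 x2 y y2.
Proof.
move=> pq Phi h1 h2 h3 h4 hx hy; rewrite /Phi /boundary_integral.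
have e1 : segI (q x1) y1 y2 = segI (q x1) y1 y + segI (q x1) y y2.
  by apply: segI_split => // t ht; apply: (closed_form_contr pq); lra.
have e2 : segI (q x2) y1 y2 = segI (q x2) y1 y + segI (q x2) y y2.
  by apply: segI_split => // t ht; apply: (closed_form_contr pq); lra.
by rewrite e1 e2; ring.
Qed.

(** The affine part of the form contributes [- m * b] over the length [a] and [m * a] over the
    length [b]; these cancel because p_y = q_x = m. What survives is the remainder, of size
    [e * (a + b)] at each point of the edges. *)
Lemma boundary_integral_small p q X1 X2 Y1 Y2 X Y e :
  closed_form_on p q X1 X2 Y1 Y2 -> let Phi := boundary_integral p q in
  X1 <= X <= X2 -> Y1 <= Y <= Y2 -> 0 < e ->
  exists2 d, 0 < d & forall x y a b, 0 <= a -> 0 <= b -> a < d -> b < d ->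
    X1 <= x -> x + a <= X2 -> Y1 <= y -> y + b <= Y2 ->
    x <= X <= x + a -> y <= Y <= y + b ->
    `|Phi x (x + a) y (y + b)| <= 2 * e * (a + b) ^+ 2.
Proof.
move=> pq Phi hX hY e0; have [p1 [m [q2 [Hp Hq]]]] := pq _ _ hX hY.
have [d1 d10 H1] := Hp _ e0; have [d2 d20 H2] := Hq _ e0.
exists (Num.min d1 d2); first by rewrite lt_min d10.
move=> x y a b a0 b0; rewrite !lt_min => /andP[a1 a2] /andP[b1 b2] x1 x2 y1 y2 hx hy.
have Ep t s : x <= t <= x + a -> y <= s <= y + b ->
   `|p t s - p X Y - p1 * (t - X) - m * (s - Y)| <= e * (a + b).
  move=> ht hs.
  have q1 : `|t - X| <= a by rewrite ler_norml; clear -ht hs hx hy; lra.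
  have q3 : `|s - Y| <= b by rewrite ler_norml; clear -ht hs hx hy; lra.
  apply: le_trans (H1 t s (le_lt_trans q1 a1) (le_lt_trans q3 b1)) _.
  by rewrite ler_pM2l// lerD.
have Eq t s : x <= t <= x + a -> y <= s <= y + b ->
   `|q t s - q X Y - m * (t - X) - q2 * (s - Y)| <= e * (a + b).
  move=> ht hs.
  have q1 : `|t - X| <= a by rewrite ler_norml; clear -ht hs hx hy; lra.
  have q3 : `|s - Y| <= b by rewrite ler_norml; clear -ht hs hx hy; lra.
  apply: le_trans (H2 t s (le_lt_trans q1 a2) (le_lt_trans q3 b2)) _.
  by rewrite ler_pM2l// lerD.
have cpt t s : x <= t <= x + a -> y <= s <= y + b -> {for t, continuous (p^~ s)}.
  by move=> ht hs; apply: (closed_form_contl pq); clear -ht hs x1 x2 y1 y2; lra.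
have cqt t s : x <= t <= x + a -> y <= s <= y + b -> {for s, continuous (q t)}.
  by move=> ht hs; apply: (closed_form_contr pq); clear -ht hs x1 x2 y1 y2; lra.
have xa : x <= x + a by rewrite lerDl.
have yb : y <= y + b by rewrite lerDl.
have yI : y <= y <= y + b by rewrite lexx.
have yI' : y <= y + b <= y + b by rewrite lexx andbT.
have xI : x <= x <= x + a by rewrite lexx.
have xI' : x <= x + a <= x + a by rewrite lexx andbT.
have E1 : segI (p^~ y) x (x + a) - segI (p^~ (y + b)) x (x + a) =
   segI (fun t => p t y - p t (y + b)) x (x + a).
  apply/esym/(eq_trans (segI_add (g := p^~ y) (h := fun t => - p t (y + b)) _ _)).
  - by move=> t ht; exact: cpt.
  - by move=> t ht; apply: continuousN; exact: cpt.
  - by congr (_ + _); apply: segI_opp => // t ht; exact: cpt.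
have E2 : segI (q (x + a)) y (y + b) - segI (q x) y (y + b) =
   segI (fun t => q (x + a) t - q x t) y (y + b).
  apply/esym/(eq_trans (segI_add (g := q (x + a)) (h := fun t => - q x t) _ _)).
  - by move=> t ht; exact: cqt.
  - by move=> t ht; apply: continuousN; exact: cqt.
  - by congr (_ + _); apply: segI_opp => // t ht; exact: cqt.
have c1 t : x <= t <= x + a -> {for t, continuous (fun t => p t y - p t (y + b))}.
  by move=> ht; apply: continuousB; exact: cpt.
have c2 t : y <= t <= y + b -> {for t, continuous (fun t => q (x + a) t - q x t)}.
  by move=> ht; apply: continuousB; exact: cqt.
have B1 t : x <= t <= x + a -> - m * b - 2 * e * (a + b) <= p t y - p t (y + b)
     <= - m * b + 2 * e * (a + b).
  move=> ht; have := Ep t y ht yI; have := Ep t (y + b) ht yI'; rewrite !ler_norml.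
  by clear; lra.
have B2 t : y <= t <= y + b -> m * a - 2 * e * (a + b) <= q (x + a) t - q x t
     <= m * a + 2 * e * (a + b).
  move=> ht; have := Eq (x + a) t xI' ht; have := Eq x t xI ht; rewrite !ler_norml.
  by clear; lra.
have L1 := segI_ge_cst xa c1 (fun t ht => proj1 (andP (B1 t ht))).
have U1 := segI_le_cst xa c1 (fun t ht => proj2 (andP (B1 t ht))).
have L2 := segI_ge_cst yb c2 (fun t ht => proj1 (andP (B2 t ht))).
have U2 := segI_le_cst yb c2 (fun t ht => proj2 (andP (B2 t ht))).
rewrite /Phi /boundary_integral E1 E2.
move: L1 U1 L2 U2; set s1 := segI _ _ _; set s2 := segI _ _ _ => L1 U1 L2 U2.
by rewrite ler_norml; clear -L1 U1 L2 U2; nra.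
Qed.

(* If the integral [Phi] over the boundary were nonzero, bisection would produce
   nested rectangles with [|Phi| > eps * area] shrinking to a point, against the
   first-order expansion of the form there. *)
Lemma goursat p q X1 X2 Y1 Y2 : closed_form_on p q X1 X2 Y1 Y2 ->
  X1 < X2 -> Y1 < Y2 -> boundary_integral p q X1 X2 Y1 Y2 = 0.
Proof.
move=> pq hX hY; set Phi := boundary_integral p q.
apply: contrapT => /eqP Phi0.
set A := X2 - X1; set B := Y2 - Y1.
have A0 : 0 < A by rewrite subr_gt0.
have B0 : 0 < B by rewrite subr_gt0.
(* Half of the mean density of the circulation, so that the initial rectangle is bad with a strict
   inequality. *)
set eps := `|Phi X1 X2 Y1 Y2| / (2 * A * B).
have eps0 : 0 < eps by rewrite divr_gt0 ?normr_gt0// !mulr_gt0.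
pose s n : R := (2 ^- n).
have s0 n : 0 < s n by rewrite /s invr_gt0 exprn_gt0.
have sS n : s n = 2 * s n.+1.
  by rewrite /s exprS invfM mulrA divff ?mul1r.
pose bad (n : nat) (c : R * R) := [/\ X1 <= c.1, c.1 + A * s n <= X2, Y1 <= c.2,
  c.2 + B * s n <= Y2 & eps * (A * s n * (B * s n)) <
  `|Phi c.1 (c.1 + A * s n) c.2 (c.2 + B * s n)| ].
have step (nc : nat * (R * R)) : exists c' : R * R, bad nc.1 nc.2 ->
  bad nc.1.+1 c' /\ nc.2.1 <= c'.1 <= nc.2.1 + A * s nc.1.+1 /\
  nc.2.2 <= c'.2 <= nc.2.2 + B * s nc.1.+1.
  case: nc => n [x y] /=.
  (* [choice] wants a total relation: a rectangle that is not bad gets the default corner (0, 0). *)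
  have [[/= h1 h2 h3 h4 h5]|] := pselect (bad n (x, y)); last by exists (0, 0).
  move: h2 h4 h5; rewrite (sS n); set t := s n.+1 => h2 h4 h5.
  have t0 : 0 < t by exact: s0.
  have At : 0 < A * t by rewrite mulr_gt0.
  have Bt : 0 < B * t by rewrite mulr_gt0.
  have e1 : A * (2 * t) = A * t + A * t by ring.
  have e2 : B * (2 * t) = B * t + B * t by ring.
  rewrite e1 addrA in h2; rewrite e2 addrA in h4; rewrite e1 e2 !addrA in h5.
  clear e1 e2; move: h2 h4 h5 At Bt; set At' := A * t; set Bt' := B * t => h2 h4 h5 At Bt.
  have h1' : X1 <= x + At' by clear -h1 At; lra.
  have h2' : x + At' <= X2 by clear -h2 At; lra.
  have h3' : Y1 <= y + Bt' by clear -h3 Bt; lra.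
  have h4' : y + Bt' <= Y2 by clear -h4 Bt; lra.
  have a1 : x <= x + At' by rewrite lerDl ltW.
  have a2 : x + At' <= x + At' + At' by rewrite lerDl ltW.
  have a3 : y <= y + Bt' by rewrite lerDl ltW.
  have a4 : y + Bt' <= y + Bt' + Bt' by rewrite lerDl ltW.
  have a5 : x <= x + At' <= x + At' + At' by rewrite a1.
  have a6 : y <= y + Bt' <= y + Bt' + Bt' by rewrite a3.
  have S1 : Phi x (x + At' + At') y (y + Bt' + Bt') =
      Phi x (x + At') y (y + Bt' + Bt') + Phi (x + At') (x + At' + At') y (y + Bt' + Bt').
    exact: (boundary_integral_splitx pq h1 h2 h3 h4 a5 (le_trans a3 a4)).
  have S2 : Phi x (x + At') y (y + Bt' + Bt') =
      Phi x (x + At') y (y + Bt') + Phi x (x + At') (y + Bt') (y + Bt' + Bt').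
    exact: (boundary_integral_splity pq h1 h2' h3 h4 a1 a6).
  have S3 : Phi (x + At') (x + At' + At') y (y + Bt' + Bt') =
      Phi (x + At') (x + At' + At') y (y + Bt') +
      Phi (x + At') (x + At' + At') (y + Bt') (y + Bt' + Bt').
    exact: (boundary_integral_splity pq h1' h2 h3 h4 a2 a6).
  rewrite S1 S2 S3 in h5; clear S1 S2 S3.
  move: h5; set f1 := Phi x _ y _; set f2 := Phi x _ (y + Bt') _.
  set f3 := Phi (x + At') _ y _; set f4 := Phi (x + At') _ (y + Bt') _ => h5.
  have h5' : eps * ((At' + At') * (Bt' + Bt')) < `|f1| + `|f2| + (`|f3| + `|f4|).
    apply: lt_le_trans h5 _; apply: le_trans (ler_normD _ _) _.
    by apply: lerD; exact: ler_normD.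
  set G := eps * (At' * (Bt')).
  have eG : eps * ((At' + At') * (Bt' + Bt')) = 4 * G by rewrite /G; ring.
  rewrite eG in h5'.
  have l1 : x <= x <= x + At' by rewrite lexx.
  have l2 : x <= x + At' <= x + At' by rewrite lexx andbT.
  have l3 : y <= y <= y + Bt' by rewrite lexx.
  have l4 : y <= y + Bt' <= y + Bt' by rewrite lexx andbT.
  have [g1|g1] := ltP G `|f1|; first by exists (x, y).
  have [g2|g2] := ltP G `|f2|; first by exists (x, y + Bt').
  have [g3|g3] := ltP G `|f3|; first by exists (x + At', y).
  have [g4|g4] := ltP G `|f4|; first by exists (x + At', y + Bt').
  by exfalso; clear -h5' g1 g2 g3 g4; lra.
have [F HF] := choice step.
pose c := fix c n := if n is m.+1 then F (m, c m) else (X1, Y1).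
have badc n : bad n (c n).
  elim: n => [|n IH]; last by have [] := HF (n, c n) IH.
  rewrite /bad /= /s expr0 invr1 !mulr1 /A /B !subrKC; split => //.
  rewrite -/A -/B; have -> : eps * (A * B) = `|Phi X1 X2 Y1 Y2| / 2.
    by rewrite /eps; field; rewrite !gt_eqF.
  by rewrite ltr_pdivrMr// ltr_pMr ?normr_gt0// ltr1n.
have cS n := HF (n, c n) (badc n).
have mono1 n k : (c n).1 <= (c (n + k)%N).1 /\ (c (n + k)%N).1 + A * s (n + k)%N <= (c n).1 + A * s n.
  elim: k => [|k [IH1 IH2]]; first by rewrite addn0.
  have [_ [/= h _]] := cS (n + k)%N; rewrite addnS /=.
  move: IH2; rewrite (sS (n + k)%N) => IH2.
  by clear -h IH1 IH2; split; lra.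
have mono2 n k : (c n).2 <= (c (n + k)%N).2 /\ (c (n + k)%N).2 + B * s (n + k)%N <= (c n).2 + B * s n.
  elim: k => [|k [IH1 IH2]]; first by rewrite addn0.
  have [_ [/= _ h]] := cS (n + k)%N; rewrite addnS /=.
  move: IH2; rewrite (sS (n + k)%N) => IH2.
  by clear -h IH1 IH2; split; lra.
have As n : 0 < A * s n by rewrite mulr_gt0.
have Bs n : 0 < B * s n by rewrite mulr_gt0.
(* The supremum of the left endpoints lies in all the nested intervals. *)
have nest (u : nat -> R) (w : nat -> R) : (forall n, 0 < w n) ->
   (forall n k, u n <= u (n + k)%N /\ u (n + k)%N + w (n + k)%N <= u n + w n) ->
   exists z, forall n, u n <= z <= u n + w n.
  move=> w0 H; exists (sup (range u)) => n.
  have ub m : ubound (range u) (u m + w m).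
    move=> _ [k _ <-]; have [mk|km] := leqP m k.
      by have [_] := H m (k - m)%N; rewrite subnKC// => h; have := w0 k; clear -h; lra.
    by have [h _] := H k (m - k)%N; rewrite subnKC ?(ltnW km)// in h; have := w0 m; clear -h; lra.
  apply/andP; split.
    by apply: ub_le_sup; [exists (u 0%N + w 0%N); exact: ub | exists n].
  by apply: ge_sup; [exists (u 0%N); exists 0%N | exact: ub].
have [X HX] := nest (fun n => (c n).1) (fun n => A * s n) As mono1.
have [Y HY] := nest (fun n => (c n).2) (fun n => B * s n) Bs mono2.
have h0 := badc 0%N; move: h0 => [/= b1 b2 b3 b4 _].
(* With this [e] the bound of [boundary_integral_small] on the n-th rectangle is exactly half of
   [eps] times its area. *)
pose e := eps * (A * B) / (4 * (A + B) ^+ 2).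
have AB0 : 0 < A + B by rewrite addr_gt0.
have e0 : 0 < e by apply: divr_gt0; apply: mulr_gt0 => //; [exact: mulr_gt0 | exact: exprn_gt0].
have [d d0 Hd] : exists2 d, 0 < d & forall x y a b, 0 <= a -> 0 <= b -> a < d -> b < d ->
    X1 <= x -> x + a <= X2 -> Y1 <= y -> y + b <= Y2 ->
    x <= X <= x + a -> y <= Y <= y + b ->
    `|Phi x (x + a) y (y + b)| <= 2 * e * (a + b) ^+ 2.
  apply: (boundary_integral_small pq) => //.
    by have := HX 0%N => /=; clear -b1 b2; lra.
  by have := HY 0%N => /=; clear -b3 b4; lra.
have [n Hn] : exists n, (A + B) * s n < d.
  have := @cvg_geometric R (A + B) (1/2); rewrite ger0_norm//.
  move=> /(_ ltac:(clear; lra)) /cvgrPdist_lt /(_ _ d0) [n _ /(_ n (leqnn _))] /=.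
  rewrite sub0r normrN ger0_norm; last by rewrite mulr_ge0 ?ltW// exprn_gt0// divr_gt0.
  by rewrite div1r exprVn => h; exists n.
have [k1 k2 k3 k4] := badc n.
have := As n; have := Bs n => q1 q2.
have small : A * s n + B * s n < d by rewrite -mulrDl.
have := Hd (c n).1 (c n).2 (A * s n) (B * s n) (ltW q2) (ltW q1).
move=> /(_ ltac:(clear -small q1; lra) ltac:(clear -small q2; lra) k1 k2 k3 k4 (HX n) (HY n)) h.
move=> /lt_le_trans /(_ h).
have -> : 2 * e * (A * s n + B * s n) ^+ 2 = eps * (A * s n * (B * s n)) / 2.
  by rewrite /e; field; rewrite gt_eqF.
have : 0 < eps * (A * s n * (B * s n)) by apply: mulr_gt0 => //; exact: mulr_gt0.
by clear; lra.
Qed.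

End Goursat.

Local Notation normc := ComplexField.Normc.normc.
Local Notation Re := complex.Re.
Local Notation Im := complex.Im.

(** * Complex differentiability, continuity and the modulus *)

Section ComplexDiff.
Context {R : realType}.
Implicit Types (h g : R[i] -> R[i]) (s t x y : R[i]).

(** The wrapper confines the view of R[i] as the normed space R[i]^o to this place; later statements
    speak of plain functions on R[i]. *)
Variant cdiff h t : Prop :=
  CDiff of differentiable (h : R[i]^o -> R[i]^o) (t : R[i]^o).
Variant ccont h t : Prop :=
  CCont of {for (t : R[i]^o), continuous (h : R[i]^o -> R[i]^o)}.

Lemma cdiff_cont h t : cdiff h t -> ccont h t.
Proof. by move=> [dh]; split; exact: differentiable_continuous. Qed.

Lemma cdiff_cst c t : cdiff (fun=> c) t.
Proof. split; exact: differentiable_cst. Qed.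

Lemma cdiff_id t : cdiff id t.
Proof. by split; apply/derivable1_diffP; exact: derivable_id. Qed.

Lemma cdiffD h g t : cdiff h t -> cdiff g t -> cdiff (fun x => h x + g x) t.
Proof. by move=> [dh] [dg]; split; exact: differentiableD. Qed.

Lemma cdiffM h g t : cdiff h t -> cdiff g t -> cdiff (fun x => h x * g x) t.
Proof. by move=> [dh] [dg]; split; exact: differentiableM. Qed.

Lemma cdiffV h t : h t != 0 -> cdiff h t -> cdiff (fun x => (h x)^-1) t.
Proof.
move=> h0 [dh]; split; exact: (@differentiableV (R[i] : numFieldType) R[i]^o h t dh h0).
Qed.

Lemma cdiff_comp h g t : cdiff h t -> cdiff g (h t) -> cdiff (fun x => g (h x)) t.
Proof.
move=> [dh] [dg]; split.
exact: (@differentiable_comp (R[i] : numFieldType) R[i]^o R[i]^o R[i]^o h g t dh dg).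
Qed.

Lemma ccont_cst c t : ccont (fun=> c) t. Proof. exact/cdiff_cont/cdiff_cst. Qed.

Lemma ccont_id t : ccont id t. Proof. exact/cdiff_cont/cdiff_id. Qed.

Lemma ccontD h g t : ccont h t -> ccont g t -> ccont (fun x => h x + g x) t.
Proof.
by move=> [a] [b]; split; exact: (@continuousD (R[i] : numFieldType) R[i]^o R[i]^o h g t a b).
Qed.

Lemma ccontM h g t : ccont h t -> ccont g t -> ccont (fun x => h x * g x) t.
Proof.
by move=> [a] [b]; split; exact: (@continuousM (R[i] : numFieldType) R[i]^o h g t a b).
Qed.

Lemma ccont_comp h g t : ccont h t -> ccont g (h t) -> ccont (fun x => g (h x)) t.
Proof.
by move=> [a] [b]; split; exact: (@continuous_comp R[i]^o R[i]^o R[i]^o h g t a b).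
Qed.

Lemma normE t : `|t| = (normc t)%:C. Proof. by []. Qed.

Lemma normc_ge0 t : 0 <= normc t. Proof. by case: t => a b /=; rewrite sqrtr_ge0. Qed.
Lemma normcD x y : normc (x + y) <= normc x + normc y. Proof. exact: le_normcD. Qed.
Lemma normcN' x : normc (- x) = normc x. Proof. exact: normcN. Qed.
Lemma normcB x y : normc (x - y) = normc (y - x). Proof. by rewrite -normcN' opprB. Qed.
Lemma normc_eq0 x : (normc x == 0) = (x == 0).
Proof.
apply/eqP/eqP => [|->]; [exact: ComplexField.Normc.eq0_normc|exact: ComplexField.Normc.normc0].
Qed.
Lemma normc_gt0 x : (0 < normc x) = (x != 0).
Proof. by rewrite lt_def normc_ge0 andbT normc_eq0. Qed.
Lemma normcX x n : normc (x ^+ n) = normc x ^+ n.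
Proof.
elim: n => [|n IH]; first by rewrite !expr0 ComplexField.Normc.normc1.
by rewrite !exprS ComplexField.Normc.normcM IH.
Qed.
Lemma normc_prod (I : finType) (P : pred I) (F : I -> R[i]) :
  normc (\prod_(i | P i) F i) = \prod_(i | P i) normc (F i).
Proof.
by apply: big_morph; [exact: ComplexField.Normc.normcM | exact: ComplexField.Normc.normc1].
Qed.
Lemma normc_Re x : `|Re x| <= normc x.
Proof. by case: x => a b /=; rewrite -sqrtr_sqr ler_wsqrtr// lerDl sqr_ge0. Qed.
Lemma normc_Im x : `|Im x| <= normc x.
Proof. by case: x => a b /=; rewrite -sqrtr_sqr ler_wsqrtr// lerDr sqr_ge0. Qed.
Lemma normc_real (a : R) : normc a%:C = `|a|.
Proof. by rewrite /= expr0n addr0 sqrtr_sqr. Qed.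
Lemma normc_le_ReIm x : normc x <= `|Re x| + `|Im x|.
Proof.
case: x => a b /=; rewrite -(ger0_norm (addr_ge0 (normr_ge0 a) (normr_ge0 b))) -sqrtr_sqr.
apply: ler_wsqrtr; rewrite sqrrD -!normrX !(ger0_norm (sqr_ge0 _)).
rewrite addrAC lerDl mulrn_wge0//; apply: mulr_ge0; exact: normr_ge0.
Qed.
Lemma sqr_normc x : normc x ^+ 2 = Re x ^+ 2 + Im x ^+ 2.
Proof. by case: x => a b /=; rewrite sqr_sqrtr// addr_ge0 ?sqr_ge0. Qed.

Lemma gt0_real (e : R[i]) : 0 < e -> e = (Re e)%:C /\ 0 < Re e.
Proof. by case: e => a b; rewrite ltcE /= => /andP[/eqP -> ->]. Qed.

Lemma ccontP h t : ccont h t <-> forall e, 0 < e -> exists2 d, 0 < d &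
  forall x, normc (x - t) < d -> normc (h x - h t) < e.
Proof.
split=> [[/cvgrPdist_lt H] e e0|H].
  have /H/nbhs_ballP[d /= d0 Hd] : 0 < e%:C by rewrite ltcR.
  have [dE d0'] := gt0_real d0; exists (Re d) => // x xt.
  have := Hd x; rewrite /ball/= -normcB !normE ltcR => -> //.
  by rewrite dE ltcR normcB.
split; apply/(@cvgrPdist_lt (R[i] : numFieldType) R[i]^o R[i]^o (nbhs (t : R[i]^o)) (nbhs_filter _)) => e e0.
have [eE e0'] := gt0_real e0; have [d d0 Hd] := H _ e0'.
apply/nbhs_ballP; exists d%:C => /=; first by rewrite ltcR.
move=> x /=; rewrite /ball/= normE ltcR eE => xt.
by rewrite normE ltcR normcB; apply: Hd; rewrite normcB.
Qed.

Lemma cdiffP h t : cdiff h t -> exists D, forall e, 0 < e -> exists2 d, 0 < d &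
  forall x, normc (x - t) < d -> normc (h x - h t - D * (x - t)) <= e * normc (x - t).
Proof.
move=> [/derivable1_diffP dh]; exists ('D_1 (h : R[i]^o -> R[i]^o) t) => e e0.
have /eqaddoP H := derivable_nbhs dh.
have : 0 < e%:C by rewrite ltcR.
move=> /H /nbhs_ballP[d /= d0 Hd].
have [dE d0'] := gt0_real d0; exists (Re d) => // x xt.
have := Hd (x - t); rewrite /ball/= sub0r normrN !normE dE ltcR => /(_ xt).
rewrite -lecR rmorphM /= -!normE; apply: le_trans; rewrite le_eqVlt; apply/orP; left.
apply/eqP; congr (`| _ |).
rewrite !fctE /= /GRing.scale /= mulr1 subrK.
by rewrite opprD addrA [_ * (x - t)]mulrC.
Qed.

Lemma cdiff_near h g t (d : R) : cdiff h t -> 0 < d ->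
  (forall x, normc (x - t) < d -> h x = g x) -> cdiff g t.
Proof.
move=> [/derivable1_diffP dh] d0 H; split; apply/derivable1_diffP.
apply: (near_eq_derivable (f := h : R[i]^o -> R[i]^o)) => //.
apply/nbhs_ballP; exists d%:C => /=; first by rewrite ltcR.
by move=> x /=; rewrite /ball/= normE ltcR normcB => /H.
Qed.

End ComplexDiff.

(** * The mean value inequality *)

Section CircleMean.
Context {R : realType}.
Implicit Types (h : R[i] -> R[i]) (t : R[i]).

Lemma derive_dist (f : R -> R) (x df e : R) : is_derive x 1 f df -> 0 < e ->
  exists2 d, 0 < d & forall x', `|x' - x| < d ->
    `|f x' - f x - df * (x' - x)| <= e * `|x' - x|.
Proof.
move=> [dv Df] e0; have /eqaddoP H := derivable_nbhs dv.
have /nbhs_ballP[d /= d0 Hd] := H _ e0; exists d => // x' xx.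
have := Hd (x' - x); rewrite /ball/= sub0r normrN => /(_ xx); rewrite !fctE /= Df.
by rewrite /GRing.scale /= mulr1 subrK opprD addrA [_ * df]mulrC.
Qed.

(** Products of functions of separate variables are the case at hand: both components of [polar]
    have this form. *)
Lemma affine_approx_prod (f g : R -> R) (a b df dg : R) :
  is_derive a 1 f df -> is_derive b 1 g dg ->
  affine_approx (fun x y => f x * g y) a b (df * g b) (f a * dg).
Proof.
move=> Hf Hg e e0.
set M := 1 + `|g b| + `|df| + `|f a| + `|dg|.
have M0 : 0 < M by rewrite /M -!addrA ltr_pwDl// !addr_ge0.
have := e0; set e1 := Num.min 1 (e / (2 * M)).
have e10 : 0 < e1 by rewrite /e1 lt_min ltr01 divr_gt0// mulr_gt0.
have e1M : 2 * M * e1 <= e by rewrite mulrC -ler_pdivlMr ?mulr_gt0// ge_min lexx orbT.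
have e11 : e1 <= 1 by rewrite ge_min lexx.
have [d1 d10 H1] := derive_dist Hf e10; have [d2 d20 H2] := derive_dist Hg e10.
pose m := Num.min (Num.min d1 d2) (Num.min 1 (e1 / M)).
exists m => [|x' y']; first by rewrite /m !lt_min d10 d20 ltr01 divr_gt0.
rewrite /m !lt_min => /andP[/andP[x1 _] /andP[x3 x4]] /andP[/andP[_ y2] /andP[y3 y4]].
have {}H1 := H1 _ x1; have {}H2 := H2 _ y2.
set X := `|x' - a| in x3 x4 H1 *; set Y := `|y' - b| in y3 y4 H2 *.
have X0 : 0 <= X by exact: normr_ge0.
have Y0 : 0 <= Y by exact: normr_ge0.
have MY : M * Y <= e1 by rewrite mulrC -ler_pdivlMr// ltW.
have gY : `|g y' - g b| <= e1 + e1.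
  have -> : g y' - g b = (g y' - g b - dg * (y' - b)) + dg * (y' - b) by ring.
  apply: le_trans (ler_normD _ _) _; rewrite normrM -/Y; apply: lerD.
    by apply: le_trans H2 _; rewrite ler_piMr// ltW.
  apply: le_trans MY; rewrite ler_wpM2r// /M lerDr !addr_ge0//.
have -> : f x' * g y' - f a * g b - df * g b * (x' - a) - f a * dg * (y' - b) =
  (f x' - f a - df * (x' - a)) * g b + (f x' - f a - df * (x' - a)) * (g y' - g b)
  + df * (x' - a) * (g y' - g b) + f a * (g y' - g b - dg * (y' - b)) by ring.
set A := f x' - f a - _ in H1 *; set B := g y' - g b in gY *.
set D := B - _ in H2 *.
apply: le_trans (ler_normD _ _) _; rewrite normrM.
have T1 : `|A * g b + A * B + df * (x' - a) * B| <=
    e1 * X * `|g b| + e1 * X * (e1 + e1) + `|df| * X * (e1 + e1).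
  apply: le_trans (ler_normD _ _) _; apply: lerD.
    apply: le_trans (ler_normD _ _) _; rewrite !normrM; apply: lerD.
      by rewrite ler_wpM2r.
    by rewrite ler_pM.
  by rewrite !normrM -/X ler_wpM2l// mulr_ge0.
have T2 : `|f a| * `|D| <= `|f a| * (e1 * Y) by rewrite ler_wpM2l.
apply: le_trans (lerD T1 T2) _; apply: le_trans (ler_wpM2r (addr_ge0 X0 Y0) e1M).
rewrite /M; have := normr_ge0 (g b); have := normr_ge0 df; have := normr_ge0 (f a).
have := normr_ge0 dg; move: X0 Y0 e11 e10.
move: `|g b| `|df| `|f a| `|dg| => G F A' D'; clear => X0 Y0 e11 e10 D0 A0 F0 G0.
have -> : 2 * (1 + G + F + A' + D') * e1 * (X + Y) =
  e1 * X * G + e1 * X * (1 + 1) + F * X * (e1 + e1) + A' * (e1 * Y) +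
  e1 * (G * X + 2 * A' * X + 2 * D' * X + 2 * Y + 2 * G * Y + 2 * F * Y +  A' * Y + 2 * D' * Y)
  by ring.
apply: (@le_trans _ _ (e1 * X * G + e1 * X * (1 + 1) + F * X * (e1 + e1) + A' * (e1 * Y))).
  rewrite !lerD2r lerD2l; apply: ler_wpM2l; last exact: lerD.
  exact: mulr_ge0 (ltW e10) X0.
by rewrite lerDl mulr_ge0 ?(ltW e10)// !addr_ge0// !mulr_ge0.
Qed.

(** The complex exponential of s + iu; the circle of radius r is traced at s = ln r. *)
Definition polar (s u : R) : R[i] := (expR s * cos u) +i* (expR s * sin u).

Lemma normc_polar s u : normc (polar s u) = expR s.
Proof.
rewrite /= !exprMn -mulrDr cos2Dsin2 mulr1 sqrtr_sqr ger0_norm//; exact: expR_ge0.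
Qed.

Lemma polar_approx s u (e : R) : 0 < e -> exists2 d, 0 < d & forall s' u',
  `|s' - s| < d -> `|u' - u| < d ->
  normc (polar s' u' - polar s u - polar s u * ((s' - s) +i* (u' - u))) <=
    e * (`|s' - s| + `|u' - u|).
Proof.
move=> e0; have e20 : 0 < e / 2 by rewrite divr_gt0.
have [d1 d10 H1] := affine_approx_prod (is_derive_expR s) (is_derive_cos u) e20.
have [d2 d20 H2] := affine_approx_prod (is_derive_expR s) (is_derive_sin u) e20.
exists (Num.min d1 d2); first by rewrite lt_min d10.
move=> s' u'; rewrite !lt_min => /andP[a1 a2] /andP[b1 b2].
apply: le_trans (normc_le_ReIm _) _ => /=.
have {}H1 := H1 _ _ a1 b1; have {}H2 := H2 _ _ a2 b2.
set N := _ + `|u' - u| in H1 H2 *.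
have -> : e * N = e / 2 * N + e / 2 * N by rewrite -mulrDl -splitr.
apply: lerD; [move: H1|move: H2]; set l := (X in `|X| <= _ -> _);
  set r := (X in _ -> `|X| <= _); have -> : l = r => //; rewrite /l /r; ring.
Qed.

(** Continuity replaces differentiability at 0, because this is all that is known of a difference
    quotient completed by the derivative; no removable singularity theorem is then called for. *)
Definition hol_punctured (rho : R) h :=
  ccont h 0 /\ forall t, 0 < normc t < rho -> cdiff h t.

(** Cauchy-Riemann equations: with E = h'(p) p, the derivative of h(polar s u) is E in s and iE in
    u, so the u-derivative of the imaginary part and the s-derivative of the real part are both Re
    E. *)
Lemma polar_comp_closed h s u : cdiff h (polar s u) ->
  closed_form_at (fun s u => Im (h (polar s u))) (fun s u => Re (h (polar s u))) s u.
Proof.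
move=> /cdiffP[D HD]; set p := polar s u.
pose E := D * p; exists (Im E), (Re E), (- Im E).
suff H e : 0 < e -> exists2 d, 0 < d & forall s' u', `|s' - s| < d -> `|u' - u| < d ->
   normc (h (polar s' u') - h p - E * ((s' - s) +i* (u' - u))) <=
   e * (`|s' - s| + `|u' - u|).
  split=> e e0; have [d d0 Hd] := H _ e0; exists d => // s' u' hs hu.
    apply: le_trans (Hd _ _ hs hu); apply: le_trans (normc_Im _).
    rewrite -/p; clear; case: (h (polar s' u')) (h p) (E) => [a b] [a' b'] [x y] /=.
    by rewrite le_eqVlt; apply/orP; left; apply/eqP; congr (`| _ |); ring.
  apply: le_trans (Hd _ _ hs hu); apply: le_trans (normc_Re _).
  rewrite -/p; clear; case: (h (polar s' u')) (h p) (E) => [a b] [a' b'] [x y] /=.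
  by rewrite le_eqVlt; apply/orP; left; apply/eqP; congr (`| _ |); ring.
move=> e0.
set M := normc p + 1; have M0 : 0 < M by rewrite ltr_wpDl ?normc_ge0.
set N := normc D + 1; have N0 : 0 < N by rewrite ltr_wpDl ?normc_ge0.
have e1 : 0 < e / (2 * M) by rewrite divr_gt0 ?mulr_gt0.
have e2 : 0 < Num.min 1 (e / (2 * N)) by rewrite lt_min ltr01 divr_gt0 ?mulr_gt0.
have [d1 d10 H1] := HD _ e1; have [d2 d20 H2] := polar_approx s u e2.
exists (Num.min d2 (d1 / (2 * M))); first by rewrite lt_min d20 divr_gt0 ?mulr_gt0.
move=> s' u'; rewrite !lt_min => /andP[a1 a2] /andP[b1 b2].
have {}H2 := H2 _ _ a1 b1; rewrite -/p in H2.
set S := `|s' - s| + `|u' - u| in H2 *.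
have S0 : 0 <= S by rewrite addr_ge0.
set z := _ +i* _ in H2 *.
have zS : normc z <= S by exact: normc_le_ReIm.
set q := polar s' u' in H2 *.
have qp : normc (q - p) <= M * S.
  have -> : q - p = (q - p - p * z) + p * z by ring.
  apply: le_trans (normcD _ _) _; rewrite ComplexField.Normc.normcM /M mulrDl mul1r addrC.
  apply: lerD; first by rewrite ler_wpM2l ?normc_ge0.
  apply: le_trans H2 _; rewrite ler_piMl// ge_min lexx//.
have Sd : M * S < d1.
  rewrite mulrC -ltr_pdivlMr//; move: a2 b2; rewrite invfM mulrCA mulrC => a2 b2.
  by rewrite (splitr (d1 / M)) /S; apply: ltrD.
have {}H1 := H1 _ (le_lt_trans qp Sd).
have -> : h q - h p - E * z = (h q - h p - D * (q - p)) + D * (q - p - p * z).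
  by rewrite /E; ring.
apply: le_trans (normcD _ _) _; rewrite ComplexField.Normc.normcM.
have -> : e * S = e / (2 * M) * (M * S) + N * (e / (2 * N) * S).
  by field; rewrite !gt_eqF.
apply: lerD; first by apply: le_trans H1 _; rewrite ler_wpM2l// ltW.
apply: ler_pM; rewrite ?normc_ge0//; first by rewrite lerDl.
apply: le_trans H2 _; rewrite ler_wpM2r// ge_min lexx orbT//.
Qed.

(* In polar coordinates [h dt / (i t)] is a closed form with real part
   [Re h du + Im h ds], so [Re h] has the same mean over all circles about [0]. *)
Lemma circle_mean_le h (rho r m : R) : hol_punctured rho h -> 0 < r < rho ->
  (forall t, normc t = r -> Re (h t) <= m) -> Re (h 0) <= m.
Proof.
move=> [ch dh] /andP[r0 rrho] Hm; rewrite leNgt; apply/negP => hm.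
set dl := Re (h 0) - m; have dl0 : 0 < dl by rewrite subr_gt0.
have dl2 : 0 < dl / 2 by rewrite divr_gt0.
have [d d0 Hd] := (ccontP h 0).1 ch _ dl2.
(* A circle so small that Re h stays above m + dl/2 on it, by continuity at 0; the puncture is never
   entered. *)
set r1 := Num.min (d / 2) (r / 2).
have r10 : 0 < r1 by rewrite lt_min !divr_gt0.
have r1d : r1 < d by rewrite gt_min ltr_pdivrMr// ltr_pMr// ltr1n.
have r1r : r1 < r by rewrite gt_min [X in _ || X]ltr_pdivrMr// ltr_pMr// ltr1n orbT.
have s12 : ln r1 < ln r by rewrite ltr_ln ?posrE.
have pi2 : (0 : R) < pi *+ 2 by rewrite mulrn_wgt0// pi_gt0.
have cf : closed_form_on (fun s u => Im (h (polar s u))) (fun s u => Re (h (polar s u)))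
    (ln r1) (ln r) 0 (pi *+ 2).
  move=> s u /andP[_ sr] _; apply: polar_comp_closed; apply: dh.
  rewrite normc_polar expR_gt0/=; apply: le_lt_trans rrho.
  by rewrite -(lnK r0) ler_expR.
have cu s u : ln r1 <= s <= ln r -> 0 <= u <= pi *+ 2 ->
  {for u, continuous (fun u => Re (h (polar s u)))}.
  by move=> hs hu; apply: (closed_form_contr cf).
have L : segI (fun u => Re (h (polar (ln r) u))) 0 (pi *+ 2) <= m * (pi *+ 2 - 0).
  apply: segI_le_cst; first exact: ltW.
    move=> u; apply: cu; rewrite lexx andbT; exact: ltW.
  move=> u _; apply: Hm; rewrite normc_polar; exact: lnK.
have U : (m + dl / 2) * (pi *+ 2 - 0) <= segI (fun u => Re (h (polar (ln r1) u))) 0 (pi *+ 2).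
  apply: segI_ge_cst; first exact: ltW.
    move=> u; apply: cu; rewrite lexx; exact: ltW.
  move=> u hu; have := Hd (polar (ln r1) u); rewrite subr0 normc_polar lnK// => /(_ r1d) ht.
  have := le_lt_trans (normc_Re _) ht; rewrite raddfB /= ltr_norml => /andP[+ _].
  by rewrite /dl; clear; lra.
have := goursat cf s12 pi2; rewrite /boundary_integral.
(* The edges u = 0 and u = 2 pi carry the same values and cancel, so the integrals over the two
   circles agree. *)
have per s : polar s 0 = polar s (pi *+ 2) by rewrite /polar cos2pi sin2pi cos0 sin0.
rewrite [X in X - _](_ : _ = segI (fun s => Im (h (polar s (pi *+ 2)))) (ln r1) (ln r)); last first.
  by rewrite /segI; apply: eq_Rintegral => s _; rewrite per.
rewrite subrr add0r => /eqP; rewrite subr_eq0 => /eqP Q.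

move: U; rewrite -Q subr0 => U; rewrite subr0 in L.
have := le_trans U L; rewrite (ler_pM2r pi2) => H; move: dl2; rewrite ltNge => /negP; apply.
by rewrite -(lerD2l m) addr0.
Qed.

End CircleMean.

(** * Continuity of real functions of a complex variable *)

Section RealContinuity.
Context {R : realType}.
Implicit Types (h : R[i] -> R[i]) (v w : R[i] -> R) (t x : R[i]).

Variant rcont v t : Prop :=
  RCont of {for (t : R[i]^o), continuous (v : R[i]^o -> R)}.

Lemma rcontP v t : rcont v t <-> forall e, 0 < e -> exists2 d, 0 < d &
  forall x, normc (x - t) < d -> `|v x - v t| < e.
Proof.
split=> [[/cvgrPdist_lt H] e e0|H].
  have /nbhs_ballP[d /= d0 Hd] := H _ e0.
  have [dE d0'] := gt0_real d0; exists (Re d) => // x xt.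
  by rewrite distrC; apply: Hd; rewrite /ball/= normE dE ltcR normcB.
split; apply/(@cvgrPdist_lt R R R[i]^o (nbhs (t : R[i]^o)) (nbhs_filter _)) => e e0.
have [d d0 Hd] := H _ e0.
apply/nbhs_ballP; exists d%:C => /=; first by rewrite ltcR.
move=> x /=; rewrite /ball/= normE ltcR => xt.
by rewrite distrC; apply: Hd; rewrite normcB.
Qed.

Lemma rcont_cst (c : R) t : rcont (fun=> c) t.
Proof. by apply/rcontP => e e0; exists 1 => // x _; rewrite subrr normr0. Qed.

Lemma rcontD v w t : rcont v t -> rcont w t -> rcont (fun x => v x + w x) t.
Proof. by move=> [a] [b]; split; exact: (@continuousD R R R[i]^o v w t a b). Qed.

Lemma rcontM v w t : rcont v t -> rcont w t -> rcont (fun x => v x * w x) t.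
Proof. by move=> [a] [b]; split; exact: (@continuousM R R[i]^o v w t a b). Qed.

Lemma rcont_comp v (f : R -> R) t : rcont v t -> {for v t, continuous f} ->
  rcont (fun x => f (v x)) t.
Proof. by move=> [a] b; split; exact: (@continuous_comp R[i]^o R R v f t a b). Qed.

Lemma rcont_sum (I : Type) (s : seq I) (P : pred I) (F : I -> R[i] -> R) t :
  (forall i, rcont (F i) t) -> rcont (fun x => \sum_(i <- s | P i) F i x) t.
Proof.
move=> H; elim: s => [|i s IH].
  under eq_fun do rewrite big_nil; exact: rcont_cst.
under eq_fun do rewrite big_cons; case: (P i); [exact: (rcontD (H i) IH)|exact: IH].
Qed.

Lemma rcont_prod (I : Type) (s : seq I) (P : pred I) (F : I -> R[i] -> R) t :
  (forall i, rcont (F i) t) -> rcont (fun x => \prod_(i <- s | P i) F i x) t.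
Proof.
move=> H; elim: s => [|i s IH].
  under eq_fun do rewrite big_nil; exact: rcont_cst.
under eq_fun do rewrite big_cons; case: (P i); [exact: (rcontM (H i) IH)|exact: IH].
Qed.

(** At a zero of [v] the power need not be differentiable, so continuity is checked there by
    monotonicity. The exponent 0 gives the constant 1, also at zeros of [v]. *)
Lemma rcont_powR v (p : R) t : 0 <= p -> (forall x, 0 <= v x) -> rcont v t ->
  rcont (fun x => v x `^ p) t.
Proof.
rewrite le_eqVlt => /predU1P[<- v0 _|p0 v0 vt].
  by under eq_fun do rewrite powRr0; exact: rcont_cst.
have [vt0|vt0] := eqVneq (v t) 0; last first.
  apply: (rcont_comp (f := fun a => a `^ p)) => //.
  apply: differentiable_continuous; apply/derivable1_diffP; apply: derivable_powR.
  by rewrite in_itv/= andbT lt_def vt0 v0.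
apply/rcontP => e e0; have ep : 0 < e `^ p^-1 by exact: powR_gt0.
have [d d0 Hd] := (rcontP v t).1 vt _ ep; exists d => // x /Hd.
rewrite vt0 powR0 ?gt_eqF// !subr0 !ger0_norm ?powR_ge0// => vx.
have := gt0_ltr_powR p0 (v0 x) (ltW ep) vx.
by rewrite -powRrM mulVf ?gt_eqF// powRr1// ltW.
Qed.

Lemma rcont_expR v t : rcont v t -> rcont (fun x => expR (v x)) t.
Proof. by move=> vt; apply: (rcont_comp vt); exact: continuous_expR. Qed.

Lemma rcont_normc h t : ccont h t -> rcont (fun x => normc (h x)) t.
Proof.
move=> /ccontP H; apply/rcontP => e e0; have [d d0 Hd] := H _ e0; exists d => // x /Hd.
apply: le_lt_trans; have := normcD (h x - h t) (h t); have := normcD (h t - h x) (h x).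
rewrite !subrK (normcB (h t)) ler_norml.
by move: (normc (h x)) (normc (h t)) (normc (h x - h t)); clear => a b c; lra.
Qed.

Lemma rcont_Re h t : ccont h t -> rcont (fun x => Re (h x)) t.
Proof.
move=> /ccontP H; apply/rcontP => e e0; have [d d0 Hd] := H _ e0; exists d => // x /Hd.
by apply: le_lt_trans; rewrite -raddfB; exact: normc_Re.
Qed.

End RealContinuity.

(** * Polar coordinates and maxima over annuli *)

Section PolarCoordinates.
Context {R : realType}.
Implicit Types (s u : R) (t : R[i]).

Definition circ u : R[i] := cos u +i* sin u.

Lemma normc_circ u : normc (circ u) = 1.
Proof. by rewrite /= cos2Dsin2 sqrtr1. Qed.

Lemma circ_surj t : exists2 u, - pi <= u <= pi & t = (normc t)%:C * circ u.
Proof.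
have [->|t0] := eqVneq t 0.
  by exists 0; [rewrite oppr_le0 pi_ge0 | rewrite ComplexField.Normc.normc0 mul0r].
have r0 : 0 < normc t by rewrite normc_gt0.
have := sqr_normc t; move: r0; set r := normc t => r0; rewrite /r -/r.
case: t t0 @r r0 => a b t0 r r0 /= rE.
have x1 : -1 <= a / r <= 1.
  rewrite -ler_norml normrM normfV (ger0_norm (ltW r0)) ler_pdivrMr// mul1r.
  by rewrite -(ger0_norm (ltW r0)) -ler_sqr ?nnegrE// !real_normK ?num_real// rE lerDl sqr_ge0.
have sE : sin (acos (a / r)) = `|b| / r.
  rewrite sin_acos//; have -> : 1 - (a / r) ^+ 2 = (b / r) ^+ 2.
    have : b ^+ 2 = r ^+ 2 - a ^+ 2 by rewrite rE addrC addKr.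
    rewrite !exprMn => ->; field; by rewrite gt_eqF.
  by rewrite sqrtr_sqr normrM normfV (ger0_norm (ltW r0)).
have cE : cos (acos (a / r)) = a / r by apply: acosK; rewrite in_itv.
have u0 := acos_ge0 x1; have u1 := acos_lepi x1.
have rr : r != 0 by rewrite gt_eqF.
have [b0|b0] := leP 0 b.
  exists (acos (a / r)); first by rewrite u1 andbT (le_trans _ u0)// oppr_le0 pi_ge0.
  rewrite /circ cE sE ger0_norm//; apply/eqP; rewrite eq_complex /= !mul0r subr0 addr0.
  by rewrite !(mulrC r) !divfK// !eqxx.
exists (- acos (a / r)); first by rewrite lerN2 u1 (le_trans _ (@pi_ge0 R))// oppr_le0.
rewrite /circ cosN sinN cE sE ltr0_norm//; apply/eqP; rewrite eq_complex /= !mul0r subr0 addr0.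
by rewrite mulNr opprK !(mulrC r) !divfK// !eqxx.
Qed.

Lemma lipschitz1 (f df : R -> R) : (forall x : R, is_derive x 1 f (df x)) ->
  (forall x, `|df x| <= 1) -> forall u u', `|f u - f u'| <= `|u - u'|.
Proof.
move=> Df f1 u u'; wlog uu : u u' / u' <= u.
  by move=> H; have [/H//|/ltW/H] := leP u' u; rewrite distrC [X in _ <= X]distrC.
have [|c _ ->] := @MVT_segment R f df u' u uu (fun x _ => Df x).
  apply: continuous_subspaceT => x; apply: differentiable_continuous.
  by apply/derivable1_diffP; apply: ex_derive.
by rewrite normrM ler_piMl.
Qed.

Lemma circ_lip u u' : normc (circ u - circ u') <= 2 * `|u - u'|.
Proof.
apply: le_trans (normc_le_ReIm _) _ => /=; rewrite mulr2n mulrDl mul1r; apply: lerD.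
  apply: (lipschitz1 (is_derive_cos (R := R))) => x.
  by rewrite normrN ler_norml sin_geN1 sin_le1.
apply: (lipschitz1 (is_derive_sin (R := R))) => x.
by rewrite ler_norml cos_geN1 cos_le1.
Qed.

(** The annulus is a continuous image of the compact rectangle of radii and angles. The case a = 0
    gives closed discs, a = b gives circles. *)
Lemma annulus_max (v : R[i] -> R) (a b : R) : 0 <= a <= b ->
  (forall t, a <= normc t <= b -> rcont v t) ->
  exists2 t0, a <= normc t0 <= b & forall t, a <= normc t <= b -> v t <= v t0.
Proof.
move=> /andP[a0 ab] cv.
pose A := `[a, b] `*` `[- pi : R, pi].
pose P (x : R * R) : R[i] := x.1%:C * circ x.2.
have nP x : 0 <= x.1 -> normc (P x) = x.1.
  by move=> x0; rewrite ComplexField.Normc.normcM normc_circ mulr1 normc_real ger0_norm.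
have AP x : A x -> a <= normc (P x) <= b.
  move=> [H _]; have /andP[ax xb] : a <= x.1 <= b by move: H; rewrite /= in_itv.
  by rewrite nP ?ax// (le_trans a0).
have cA : compact A by apply: compact_setX; exact: segment_compact.
have A0 : A !=set0.
  by exists (a, 0); split => /=; rewrite in_itv/= ?lexx// oppr_le0 pi_ge0.
have cf : {within A, continuous (fun x => v (P x))}.
  apply: continuous_in_subspaceT => x /set_mem Ax.
  apply/cvgrPdist_lt => e e0.
  have [d d0 Hd] := (rcontP v _).1 (cv _ (AP _ Ax)) _ e0.
  have M0 : 0 < 1 + 2 * `|x.1| by rewrite ltr_pwDl// mulr_ge0.
  have h0 : 0 < d / 2 / (1 + 2 * `|x.1|) by rewrite !divr_gt0.
  have d20 : 0 < d / 4 by rewrite divr_gt0.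
  apply/(@nbhs_ballP R (R * R)%type); exists (Num.min 1 (Num.min (d / 4) (d / 2 / (1 + 2 * `|x.1|)))).
    by rewrite /= !lt_min ltr01 d20 h0.
  move=> y []; rewrite /ball /= !lt_min => /and3P[_ y1 _] /and3P[y2 _ y3].
  rewrite distrC; apply: Hd.
  have -> : P y - P x = (y.1 - x.1)%:C * circ y.2 + x.1%:C * (circ y.2 - circ x.2).
    by rewrite /P rmorphB /=; ring.
  apply: le_lt_trans (normcD _ _) _; rewrite !ComplexField.Normc.normcM normc_circ mulr1 !normc_real.
  have := circ_lip y.2 x.2 => /(ler_wpM2l (normr_ge0 x.1)) H2.
  rewrite (distrC y.1) (distrC y.2) in H2 *.
  rewrite ltr_pdivlMr// in y3.
  move: H2 y1 y3 d0 (normr_ge0 x.1) (normr_ge0 (x.2 - y.2)) M0.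
  move: `|x.1 - y.1| `|x.1| `|x.2 - y.2| (normc _) => p q s n; clear => *; nra.
have [c cin Hc] := compact_EVT_max A0 cA cf.
exists (P c); first by apply: AP; exact/set_mem.
move=> t ht; have [u hu tE] := circ_surj t.
have := Hc (normc t, u); rewrite /P /= -tE; apply; apply/mem_set.
by split => /=; rewrite in_itv.
Qed.

Lemma circle_max (v : R[i] -> R) r : 0 <= r ->
  (forall t, normc t = r -> rcont v t) ->
  exists2 t0, normc t0 = r & forall t, normc t = r -> v t <= v t0.
Proof.
move=> r0 cv; have [||t0 h H] := @annulus_max v r r; first by rewrite r0 lexx.
  by move=> t; rewrite -eq_le => /eqP/esym/cv.
exists t0; first by apply/esym/eqP; rewrite eq_le.
by move=> t tr; apply: H; rewrite tr lexx.
Qed.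

End PolarCoordinates.

(** * Maximum principle for log-subharmonic weights *)

Section LogSubharmonic.
Context {R : realType}.
Implicit Types (h : R[i] -> R[i]) (t : R[i]) (rho r : R).

Lemma ccont_big_prod (I : Type) (s : seq I) (F : I -> R[i] -> R[i]) t :
  (forall i, ccont (F i) t) -> ccont (fun x => \prod_(i <- s) F i x) t.
Proof.
move=> H; elim: s => [|i s IH].
  under eq_fun do rewrite big_nil; exact: ccont_cst.
under eq_fun do rewrite big_cons; exact: (ccontM (H i) IH).
Qed.

Lemma cdiff_big_prod (I : Type) (s : seq I) (F : I -> R[i] -> R[i]) t :
  (forall i, cdiff (F i) t) -> cdiff (fun x => \prod_(i <- s) F i x) t.
Proof.
move=> H; elim: s => [|i s IH].
  under eq_fun do rewrite big_nil; exact: cdiff_cst.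
under eq_fun do rewrite big_cons; exact: (cdiffM (H i) IH).
Qed.

Lemma ccont_big_sum (I : Type) (s : seq I) (F : I -> R[i] -> R[i]) t :
  (forall i, ccont (F i) t) -> ccont (fun x => \sum_(i <- s) F i x) t.
Proof.
move=> H; elim: s => [|i s IH].
  under eq_fun do rewrite big_nil; exact: ccont_cst.
under eq_fun do rewrite big_cons; exact: (ccontD (H i) IH).
Qed.

Lemma cdiff_big_sum (I : Type) (s : seq I) (F : I -> R[i] -> R[i]) t :
  (forall i, cdiff (F i) t) -> cdiff (fun x => \sum_(i <- s) F i x) t.
Proof.
move=> H; elim: s => [|i s IH].
  under eq_fun do rewrite big_nil; exact: cdiff_cst.
under eq_fun do rewrite big_cons; exact: (cdiffD (H i) IH).
Qed.

Lemma hol_cst rho (c : R[i]) : hol_punctured rho (fun=> c).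
Proof. by split=> [|t _]; [exact: ccont_cst | exact: cdiff_cst]. Qed.

Lemma hol_entire rho h : (forall t, cdiff h t) -> hol_punctured rho h.
Proof. by move=> H; split=> [|t _]; [exact: cdiff_cont | exact: H]. Qed.

Lemma holD rho h g : hol_punctured rho h -> hol_punctured rho g ->
  hol_punctured rho (fun t => h t + g t).
Proof.
move=> [h1 h2] [g1 g2]; split; first exact: ccontD.
by move=> t tr; apply: cdiffD; [exact: h2 | exact: g2].
Qed.

Lemma holM rho h g : hol_punctured rho h -> hol_punctured rho g ->
  hol_punctured rho (fun t => h t * g t).
Proof.
move=> [h1 h2] [g1 g2]; split; first exact: ccontM.
by move=> t tr; apply: cdiffM; [exact: h2 | exact: g2].
Qed.

Lemma hol_sum rho (I : Type) (s : seq I) (F : I -> R[i] -> R[i]) :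
  (forall i, hol_punctured rho (F i)) -> hol_punctured rho (fun t => \sum_(i <- s) F i t).
Proof.
move=> H; split; first by apply: ccont_big_sum => i; have [] := H i.
by move=> t tr; apply: cdiff_big_sum => i; have [_] := H i; exact.
Qed.

Lemma hol_prod rho (I : Type) (s : seq I) (F : I -> R[i] -> R[i]) :
  (forall i, hol_punctured rho (F i)) -> hol_punctured rho (fun t => \prod_(i <- s) F i t).
Proof.
move=> H; split; first by apply: ccont_big_prod => i; have [] := H i.
by move=> t tr; apply: cdiff_big_prod => i; have [_] := H i; exact.
Qed.

Lemma holX rho h n : hol_punctured rho h -> hol_punctured rho (fun t => h t ^+ n).
Proof.
move=> H; elim: n => [|n IH].
  under eq_fun do rewrite expr0; exact: hol_cst.
under eq_fun do rewrite exprS; exact: holM.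
Qed.

Lemma hol_le rho rho' h : rho' <= rho -> hol_punctured rho h -> hol_punctured rho' h.
Proof.
move=> le [h1 h2]; split; first exact: h1.
by move=> t /andP[t0 tr]; apply: h2; rewrite t0 (lt_le_trans tr le).
Qed.

Lemma hol_rot rho h (w : R[i]) : normc w = 1 -> hol_punctured rho h ->
  hol_punctured rho (fun t => h (w * t)).
Proof.
move=> w1 [h1 h2]; split.
  apply: (ccont_comp (h := fun t => w * t)); last by rewrite mulr0.
  by apply: ccontM; [exact: ccont_cst | exact: ccont_id].
move=> t tr; apply: (cdiff_comp (h := fun t => w * t)).
  by apply: cdiffM; [exact: cdiff_cst | exact: cdiff_id].
by apply: h2; rewrite ComplexField.Normc.normcM w1 mul1r.
Qed.

Lemma hol_rcont rho h t : 0 < rho -> hol_punctured rho h -> normc t < rho -> ccont h t.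
Proof.
move=> r0 [h1 h2] tr; have [->//|t0] := eqVneq t 0.
by apply/cdiff_cont/h2; rewrite normc_gt0 t0.
Qed.

Definition log_weight (I : finType) (h : I -> R[i] -> R[i]) (L : R[i] -> R[i])
  (a : I -> R) t := \prod_i (normc (h i t) `^ a i) * expR (Re (L t)).

Lemma log_weight_ge0 (I : finType) (h : I -> R[i] -> R[i]) L (a : I -> R) t : 0 <= log_weight h L a t.
Proof. by rewrite mulr_ge0 ?expR_ge0// prodr_ge0 => // i _; exact: powR_ge0. Qed.

Lemma log_weight_rcont (I : finType) (h : I -> R[i] -> R[i]) L (a : I -> R) t : (forall i, 0 <= a i) ->
  (forall i, ccont (h i) t) -> ccont L t -> rcont (log_weight h L a) t.
Proof.
move=> a0 ch cL; apply: rcontM.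
  apply: rcont_prod => i; apply: rcont_powR; first exact: a0.
    by move=> x; exact: normc_ge0.
  exact: rcont_normc.
exact/rcont_expR/rcont_Re.
Qed.

(** |1 + z/N|^2 = 1 + 2 Re z/N + |z|^2/N^2, and 1 + x <= e^x. Raised to the power N^2, the error
    term becomes |z|^2, which does not grow with N. *)
Lemma sqr_normc_1D_le (z : R[i]) (N : nat) : (0 < N)%N ->
  (normc (1 + z / N%:R) ^+ 2) ^+ (N ^ 2) <= expR (N%:R * Re z * 2 + normc z ^+ 2).
Proof.
move=> N0; have n0 : (0 : R) < N%:R by rewrite ltr0n.
have -> : N%:R * Re z * 2 + normc z ^+ 2 =
    (N ^ 2)%:R * (2 * Re z / N%:R + normc z ^+ 2 / N%:R ^+ 2).
  by rewrite natrX; field; rewrite gt_eqF.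
rewrite expRM_natl; apply: lerXn2r; rewrite ?nnegrE ?sqr_ge0 ?expR_ge0//.
apply: le_trans (expR_ge1Dx _); rewrite !sqr_normc.
have NE : (N%:R : R[i])^-1 = (N%:R^-1)%:C by rewrite fmorphV rmorph_nat.
rewrite NE; case: z => x y /=; rewrite !mulr0 !subr0 !add0r.
by rewrite le_eqVlt; apply/orP; left; apply/eqP; field; rewrite gt_eqF.
Qed.

(* A quantitative form of the mean value inequality for the log-subharmonic
   function [log_weight]: round the exponents [2 N a_i] up to integers, replace
   [e^L] by [(1 + L/N)^N], and let [N] tend to infinity in the mean value
   inequality of the holomorphic function so obtained. *)
Lemma log_weight_mean (I : finType) (h : I -> R[i] -> R[i]) L (a : I -> R) rho r dl :
  (forall i, hol_punctured rho (h i)) -> hol_punctured rho L -> 0 < r < rho ->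
  (forall i, 0 <= a i) -> (forall i, h i 0 = 1) -> L 0 = 0 -> 0 < dl ->
  ~ (forall t, normc t = r -> log_weight h L a t <= expR (- dl)).
Proof.
move=> hh hL /andP[r0 rrho] a0 h1 L0 dl0 H.
have rho0 := lt_trans r0 rrho.
have bd g : hol_punctured rho g -> exists2 M, 1 <= M & forall t, normc t = r -> normc (g t) <= M.
  move=> hg; have [|t0 _ Ht] := @circle_max R (fun t => normc (g t)) r (ltW r0).
    by move=> t tr; apply/rcont_normc/(hol_rcont rho0 hg); rewrite tr.
  exists (1 + normc (g t0)); first by rewrite lerDl normc_ge0.
  by move=> t /Ht /le_trans; apply; rewrite lerDr.
have [M HM] := choice (fun i => let: ex_intro2 M p q := bd _ (hh i) in ex_intro _ M (conj p q)).
have [K K1 HK] := bd _ hL.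
(* The total cost of both approximations. It does not depend on [N], while the assumed bound gains
   e^(- 2 N dl); [N] is chosen so that the gain wins. *)
pose C := \prod_i M i * expR (K ^+ 2).
have C0 : 0 < C.
  apply: mulr_gt0; last exact: expR_gt0.
  by apply: prodr_gt0 => i _; have [M1 _] := HM i; exact: lt_le_trans M1.
pose N := (Num.truncn (C / (2 * dl))).+1.
have n0 : (0 : R) < N%:R by rewrite ltr0n.
have NC : C < N%:R * 2 * dl.
  rewrite -mulrA -ltr_pdivrMr ?mulr_gt0//; apply: truncnS_gt.
(* An integer between 2 N a_i and 2 N a_i + 1: rounding costs at most one factor [M i], whatever [N]
   is. *)
pose m i := (Num.truncn ((2 * N)%:R * a i)).+1.
have m1 i : (2 * N)%:R * a i <= (m i)%:R <= (2 * N)%:R * a i + 1.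
  have x0 : 0 <= (2 * N)%:R * a i by rewrite mulr_ge0.
  by rewrite (ltW (truncnS_gt _)) -natr1 lerD2r truncn_le.
(* The exponent 2 N^2 makes the last factor an approximation of e^(2 N L), matching the power 2 N of
   the other factors. *)
pose F t := \prod_i h i t ^+ m i * (1 + L t / N%:R) ^+ (2 * N ^ 2).
have hF : hol_punctured rho F.
  apply: holM; first by apply: hol_prod => i; exact: holX.
  apply: holX; apply: holD; first exact: hol_cst.
  by apply: holM => //; exact: hol_cst.
have F0 : F 0 = 1.
  by rewrite /F L0 mul0r addr0 expr1n mulr1 big1// => i _; rewrite h1 expr1n.
have key t : normc t = r -> normc (F t) <= expR (- dl) ^+ (2 * N) * C.
  move=> tr; rewrite /F ComplexField.Normc.normcM normc_prod.
  have E1 : \prod_i normc (h i t ^+ m i) <=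
     (\prod_i (normc (h i t) `^ a i)) ^+ (2 * N) * \prod_i M i.
    rewrite -prodrXl -big_split /=; apply: ler_prod => i _.
    rewrite normc_ge0 normcX /=; have [M1 /(_ _ tr)] := HM i.
    have := normc_ge0 (h i t); move: (normc (h i t)) => x; rewrite le_eqVlt => /predU1P[<- _|x0 xM].
      rewrite expr0n /= mulr_ge0 ?exprn_ge0 ?powR_ge0// (le_trans ler01)//.
    rewrite -!powR_mulrn ?powR_ge0 ?(ltW x0)// -powRrM.
    have /andP[m2 m3] := m1 i.
    have -> : (m i)%:R = a i * (2 * N)%:R + ((m i)%:R - a i * (2 * N)%:R) by ring.
    rewrite powRD; last by rewrite (gt_eqF x0) implybT.
    rewrite ler_wpM2l ?powR_ge0//.
    apply: (@le_trans _ _ (M i `^ ((m i)%:R - a i * (2 * N)%:R))).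
      by apply: ge0_ler_powR => //; rewrite ?nnegrE ?(ltW x0)// ?subr_ge0 1?mulrC// (le_trans ler01).
    rewrite -[leRHS]powRr1 ?(le_trans ler01)//; apply: ler_powR => //.
    by rewrite lerBlDl [a i * _]mulrC.
  have E2 : normc ((1 + L t / N%:R) ^+ (2 * N ^ 2)) <= expR (Re (L t)) ^+ (2 * N) * expR (K ^+ 2).
    rewrite normcX exprM; apply: le_trans (sqr_normc_1D_le _ _) _ => //.
    rewrite -expRM_natl -expRD ler_expR; apply: lerD.
      by rewrite natrM le_eqVlt; apply/orP; left; apply/eqP; ring.
    apply: lerXn2r; rewrite ?nnegrE ?normc_ge0 ?(le_trans ler01)//; exact: HK.
  apply: le_trans (ler_pM _ _ E1 E2) _; rewrite ?normc_ge0//.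
    by apply: prodr_ge0 => i _; exact: normc_ge0.
  rewrite mulrACA -exprMn -/C; apply: ler_wpM2r; first exact: ltW.
  apply: lerXn2r; last exact: H.
    by rewrite nnegrE; exact: (log_weight_ge0 h L a t).
  by rewrite nnegrE expR_ge0.
have : Re (F 0) <= expR (- dl) ^+ (2 * N) * C.
  apply: (@circle_mean_le _ F rho r); rewrite ?r0// => t /key; apply: le_trans.
  exact: le_trans (ler_norm _) (normc_Re _).
rewrite F0 /= => /(lt_le_trans _) X.
have : expR (- dl) ^+ (2 * N) * C < 1.
  rewrite -expRM_natl mulrN expRN mulrC ltr_pdivrMr ?expR_gt0// mul1r.
  apply: lt_le_trans (expR_ge1Dx _).
  by apply: lt_trans NC _; rewrite natrM [2 * N%:R]mulrC ltrDr.
by move/X; rewrite ltxx.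
Qed.

Lemma circ_net (n : nat) (t : R[i]) : (0 < n)%N -> normc t = 1 ->
  exists k : 'I_n.+1, normc (circ (- pi + 2 * pi * k%:R / n%:R) - t) <= 4 * pi / n%:R.
Proof.
move=> n0 t1; have [u /andP[u1 u2]] := circ_surj t; rewrite t1 mul1r => tE.
have p0 : (0 : R) < pi := pi_gt0 R.
have n0' : (0 : R) < n%:R by rewrite ltr0n.
have x0 : 0 <= n%:R * (u + pi) / (2 * pi).
  apply: divr_ge0; apply: mulr_ge0 => //; last exact: ltW.
  by rewrite addrC -lerBlDl sub0r.
have kn : (Num.truncn (n%:R * (u + pi) / (2 * pi)) < n.+1)%N.
  rewrite ltnS -(ler_nat R); apply: (@le_trans _ _ (n%:R * (u + pi) / (2 * pi))); first by rewrite truncn_le.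
  by rewrite ler_pdivrMr ?mulr_gt0// ler_pM2l//; clear -u2; lra.
exists (Ordinal kn) => /=; set k := Num.truncn _.
have k1 : k%:R <= n%:R * (u + pi) / (2 * pi) by rewrite truncn_le.
have k2 : n%:R * (u + pi) / (2 * pi) < k%:R + 1 by rewrite natr1 truncnS_gt.
rewrite {1}tE; apply: le_trans (circ_lip _ _) _.
have -> : 4 * pi / n%:R = 2 * (2 * pi / n%:R) :> R by ring.
rewrite ler_pM2l// distrC.
have E (P N K U : R) : N != 0 -> P != 0 ->
   U - (- P + 2 * P * K / N) = (N * (U + P) / (2 * P) - K) * (2 * P / N).
  by move=> N0 P0; field; rewrite N0 P0.
rewrite E ?gt_eqF//.
have q0 : 0 < 2 * pi / n%:R :> R by rewrite divr_gt0 ?mulr_gt0.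
rewrite normrM (ger0_norm (ltW q0)) ler_piMl ?(ltW q0)// ger0_norm ?subr_ge0//.
by rewrite lerBlDl ltW.
Qed.

(* The strict form is obtained by multiplying over a fine net of rotations. *)
Lemma log_weight_strict (I : finType) (h : I -> R[i] -> R[i]) L (a : I -> R) rho r :
  (forall i, hol_punctured rho (h i)) -> hol_punctured rho L -> 0 < r < rho ->
  (forall i, 0 <= a i) -> (forall i, h i 0 = 1) -> L 0 = 0 ->
  (forall t, normc t = r -> log_weight h L a t <= 1) ->
  forall t, normc t = r -> log_weight h L a t = 1.
Proof.
move=> hh hL rr a0 h1 L0 H t0 t0r; apply/eqP; rewrite eq_le H//=; rewrite leNgt.
apply/negP => lt1; have /andP[r0 rrho] := rr.
have rho0 := lt_trans r0 rrho.
set g := log_weight h L a in H lt1.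
have g0 t : 0 <= g t by exact: log_weight_ge0.
set m := (1 + g t0) / 2.
have m1 : m < 1 by rewrite /m; lra.
have m2 : 0 < m by rewrite /m; have := g0 t0; lra.
have gm : 0 < m - g t0 by rewrite /m; lra.
have cg : rcont g t0.
  apply: log_weight_rcont => [//|i|].
    by apply: (hol_rcont rho0 (hh i)); rewrite t0r.
  by apply: (hol_rcont rho0 hL); rewrite t0r.
have [d d0 Hd] := (rcontP g t0).1 cg _ gm.
have p0 : (0 : R) < pi := pi_gt0 R.
pose n := (Num.truncn (r * 4 * pi / d)).+1.
have nd : r * (4 * pi / n%:R) < d.
  by rewrite !mulrA ltr_pdivrMr ?ltr0n// [d * _]mulrC -ltr_pdivrMr//; exact: truncnS_gt.
pose w (k : 'I_n.+1) := circ (- pi + 2 * pi * k%:R / n%:R : R).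
have w1 k : normc (w k) = 1 by exact: normc_circ.
have dl0 : 0 < - ln m by rewrite oppr_gt0 -ln1 ltr_ln ?posrE.
(* The product of the rotated weights is again a [log_weight], indexed by pairs. Wherever t lies on
   the circle, some rotation of the net brings it within [d] of [t0]; that factor is below [m] and
   the others are at most 1. *)
apply: (@log_weight_mean _ (fun (ik : I * 'I_n.+1) t => h ik.1 (w ik.2 * t))
  (fun t => \sum_k L (w k * t)) (fun ik => a ik.1) rho r (- ln m)) => //.
- by move=> ik; exact: hol_rot.
- by apply: hol_sum => k; exact: hol_rot.
- by move=> ik; rewrite mulr0.
- by rewrite big1// => k _; rewrite mulr0.
move=> t tr; rewrite opprK lnK//.
have -> : log_weight (fun (ik : I * 'I_n.+1) t => h ik.1 (w ik.2 * t))
  (fun t => \sum_k L (w k * t)) (fun ik => a ik.1) t = \prod_k g (w k * t).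
  rewrite /g /log_weight big_split /= exchange_big /= pair_bigA /=; congr (_ * _).
  by rewrite raddf_sum /= expR_sum.
have wt k : normc (w k * t) = r by rewrite ComplexField.Normc.normcM w1 mul1r.
have t_neq0 : t != 0 by rewrite -normc_gt0 tr.
have [|k Hk] := @circ_net n (t0 / t) (ltn0Sn _).
  by rewrite ComplexField.Normc.normcM ComplexField.Normc.normcV t0r tr divff// gt_eqF.
have gk : g (w k * t) < m.
  have /Hd : normc (w k * t - t0) < d.
    have -> : w k * t - t0 = (w k - t0 / t) * t by rewrite mulrBl divfK.
    rewrite ComplexField.Normc.normcM tr mulrC; apply: le_lt_trans nd.
    by rewrite ler_pM2l.
  by rewrite ltr_norml => /andP[_]; rewrite ltrBlDr subrK.
rewrite (bigD1 k)//=; apply: (@le_trans _ _ (g (w k * t) * 1)); last by rewrite mulr1 ltW.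
apply: ler_wpM2l => //; apply: prodr_ile1 => j _; rewrite g0 /=; exact: H.
Qed.

End LogSubharmonic.

(** * The Hermitian product of row vectors *)

Section Hermitian.
Context {R : realType}.
Implicit Types (k : R[i]).

Definition nsq n (v : 'rV[R[i]]_n) : R := \sum_i normc (v ord0 i) ^+ 2.
Definition hdot n (u v : 'rV[R[i]]_n) : R[i] := \sum_i u ord0 i * (v ord0 i)^*.

Lemma nsq_ge0 n (v : 'rV[R[i]]_n) : 0 <= nsq v.
Proof. by apply: sumr_ge0 => i _; exact: sqr_ge0. Qed.

Lemma nsq_eq0 n (v : 'rV[R[i]]_n) : (nsq v == 0) = (v == 0).
Proof.
apply/eqP/eqP => [v0|->]; last first.
  by rewrite /nsq big1// => i _; rewrite mxE ComplexField.Normc.normc0 expr0n.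
apply/rowP => i; rewrite mxE; apply/eqP; rewrite -normc_eq0 -sqrf_eq0; apply/eqP.
by apply: (psumr_eq0P _ v0) => // j _; exact: sqr_ge0.
Qed.

Lemma nsq0 n : nsq (0 : 'rV[R[i]]_n) = 0.
Proof. by apply/eqP; rewrite nsq_eq0. Qed.

Lemma nsq_gt0 n (v : 'rV[R[i]]_n) : (0 < nsq v) = (v != 0).
Proof. by rewrite lt_def nsq_ge0 nsq_eq0 andbT. Qed.

Lemma nsqZ n k (v : 'rV[R[i]]_n) : nsq (k *: v) = normc k ^+ 2 * nsq v.
Proof.
rewrite /nsq mulr_sumr; apply: eq_bigr => i _.
by rewrite mxE ComplexField.Normc.normcM exprMn.
Qed.

Lemma nsqN n (v : 'rV[R[i]]_n) : nsq (- v) = nsq v.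
Proof. by apply: eq_bigr => i _; rewrite mxE normcN'. Qed.

Lemma nsqD n (u v : 'rV[R[i]]_n) : nsq (u + v) = nsq u + nsq v + 2 * Re (hdot u v).
Proof.
rewrite /nsq /hdot raddf_sum mulr_sumr -!big_split /=; apply: eq_bigr => i _.
by rewrite mxE !sqr_normc; case: (u _ _) (v _ _) => [a b] [c d] /=; ring.
Qed.

Lemma hdotZl n k (u v : 'rV[R[i]]_n) : hdot (k *: u) v = k * hdot u v.
Proof. by rewrite /hdot mulr_sumr; apply: eq_bigr => i _; rewrite mxE mulrA. Qed.

Lemma hdotNr n (u v : 'rV[R[i]]_n) : hdot u (- v) = - hdot u v.
Proof. by rewrite /hdot -sumrN; apply: eq_bigr => i _; rewrite mxE rmorphN mulrN. Qed.

Lemma hdot0l n (v : 'rV[R[i]]_n) : hdot 0 v = 0.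
Proof. by rewrite /hdot big1// => i _; rewrite mxE mul0r. Qed.

Lemma hdotvv n (v : 'rV[R[i]]_n) : hdot v v = (nsq v)%:C.
Proof.
rewrite /hdot /nsq rmorph_sum /=; apply: eq_bigr => i _; rewrite sqr_normc.
by case: (v _ _) => a b; apply/eqP; rewrite eq_complex /=; apply/andP; split; apply/eqP; ring.
Qed.

Lemma nsqB n (u v : 'rV[R[i]]_n) : nsq (u - v) = nsq u + nsq v - 2 * Re (hdot u v).
Proof. by rewrite nsqD nsqN hdotNr raddfN /= mulrN. Qed.

(** The left-hand side is the squared length of the projection of [u] to [v], and the defect is
    nsq(u - h v). For v = 0 the left-hand side is 0. *)
Lemma cauchy_schwarz_sqr n (u v : 'rV[R[i]]_n) :
  normc (hdot u v / (nsq v)%:C) ^+ 2 * nsq v <= nsq u.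
Proof.
have [->|v0] := eqVneq v 0; first by rewrite nsq0 mulr0 nsq_ge0.
set h := _ / _; rewrite -subr_ge0.
have nv : (nsq v)%:C != 0 by rewrite -(rmorph0 (real_complex R)) (inj_eq (@complexI _)) nsq_eq0.
have -> : nsq u - normc h ^+ 2 * nsq v = nsq (u - h *: v); last exact: nsq_ge0.
rewrite -nsqZ nsqB.
suff -> : Re (hdot u (h *: v)) = nsq (h *: v) by ring.
rewrite nsqZ; have -> : hdot u (h *: v) = h^* * hdot u v.
  by rewrite /hdot mulr_sumr; apply: eq_bigr => i _; rewrite mxE rmorphM mulrCA.
have -> : hdot u v = h * (nsq v)%:C by rewrite /h divfK.
by rewrite sqr_normc; case: (h) => a b /=; ring.
Qed.

End Hermitian.

(** * Equality in the maximum principle for the gauge *)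

Section WeightMax.
Context {R : realType} (l n0 : nat) (n : 'I_l -> nat) (p : 'I_l -> R) (mu : R).
Hypotheses (p_gt0 : forall j, 0 < p j) (mu_gt0 : 0 < mu).
Implicit Types (c : forall j, R[i] -> 'rV[R[i]]_(n j)) (a : R[i] -> 'rV[R[i]]_n0).
Implicit Types (rho r m : R) (t : R[i]).

(** The gauge of the domain pulled back along a disc. The blocks [c j] are a family rather than one
    long vector, so that a single vector of exponent 1 is also covered, as needed for [phi]. *)
Definition weight c a t : R :=
  (\sum_j nsq (c j t) `^ p j) * expR (mu * nsq (a t)).

Definition hol_data rho c a :=
  (forall j k, hol_punctured rho (fun t => c j t ord0 k)) /\
  (forall k, hol_punctured rho (fun t => a t ord0 k)).

Lemma powR_le_expR (x w : R) : 0 <= x -> 0 <= w -> x `^ w <= expR (w * (x - 1)).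
Proof.
move=> x0 w0; rewrite mulrC expRM; apply: ge0_ler_powR => //; rewrite ?nnegrE ?expR_ge0//.
by rewrite -[leLHS](subrKC 1); exact: expR_ge1Dx.
Qed.

Lemma powR_lt_expR (x w : R) : 0 <= x -> 0 < w -> x != 1 -> x `^ w < expR (w * (x - 1)).
Proof.
move=> x0 w0 x1; rewrite mulrC expRM; apply: gt0_ltr_powR => //; rewrite ?nnegrE ?expR_ge0//.
by rewrite -[ltLHS](subrKC 1); apply: expR_gt1Dx; rewrite subr_eq0.
Qed.

(* If [|h| = 1 = h 0] then [|(1 + h)/2|] also attains its maximum at [0]. *)
Lemma norm1_hol_const (h : R[i] -> R[i]) rho : hol_punctured rho h -> h 0 = 1 ->
  (forall t, normc t < rho -> normc (h t) = 1) -> forall t, normc t < rho -> h t = 1.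
Proof.
move=> hh h0 h1 t tr; have [->//|t0] := eqVneq t 0.
have tr' : 0 < normc t < rho by rewrite normc_gt0 t0.
have n2 : normc (2^-1 : R[i]) = 2^-1.
  by rewrite ComplexField.Normc.normcV -(rmorph_nat (real_complex R)) normc_real ger0_norm.
have := @log_weight_strict R unit (fun _ t => (1 + h t) * 2^-1) (fun=> 0) (fun=> 1) rho (normc t).
rewrite /log_weight; move=> /(_ (fun=> holM (holD (hol_cst rho 1) hh) (hol_cst rho _))).
move=> /(_ (hol_cst rho 0) tr' (fun=> ler01)); rewrite h0.
have E s : \prod_(i : unit) normc ((1 + h s) / 2) `^ 1 * expR (complex.Re 0) = normc (1 + h s) / 2.
  rewrite expR0 mulr1 (big_pred1 tt) => [|[]//].
  by rewrite powRr1 ?normc_ge0// ComplexField.Normc.normcM n2.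
move=> H; have := H (fun=> divff _) erefl; rewrite -[1 + 1]/(2%:R) pnatr_eq0.
move=> /(_ erefl); move=> H'.
have {H'}: normc (1 + h t) / 2 = 1.
  rewrite -E; apply: H' => // s ts; rewrite E ler_pdivrMr// mul1r.
  apply: le_trans (normcD _ _) _; rewrite ComplexField.Normc.normc1 h1//; last first.
    by rewrite ts; case/andP: tr'.
move/(canRL (divfK _)); rewrite pnatr_eq0 mul1r => /(_ isT) /(congr1 (fun x => x ^+ 2)).
have /(congr1 (fun x => x ^+ 2)) := h1 t tr; rewrite !sqr_normc.
case: (h t) => x y /= e1 e2; have x1 : x = 1 by lra.
apply/eqP; rewrite eq_complex /= x1 eqxx /= -sqrf_eq0.
by apply/eqP; move: e1; rewrite x1; lra.
Qed.

Lemma weight_ge0 c a t : 0 <= weight c a t.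
Proof.
by rewrite mulr_ge0 ?expR_ge0// sumr_ge0// => j _; exact: powR_ge0.
Qed.

Lemma hol_hdot rho k (v : R[i] -> 'rV[R[i]]_k) w :
  (forall i, hol_punctured rho (fun t => v t ord0 i)) ->
  hol_punctured rho (fun t => hdot (v t) w).
Proof. by move=> hv; apply: hol_sum => i; apply: holM => //; exact: hol_cst. Qed.

(* With [h_j] the normalised projection of [c_j] to [c_j 0], the [j]-th term of
   [weight] is at least [w_j * X_j], and [X <= e^(X - 1)] turns the bound on
   [sum w_j X_j] into a bound on a [log_weight], which is therefore constant. *)
Lemma weight_const rho c a : hol_data rho c a ->
  (forall t, normc t < rho -> weight c a t <= weight c a 0) -> 0 < weight c a 0 ->
  forall t, normc t < rho -> a t = a 0 /\ forall j, c j t = c j 0.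
Proof.
move=> [hc ha] umax u0.
pose w j := nsq (c j 0) `^ p j * expR (mu * nsq (a 0)).
have w0 j : 0 <= w j by rewrite mulr_ge0 ?powR_ge0 ?expR_ge0.
pose W := \sum_j w j.
have WE : weight c a 0 = W by rewrite /weight mulr_suml.
have W0 : 0 < W by rewrite -WE.
(* The value 1 for a block vanishing at 0 only keeps [h j 0 = 1]; the exponent [al j] of that block
   is 0. *)
pose h j t := if c j 0 == 0 then 1 else hdot (c j t) (c j 0) / (nsq (c j 0))%:C.
(* Re L is mu W times the part of nsq (a t) - nsq (a 0) that is the real part of a function
   holomorphic in t. The other part, nsq (a t - a 0), is nonnegative and becomes the surplus factor
   in [prodE]. *)
pose L t := (2 * mu * W)%:C * hdot (a t - a 0) (a 0).
have hh j : hol_punctured rho (h j).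
  rewrite /h; case: eqP => _; first exact: hol_cst.
  by apply: holM; [exact: hol_hdot | exact: hol_cst].
have hL : hol_punctured rho L.
  apply: holM; first exact: hol_cst.
  apply: hol_hdot => i; have -> : (fun t => (a t - a 0) ord0 i) = (fun t => a t ord0 i + - a 0 ord0 i).
    by apply/funext => t; rewrite !mxE.
  by apply: holD; [exact: ha | exact: hol_cst].
have h0 j : h j 0 = 1.
  rewrite /h; case: eqP => // /eqP c0; rewrite hdotvv divff//.
  by rewrite -(rmorph0 (real_complex R)) (inj_eq (@complexI _)) nsq_eq0.
have L0 : L 0 = 0 by rewrite /L subrr hdot0l mulr0.
pose al j := w j * (2 * p j).
have al0 j : 0 <= al j by rewrite mulr_ge0// mulr_ge0// ltW.
pose dv t := 2 * Re (hdot (a t - a 0) (a 0)) + nsq (a t - a 0).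
have nsqa t : nsq (a t) = nsq (a 0) + dv t.
  by rewrite -[in LHS](subrK (a 0) (a t)) nsqD /dv; ring.
pose X j t := normc (h j t) `^ (2 * p j) * expR (mu * dv t).
have X0 j t : 0 <= X j t by rewrite mulr_ge0 ?powR_ge0 ?expR_ge0.
have term j t : w j * X j t <= nsq (c j t) `^ p j * expR (mu * nsq (a t)).
  rewrite (nsqa t) (mulrDr mu (nsq (a 0)) (dv t)) (expRD (mu * nsq (a 0))) /w /X mulrACA.
  rewrite ler_wpM2r ?mulr_ge0 ?expR_ge0//.
  have [c0|c0] := eqVneq (c j 0) 0.
    by rewrite c0 nsq0 powR0 ?gt_eqF// mul0r powR_ge0.
  rewrite powRrM powR_mulrn ?normc_ge0// -powRM ?nsq_ge0 ?sqr_ge0//.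
  apply: ge0_ler_powR; first exact: ltW.
  - by rewrite nnegrE mulr_ge0 ?nsq_ge0 ?sqr_ge0.
  - by rewrite nnegrE nsq_ge0.
  - by rewrite mulrC /h (negbTE c0); exact: cauchy_schwarz_sqr.
have sumX t : normc t < rho -> \sum_j w j * X j t <= W.
  move=> tr; rewrite -WE; apply: le_trans (umax _ tr).
  by rewrite /weight mulr_suml; apply: ler_sum => j _; exact: term.
have prodE t : log_weight h L al t * expR (mu * W * nsq (a t - a 0)) = \prod_j X j t `^ w j.
  rewrite /log_weight -mulrA -expRD.
  have -> : Re (L t) + mu * W * nsq (a t - a 0) = \sum_j w j * (mu * dv t).
    rewrite -mulr_suml -/W /L /dv.
    by case: (hdot _ _) => x y /=; rewrite mul0r subr0; ring.
  rewrite expR_sum -big_split; apply: eq_bigr => j _ /=.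
  rewrite /X powRM ?powR_ge0 ?expR_ge0// -powRrM mulrC.
  by rewrite -expRM [mu * _ * w j]mulrC mulrC /al [w j * (2 * p j)]mulrC.
have prodle t : normc t < rho -> \prod_j expR (w j * (X j t - 1)) <= 1.
  move=> tr; rewrite -expR_sum -[leRHS]expR0 ler_expR.
  rewrite (eq_bigr (fun j => w j * X j t - w j)); last by move=> j _; rewrite (mulrBr (w j) (X j t) 1) (mulr1 (w j)).
  by rewrite sumrB subr_le0 sumX.
have prodle1 t : normc t < rho -> \prod_j X j t `^ w j <= 1.
  move=> tr; apply: le_trans (prodle _ tr); apply: ler_prod => j _.
  by rewrite powR_ge0 powR_le_expR.
have lw t : normc t < rho -> log_weight h L al t = 1.
  move=> tr; have [->|t0] := eqVneq t 0.
    rewrite /log_weight L0 expR0 mulr1 big1// => j _.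
    by rewrite h0 ComplexField.Normc.normc1 powR1.
  have tr' : 0 < normc t < rho by rewrite normc_gt0 t0.
  apply: (@log_weight_strict _ _ _ _ _ rho (normc t)) => // s st.
  apply: le_trans (prodle1 s _); last by rewrite st.
  rewrite -prodE ler_peMr ?log_weight_ge0//.
  rewrite -[leLHS]expR0 ler_expR; apply: mulr_ge0; last exact: nsq_ge0.
  by apply: mulr_ge0; exact: ltW.
(* Since the [log_weight] is 1 and the product is at most 1, the surplus factor e^(mu W nsq (a t - a
   0)) is at most 1. *)
have aE t : normc t < rho -> a t = a 0.
  move=> tr; have := prodle1 t tr; rewrite -prodE lw// mul1r -[leRHS]expR0 ler_expR => H.
  apply/eqP; rewrite -subr_eq0 -nsq_eq0 eq_le nsq_ge0 andbT.
  by move: H; rewrite pmulr_rle0// mulr_gt0.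
(* X < e^(X - 1) is strict for X != 1: a single such factor with w_j > 0 would push the product,
   which is 1, strictly below 1. *)
have XE j t : normc t < rho -> c j 0 != 0 -> X j t = 1.
  move=> tr c0; apply/eqP; apply: contraT => X1; exfalso.
  have wj : 0 < w j by rewrite mulr_gt0 ?expR_gt0// powR_gt0// nsq_gt0.
  have : \prod_j X j t `^ w j = 1.
    by rewrite -prodE lw// aE// subrr nsq0 mulr0 expR0 mulr1.
  rewrite (bigD1 j)//= => E1; have := prodle t tr; rewrite (bigD1 j)//= => E2.
  suff : 1 < 1 :> R by rewrite ltxx.
  rewrite -{1}E1; apply: lt_le_trans E2.
  apply: (@le_lt_trans _ _ (X j t `^ w j * \prod_(i < l | i != j) expR (w i * (X i t - 1)))).
    apply: ler_wpM2l; first exact: powR_ge0.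
    by apply: ler_prod => i _; rewrite powR_ge0 powR_le_expR.
  rewrite ltr_pM2r; first exact: powR_lt_expR.
  by apply: prodr_gt0 => i _; exact: expR_gt0.
have hn j t : normc t < rho -> c j 0 != 0 -> normc (h j t) = 1.
  move=> tr c0; have := XE j t tr c0; rewrite /X /dv aE// subrr hdot0l nsq0 mulr0 addr0 mulr0 expR0 mulr1.
  move=> E; have {E} : normc (h j t) `^ (2 * p j) = 1 `^ (2 * p j) by rewrite E powR1.
  move=> /powR_injective; apply.
  - by rewrite mulr_gt0.
  - by rewrite nnegrE normc_ge0.
  - by rewrite nnegrE ler01.
(* Each term is at least [w j] while the sum is at most [W], so every term equals its value at 0. *)
have termE j t : normc t < rho -> nsq (c j t) `^ p j * expR (mu * nsq (a t)) = w j.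
  move=> tr; have wX i : w i * X i t = w i.
    have [c0|c0] := eqVneq (c i 0) 0; last by rewrite XE// mulr1.
    by rewrite /w c0 nsq0 powR0 ?gt_eqF// !mul0r.
  have ge i : true -> w i <= nsq (c i t) `^ p i * expR (mu * nsq (a t)).
    by move=> _; rewrite -[leLHS]wX; exact: term.
  have := umax t tr; rewrite WE /weight mulr_suml => le.
  have E : \sum_i (nsq (c i t) `^ p i * expR (mu * nsq (a t)) - w i) = 0.
    apply/eqP; rewrite eq_le sumrB subr_le0 le /= subr_ge0.
    by apply: ler_sum.
  have ge0 i : true -> 0 <= nsq (c i t) `^ p i * expR (mu * nsq (a t)) - w i.
    by move=> _; rewrite subr_ge0; exact: ge.
  by apply/eqP; rewrite -subr_eq0; apply/eqP; exact: (psumr_eq0P ge0 E).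
have nE j t : normc t < rho -> nsq (c j t) = nsq (c j 0).
  move=> tr; have := termE j t tr; rewrite /w aE// => /(mulIf (lt0r_neq0 (expR_gt0 _))).
  move=> /powR_injective; apply; rewrite ?nnegrE ?nsq_ge0//.
move=> t tr; split; first exact: aE.
move=> j; have [c0|c0] := eqVneq (c j 0) 0.
  by rewrite c0; apply/eqP; rewrite -nsq_eq0 nE// c0 nsq0.
(* The projection of [c j t] to [c j 0] is [c j 0] itself; since the norms agree as well, there is
   no orthogonal component. *)
have h1 : h j t = 1 by apply: (norm1_hol_const (hh j)) => // s sr; exact: hn.
apply/eqP; rewrite -subr_eq0 -nsq_eq0 nsqB nE//.
have nv : (nsq (c j 0))%:C != 0.
  by rewrite -(rmorph0 (real_complex R)) (inj_eq (@complexI _)) nsq_eq0.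
move: h1; rewrite /h (negbTE c0) => /(canRL (divfK nv)) ->; rewrite mul1r /=.
by apply/eqP; ring.
Qed.

End WeightMax.

Section WeightMaximum.
Context {R : realType} (l n0 : nat) (n : 'I_l -> nat) (p : 'I_l -> R) (mu : R).
Hypotheses (p_gt0 : forall j, 0 < p j) (mu_gt0 : 0 < mu).
Implicit Types (c : forall j, R[i] -> 'rV[R[i]]_(n j)) (a : R[i] -> 'rV[R[i]]_n0).
Implicit Types (rho r m : R) (t : R[i]).

Lemma rcont_nsq k (v : R[i] -> 'rV[R[i]]_k) t :
  (forall i, ccont (fun t => v t ord0 i) t) -> rcont (fun t => nsq (v t)) t.
Proof.
move=> cv; apply: rcont_sum => i; under eq_fun do rewrite expr2.
by apply: rcontM; exact: (rcont_normc (cv i)).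
Qed.

Lemma weight_rcont rho c a t : 0 < rho -> hol_data rho c a -> normc t < rho ->
  rcont (weight p mu c a) t.
Proof.
move=> r0 [hc ha] tr; apply: rcontM.
  apply: rcont_sum => j; apply: rcont_powR; first exact: ltW.
    by move=> x; exact: nsq_ge0.
  by apply: rcont_nsq => i; exact: hol_rcont r0 (hc j i) tr.
apply: rcont_expR; apply: rcontM; first exact: rcont_cst.
by apply: rcont_nsq => i; exact: hol_rcont r0 (ha i) tr.
Qed.

(** A disc about [t0] of radius at most |t0| avoids the puncture, so the shifted function is
    differentiable on all of it. *)
Lemma hol_shift rho d (h : R[i] -> R[i]) t0 : 0 < d -> hol_punctured rho h ->
  d <= normc t0 -> normc t0 + d <= rho -> hol_punctured d (fun s => h (t0 + s)).
Proof.
move=> d0 [_ dh] dt dr.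
have H s : normc s < d -> cdiff (fun s => h (t0 + s)) s.
  move=> sd; apply: (cdiff_comp (h := fun s => t0 + s)).
    by apply: cdiffD; [exact: cdiff_cst | exact: cdiff_id].
  apply: dh; apply/andP; split; last first.
    by apply: le_lt_trans (normcD _ _) _; apply: lt_le_trans dr; rewrite ltrD2l.
  have := normcD (t0 + s) (- s); rewrite addrK normcN' => h1.
  rewrite -(ltrD2r (normc s)) add0r; apply: lt_le_trans h1.
  exact: lt_le_trans sd dt.
split=> [|s /andP[_ sd]]; last exact: H.
by apply/cdiff_cont/H; rewrite ComplexField.Normc.normc0.
Qed.

(** Approach [t1] along the radius. This is the way from a disc on which a function is constant to a
    boundary point with separate information: the outer circle or the puncture. *)
Lemma rcont_reach (v : R[i] -> R) t0 t1 d M : 0 < d -> normc (t1 - t0) = d ->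
  rcont v t1 -> (forall s, normc s < d -> v (t0 + s) = M) -> v t1 = M.
Proof.
move=> d0 td cv H; apply/eqP; rewrite -subr_eq0; apply/negP => /negP ne.
have e0 : 0 < `|v t1 - M| by rewrite normr_gt0.
have [d' d'0 Hd] := (rcontP v t1).1 cv _ e0.
pose e := Num.min (1/2) (d' / (2 * d)).
have e1 : 0 < e by rewrite lt_min !divr_gt0// mulr_gt0.
have e2 : e < 1 by rewrite gt_min ltr_pdivrMr// mul1r ltr1n.
have e3 : e * d < d'.
  rewrite -ltr_pdivlMr// gt_min; apply/orP; right; rewrite invfM mulrA.
  by rewrite ltr_pM2r ?invr_gt0// ltr_pdivrMr// ltr_pMr// ltr1n.
have := Hd (t0 + (1 - e)%:C * (t1 - t0)).
have -> : t0 + (1 - e)%:C * (t1 - t0) - t1 = (- e)%:C * (t1 - t0).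
  by rewrite rmorphB rmorphN rmorph1 /=; ring.
rewrite ComplexField.Normc.normcM normc_real td normrN ger0_norm ?(ltW e1)// => /(_ e3).
rewrite H; first by rewrite distrC ltxx.
rewrite ComplexField.Normc.normcM normc_real td ger0_norm ?subr_ge0 ?(ltW e2)//.
by rewrite gtr_pMl// ltrBlDr ltrDl.
Qed.

(** Suppose the maximum over the closed disc exceeds [m] and is attained at [t0]. The weight is
    constant on the largest disc about [t0] that avoids 0 and stays inside; this disc touches either
    the outer circle, a contradiction, or 0. In the latter case the maximum is also attained at 0,
    and the disc about 0 reaches the outer circle. Two discs thus replace a connectedness
    argument. *)
Lemma weight_max rho c a r m : hol_data rho c a -> 0 < r < rho ->
  (forall t, normc t = r -> weight p mu c a t <= m) ->
  forall t, normc t <= r -> weight p mu c a t <= m.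
Proof.
move=> hca /andP[r0 rrho] Hm; have rho0 := lt_trans r0 rrho.
have [hc ha] := hca; set u := weight p mu c a in Hm *.
have cu t : normc t <= r -> rcont u t.
  by move=> tr; apply: weight_rcont rho0 hca _; exact: le_lt_trans rrho.
have m0 : 0 <= m.
  apply: le_trans (Hm r%:C _); first exact: weight_ge0.
  by rewrite normc_real ger0_norm// ltW.
have cu' t : 0 <= normc t <= r -> rcont u t by move=> /andP[_]; exact: cu.
have [|t0 /andP[_ t0r] Ht0] := annulus_max _ cu'; first by rewrite lexx ltW.
move=> t tr; apply: le_trans (Ht0 t _) _; first by rewrite normc_ge0.
rewrite leNgt; apply/negP => mM.
have M0 : 0 < u t0 by exact: le_lt_trans mM.
have t0r' : normc t0 < r.
  by rewrite lt_neqAle t0r andbT; apply: contraTneq mM => /Hm; rewrite leNgt.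
have le t' : normc t' <= r -> u t' <= u t0.
  by move=> h; apply: Ht0; rewrite normc_ge0.
have center : u 0 = u t0 -> False.
  move=> u0; have cst s : normc s < r -> u s = u t0.
    move=> sr; have hca' : hol_data r c a.
      by split=> *; apply: hol_le (ltW rrho) _; [exact: hc | exact: ha].
    have [||aE cE] := weight_const p_gt0 mu_gt0 hca' _ _ sr.
    - by move=> x xr; rewrite -/u u0; apply: le; exact: ltW.
    - by rewrite -/u u0.
    by rewrite -u0 /u /weight aE; congr (_ * _); apply: eq_bigr => j _; rewrite cE.
  have nr : normc (r%:C : R[i]) = r by rewrite normc_real ger0_norm// ltW.
  have := @rcont_reach u 0 r%:C r (u t0) r0; rewrite subr0 => /(_ nr) H.
  have := Hm _ nr; rewrite H ?leNgt ?mM//; first by apply: cu; rewrite nr.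
  by move=> s sr; rewrite add0r cst.
have [t00|t0_neq0] := eqVneq t0 0; first by apply: center; rewrite t00.
have n0' : 0 < normc t0 by rewrite normc_gt0.
pose d := Num.min (normc t0) (r - normc t0).
have d0 : 0 < d by rewrite lt_min n0' subr_gt0.
have d1 : d <= normc t0 by rewrite ge_min lexx.
have d2 : normc t0 + d <= r by rewrite -lerBrDl ge_min lexx orbT.
have cst s : normc s < d -> u (t0 + s) = u t0.
  move=> sd.
  have hca' : hol_data d (fun j s => c j (t0 + s)) (fun s => a (t0 + s)).
    have dd := le_trans d2 (ltW rrho).
    by split=> [j k|k]; [exact: (hol_shift d0 (hc j k) d1 dd) | exact: (hol_shift d0 (ha k) d1 dd)].
  have [||aE cE] := weight_const p_gt0 mu_gt0 hca' _ _ sd.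
  - move=> x xd; have := le (t0 + x); rewrite /u /weight addr0; apply.
    by apply: le_trans (normcD _ _) _; apply: le_trans d2; rewrite lerD2l ltW.
  - by move: M0; rewrite /u /weight addr0.
  rewrite /u /weight aE addr0; congr (_ * _); apply: eq_bigr => j _.
  by rewrite cE addr0.
have [h|h] := leP (normc t0) (r - normc t0).
  apply: center; apply: (@rcont_reach u t0 0 d _ d0) => //.
    by rewrite sub0r normcN' /d min_l.
  by apply: cu; rewrite ComplexField.Normc.normc0 ltW.
pose t1 := t0 * (r / normc t0)%:C.
have rn : 0 < r / normc t0 by rewrite divr_gt0.
have t1r : normc t1 = r.
  by rewrite ComplexField.Normc.normcM normc_real ger0_norm ?(ltW rn)// mulrC divfK// gt_eqF.
have := Hm _ t1r; rewrite (@rcont_reach u t0 t1 d (u t0) d0) ?leNgt ?mM//; last first.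
  by apply: cu; rewrite t1r.
have -> : t1 - t0 = t0 * (r / normc t0 - 1)%:C.
  by rewrite /t1 rmorphB rmorph1 /= mulrBr mulr1.
rewrite ComplexField.Normc.normcM normc_real ger0_norm; last first.
  by rewrite subr_ge0 ler_pdivlMr// mul1r ltW.
by rewrite mulrBr mulr1 mulrC divfK ?gt_eqF// /d min_r// ltW.
Qed.

End WeightMaximum.

(** * Complex lines and difference quotients *)

Section Slices.
Context {R : realType}.

Lemma line_cdiff (V W : normedModType R[i]) (F : V -> W) (g : W -> R[i]^o) (x v : V) (t : R[i]) :
  differentiable F (x + t *: v) -> differentiable g (F (x + t *: v)) ->
  cdiff (fun t => g (F (x + t *: v))) t.
Proof.
move=> dF dg; split.
have d0 : differentiable (fun t : R[i]^o => x + t *: v) (t : R[i]^o).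
  apply: differentiableD; first exact: differentiable_cst.
  by apply: differentiableZl; apply/derivable1_diffP; exact: derivable_id.
have d1 := @differentiable_comp (R[i] : numFieldType) R[i]^o V W _ F t d0 dF.
exact: (@differentiable_comp (R[i] : numFieldType) R[i]^o W R[i]^o _ g t d1 dg).
Qed.

Lemma line_diff_quotient (V W : normedModType R[i]) (F : V -> W) (x v : V) (e : R) :
  differentiable F x -> 0 < e ->
  exists2 d, 0 < d & forall t : R[i], 0 < normc t < d ->
   ball ('d F x v) e%:C (t^-1 *: (F (x + t *: v) - F x)).
Proof.
move=> dF e0; have dv : derivable F x v by exact: diff_derivable.
have H : (fun h : R[i]^o => h^-1 *: ((F \o shift x) (h *: v) - F x)) @ 0^' --> 'd F x v.
  by rewrite -deriveE//; exact: dv.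
have e0' : 0 < e%:C by rewrite ltcR.
have H' := (cvg_ballP _ _).1 H _ e0'.
have /nbhs_ballP[d /= d0 Hd] : \forall t \near (0 : R[i]^o), t != 0 ->
    ball ('d F x v) e%:C (t^-1 *: ((F \o shift x) (t *: v) - F x)).
  exact: H'.
have [dE d0'] := gt0_real d0; exists (Re d) => // t /andP[t0 td].
have := Hd t; rewrite /ball/= sub0r normrN normE dE ltcR => /(_ td).
by rewrite -normc_gt0 => /(_ t0); rewrite [t *: v + x]addrC.
Qed.

Definition fdiff (V W : normedModType R[i]) (F : V -> W) (x v : V) : W := 'd F x v.

Lemma fdiff_linear (V W : normedModType R[i]) (F : V -> W) (x u v : V) (k : R[i]) :
  fdiff F x (k *: u + v) = k *: fdiff F x u + fdiff F x v.
Proof. by rewrite /fdiff linearP. Qed.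

Variables (m N m' N' : nat).
Local Notation V := ('rV[R[i]]_m * 'rV[R[i]]_N)%type.
Local Notation W := ('rV[R[i]]_m' * 'rV[R[i]]_N')%type.
Implicit Types (F : V -> W) (D : set V) (x v : V) (t : R[i]).

Lemma line_cdiff1 F D x v t k : holomorphic_on D F -> D (x + t *: v) ->
  cdiff (fun t => (F (x + t *: v)).1 ord0 k) t.
Proof.
move=> hF /hF dF; apply: (line_cdiff (g := fun y : W => y.1 ord0 k) dF).
apply: (@differentiable_comp (R[i] : numFieldType) W _ R[i]^o fst (fun M => M ord0 k)).
  by apply: linear_differentiable => y; exact: cvg_fst.
exact: differentiable_coord.
Qed.

Lemma line_cdiff2 F D x v t k : holomorphic_on D F -> D (x + t *: v) ->
  cdiff (fun t => (F (x + t *: v)).2 ord0 k) t.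
Proof.
move=> hF /hF dF; apply: (line_cdiff (g := fun y : W => y.2 ord0 k) dF).
apply: (@differentiable_comp (R[i] : numFieldType) W _ R[i]^o snd (fun M => M ord0 k)).
  by apply: linear_differentiable => y; exact: cvg_snd.
exact: differentiable_coord.
Qed.

Lemma coord_quotient F D x v (e : R) : holomorphic_on D F -> D x -> 0 < e ->
  exists2 d, 0 < d & forall t, 0 < normc t < d ->
   (forall k, normc (t^-1 * ((F (x + t *: v)).1 ord0 k - (F x).1 ord0 k) - (fdiff F x v).1 ord0 k) < e) /\
   (forall k, normc (t^-1 * ((F (x + t *: v)).2 ord0 k - (F x).2 ord0 k) - (fdiff F x v).2 ord0 k) < e).
Proof.
move=> hF /hF dF e0; have [d d0 Hd] := line_diff_quotient v dF e0.
exists d => // t /Hd [[_ H1] [_ H2]].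
by split=> k; [have := H1 ord0 k | have := H2 ord0 k];
  rewrite /ball /= !mxE normE ltcR normcB.
Qed.

(** Continuity at t = 0 is the definition of the derivative; elsewhere the quotient is a product of
    differentiable functions. This is precisely the pattern of [hol_punctured]. *)
Lemma quotient2_hol F D x v (rho : R) : holomorphic_on D F -> 0 < rho ->
  (forall t, normc t < rho -> D (x + t *: v)) ->
  forall k, hol_punctured rho (fun t => (if t == 0 then (fdiff F x v).2 else
    t^-1 *: ((F (x + t *: v)).2 - (F x).2)) ord0 k).
Proof.
move=> hF rho0 HD k; have Dx : D x.
  by have := HD 0; rewrite scale0r addr0; apply; rewrite ComplexField.Normc.normc0.
split.
  apply/ccontP => e e0; have [d d0 Hd] := coord_quotient v hF Dx e0.
  exists d => // t; rewrite subr0 eqxx; case: eqP => [_ _|/eqP t0 td].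
    by rewrite subrr ComplexField.Normc.normc0.
  by have [|_ /(_ k)] := Hd t; [rewrite normc_gt0 t0 | rewrite !mxE].
move=> t /andP[t0 td].
pose q s := s^-1 * ((F (x + s *: v)).2 ord0 k + - (F x).2 ord0 k).
have dq : cdiff q t.
  apply: cdiffM.
    by apply: cdiffV; [rewrite -normc_gt0 | exact: cdiff_id].
  by apply: cdiffD; [exact: line_cdiff2 hF (HD _ td) | exact: cdiff_cst].
apply: (cdiff_near dq t0) => s st; rewrite /q.
case: eqP => [s0|_]; last by rewrite !mxE.
by move: st; rewrite s0 sub0r normcN' ltxx.
Qed.

End Slices.

(** * The Schwarz lemma on the domain *)

Section Domain.
Context {R : realType} (l n0 : nat) (n : 'I_l -> nat) (p : 'I_l -> R) (mu : R).
Hypotheses (p_gt0 : forall j, 0 < p j) (mu_gt0 : 0 < mu).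
Local Notation N := (\sum_(j < l) n j)%N.
Local Notation V := ('rV[R[i]]_n0 * 'rV[R[i]]_N)%type.
Local Notation D := (FBH_domain n0 n p mu).
Implicit Types (z : 'rV[R[i]]_n0) (w : 'rV[R[i]]_N) (t : R[i]) (f g : V -> V).

Definition block_psum w : R := \sum_j nsq (submxrow w j) `^ p j.
Definition rhoD z w : R := block_psum w * expR (mu * nsq z).

Lemma hermitian_normE k (v : 'rV[R[i]]_k) (q : R) : hermitian_norm v `^ (2 * q) = nsq v `^ q.
Proof.
rewrite powRrM -[2]/(2%:R) powR_mulrn ?sqrtr_ge0// sqr_sqrtr//; exact: nsq_ge0.
Qed.

Lemma domE z w : D (z, w) <-> rhoD z w < 1.
Proof.
rewrite /FBH_domain /= /rhoD /block_psum; under eq_bigr do rewrite hermitian_normE.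
have -> : hermitian_norm z ^+ 2 = nsq z by rewrite sqr_sqrtr//; exact: nsq_ge0.
by rewrite mulNr expRN -ltr_pdivlMr ?expR_gt0// mul1r.
Qed.

Lemma submxrowZ t w j : submxrow (t *: w) j = t *: submxrow w j.
Proof. by apply/rowP => k; rewrite !mxE. Qed.

Lemma submxrow_eq w w' : (forall j, submxrow w j = submxrow w' j) -> w = w'.
Proof.
by move=> H; rewrite -[w]submxrowK -[w']submxrowK; apply: eq_mxrow.
Qed.

Lemma submxrow0 j : submxrow (0 : 'rV[R[i]]_N) j = 0.
Proof. by apply/rowP => k; rewrite !mxE. Qed.

Lemma psum_ge0 w : 0 <= block_psum w.
Proof. by apply: sumr_ge0 => j _; exact: powR_ge0. Qed.

Lemma psum0 : block_psum 0 = 0.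
Proof. by rewrite /block_psum big1// => j _; rewrite submxrow0 nsq0 powR0 ?gt_eqF. Qed.

Lemma psum_gt0 w : w != 0 -> 0 < block_psum w.
Proof.
move=> w0; rewrite lt_def psum_ge0 andbT; apply: contra w0 => /eqP H.
apply/eqP/submxrow_eq => j; rewrite submxrow0; apply/eqP; rewrite -nsq_eq0; apply/eqP.
have /(_ j isT) := psumr_eq0P (fun j _ => powR_ge0 (nsq (submxrow w j)) (p j)) H.
exact: powR_eq0_eq0.
Qed.

Lemma psumZ t w : block_psum (t *: w) = \sum_j (normc t ^+ 2) `^ p j * nsq (submxrow w j) `^ p j.
Proof.
apply: eq_bigr => j _; rewrite submxrowZ nsqZ powRM ?nsq_ge0 ?sqr_ge0//.
Qed.

Lemma psumZ_lt t t' w : w != 0 -> normc t < normc t' -> block_psum (t *: w) < block_psum (t' *: w).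
Proof.
move=> w0 tt; rewrite !psumZ.
have sq : normc t ^+ 2 < normc t' ^+ 2 by rewrite ltr_sqr ?nnegrE ?normc_ge0.
have le j : (normc t ^+ 2) `^ p j < (normc t' ^+ 2) `^ p j.
  by apply: gt0_ltr_powR; rewrite ?nnegrE ?sqr_ge0.
have [j wj] : exists j, submxrow w j != 0.
  apply: contrapT => H; move/eqP: w0; apply; apply: submxrow_eq => j.
  by rewrite submxrow0; apply/eqP; apply: contraT => wj; case: H; exists j.
rewrite (bigD1 j)//= [ltRHS](bigD1 j)//=; apply: ltr_leD.
  by rewrite ltr_pM2r// powR_gt0// nsq_gt0.
by apply: ler_sum => i _; rewrite ler_wpM2r ?powR_ge0// ltW.
Qed.

Lemma psumZ_rcont w t : rcont (fun t => block_psum (t *: w)) t.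
Proof.
apply: rcont_sum => j; apply: rcont_powR; first exact: ltW.
  by move=> x; exact: nsq_ge0.
apply: rcont_nsq => k.
have -> : (fun t => submxrow (t *: w) j ord0 k) = (fun t => t * submxrow w j ord0 k).
  by apply/funext => s; rewrite !mxE.
by apply: ccontM; [exact: ccont_id | exact: ccont_cst].
Qed.

Lemma psumZ_surj w (y : R) : w != 0 -> 0 < y -> exists2 s : R, 0 < s & block_psum (s%:C *: w) = y.
Proof.
move=> w0 y0.
have [j wj] : exists j, submxrow w j != 0.
  apply: contrapT => H; move/eqP: w0; apply; apply: submxrow_eq => j.
  by rewrite submxrow0; apply/eqP; apply: contraT => wj; case: H; exists j.
have nj : 0 < nsq (submxrow w j) by rewrite nsq_gt0.
(* At this scale block [j] alone already contributes [y], which gives the upper end for the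
   intermediate value theorem. *)
pose b := Num.sqrt (y `^ (p j)^-1 / nsq (submxrow w j)).
have b0 : 0 < b by rewrite sqrtr_gt0 divr_gt0// powR_gt0.
have yb : y <= block_psum (b%:C *: w).
  rewrite /block_psum (bigD1 j)//= submxrowZ nsqZ normc_real ger0_norm ?(ltW b0)//.
  rewrite sqr_sqrtr ?divr_ge0 ?powR_ge0 ?(ltW nj)// divfK ?gt_eqF// -powRrM mulVf ?gt_eqF//.
  by rewrite powRr1 ?(ltW y0)// lerDl sumr_ge0// => i _; exact: powR_ge0.
have cf : {within `[0, b], continuous (fun s : R => block_psum (s%:C *: w))}.
  apply: continuous_subspaceT => s; apply: continuous_at_dist => e e0.
  have [d d0 Hd] := (rcontP _ _).1 (psumZ_rcont w s%:C) _ e0.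
  exists d => // s' ss; apply/ltW/Hd; by rewrite -rmorphB normc_real.
have [|s] := @IVT R (fun s => block_psum (s%:C *: w)) 0 b y (ltW b0) cf.
  rewrite rmorph0 scale0r psum0 min_l ?psum_ge0// max_r ?psum_ge0//.
  by rewrite (ltW y0).
rewrite in_itv/= => /andP[s0 _] sE; exists s => //.
rewrite lt_neqAle s0 andbT; apply/eqP => s0'; move: sE y0.
by rewrite -s0' rmorph0 scale0r psum0 => <-; rewrite ltxx.
Qed.

Definition phi f z := (f (z, 0)).1.
Definition fibre f z w := (fdiff f (z, 0) (0, w)).2.

(** When the w-part of [f x] is 0, this is the w-part of f(x + t v) divided by t, the function to
    which the Schwarz lemma applies. *)
Definition quot f (x v : V) t : 'rV[R[i]]_N :=
  if t == 0 then (fdiff f x v).2 else t^-1 *: ((f (x + t *: v)).2 - (f x).2).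

Lemma line_hol_data f (x v : V) (r : R) : holomorphic_on D f -> 0 < r ->
  (forall t, normc t < r -> D (x + t *: v)) ->
  hol_data r (fun j t => submxrow (quot f x v t) j) (fun t => (f (x + t *: v)).1).
Proof.
move=> hf r0 HD; split=> [j k|k].
  have -> : (fun t => submxrow (quot f x v t) j ord0 k) =
    (fun t => quot f x v t ord0 (tagnat.Rank j k)) by apply/funext => t; rewrite !mxE.
  exact: quotient2_hol hf r0 HD (tagnat.Rank j k).
split; first by apply/cdiff_cont/(line_cdiff1 _ hf)/HD; rewrite ComplexField.Normc.normc0.
by move=> t /andP[_ tr]; apply: (line_cdiff1 _ hf); exact: HD.
Qed.

(** One half of the data of an automorphism. Statements assuming both [half_aut f g] and
    [half_aut g f] apply to the inverse by exchanging the two. *)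
Definition half_aut f g := [/\ (forall x, D x -> D (f x)), (forall x, D x -> g (f x) = x),
  holomorphic_on D f & f (0, 0) = (0, 0)].

Lemma D_z0 z : D (z, 0).
Proof. by apply/domE; rewrite /rhoD psum0 mul0r ltr01. Qed.

(** On the domain the w-part has [block_psum] at most 1, so on |t| = r the quotient has weight at
    most sum_j r^(- 2 p_j). The maximum principle with r tending to infinity makes it vanish, and t
    = 1 gives the claim. *)
Lemma phi_fibre_axis f g z : half_aut f g -> (f (z, 0)).2 = 0.
Proof.
move=> [fD _ hf f0].
pose x : V := (0, 0); pose v : V := (z, 0).
have lE t : x + t *: v = (t *: z, 0).
  by rewrite /x /v; congr (_, _); rewrite /= ?add0r ?scaler0.
have HD t : D (x + t *: v) by rewrite lE; exact: D_z0.
have fx : (f x).2 = 0 by rewrite /x f0.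
pose c j t := submxrow (quot f x v t) j.
have hc r : 0 < r -> hol_data r c (fun=> 0 : 'rV[R[i]]_n0).
  move=> r0; have [hc _] := line_hol_data hf r0 (fun t _ => HD t); split => // k.
  have -> : (fun _ : R[i] => (0 : 'rV[R[i]]_n0) ord0 k) = fun=> 0 by apply/funext => t; rewrite mxE.
  exact: hol_cst.
have bd (r : R) t : 0 < r -> normc t = r ->
    weight p mu c (fun=> 0 : 'rV[R[i]]_n0) t <= \sum_j ((normc (r^-1)%:C) ^+ 2) `^ p j.
  move=> r0 tr; rewrite /weight nsq0 mulr0 expR0 mulr1; apply: ler_sum => j _.
  have t0 : t != 0 by rewrite -normc_gt0 tr.
  rewrite /c /quot (negbTE t0) fx subr0 submxrowZ nsqZ powRM ?nsq_ge0 ?sqr_ge0//.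
  rewrite ComplexField.Normc.normcV tr normc_real ger0_norm ?invr_ge0 ?(ltW r0)//.
  rewrite ler_piMr ?powR_ge0//.
  have : D (f (x + t *: v)) by exact/fD/HD.
  case: (f _) => z' w' /domE; rewrite /rhoD => h.
  have : block_psum w' <= 1.
    apply: le_trans (ltW h); rewrite ler_peMr ?psum_ge0// -[leLHS]expR0 ler_expR.
    by rewrite mulr_ge0 ?nsq_ge0// ltW.
  by apply: le_trans; rewrite /block_psum [leRHS](bigD1 j)//= lerDl sumr_ge0// => i _; exact: powR_ge0.
have small t : weight p mu c (fun=> 0 : 'rV[R[i]]_n0) t <= 0.
  rewrite leNgt; apply/negP => w0.
  have : rcont (fun s => \sum_j (normc s ^+ 2) `^ p j) (0 : R[i]).
    apply: rcont_sum => j; apply: rcont_powR; first exact: ltW.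
      by move=> s; exact: sqr_ge0.
    under eq_fun do rewrite expr2.
    by apply: rcontM; exact: rcont_normc (ccont_id _).
  move=> /rcontP /(_ _ w0) [d d0 Hd].
  pose r := Num.max (normc t + 1) (2 / d).
  have r0 : 0 < r by rewrite lt_max ltr_wpDl ?normc_ge0.
  have tr : normc t <= r by rewrite le_max lerDl ler01.
  have := Hd (r^-1)%:C; rewrite subr0 normc_real ger0_norm ?invr_ge0 ?(ltW r0)//.
  have rd : r^-1 < d.
    rewrite invf_plt ?posrE// lt_max; apply/orP; right.
    by rewrite -[ltLHS]mul1r ltr_pM2r ?invr_gt0// ltr1n.
  move=> /(_ rd); rewrite [X in _ - X]big1; last first.
    by move=> j _; rewrite ComplexField.Normc.normc0 expr0n powR0 ?gt_eqF.
  rewrite subr0; apply/negP; rewrite -leNgt; apply: le_trans (ler_norm _).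
  have rr : 0 < r < r + 1 by rewrite r0 ltrDl ltr01.
  have := @weight_max R l n0 n p mu p_gt0 mu_gt0 (r + 1) c (fun=> 0) r _ (hc _ _) rr _ t tr.
  apply; first by rewrite addr_gt0.
  move=> s sr; have := bd r s r0 sr.
  by rewrite normc_real ger0_norm ?invr_ge0 ?(ltW r0).
have q1 : quot f x v 1 = 0.
  have := small 1; rewrite /weight nsq0 mulr0 expR0 mulr1 => h.
  apply/eqP; apply: contraT => /psum_gt0; rewrite ltNge => /negP; case; exact: h.
move: q1; rewrite /quot oner_eq0 invr1 scale1r lE scale1r fx subr0; exact.
Qed.

Lemma line_fibreE z w t : (z, 0) + t *: (0, w) = (z, t *: w) :> V.
Proof. by congr (_, _); rewrite /= ?scaler0 ?addr0 ?add0r. Qed.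

Lemma D_line z w t : rhoD z w <= 1 -> normc t < 1 -> D ((z, 0) + t *: (0, w)).
Proof.
rewrite line_fibreE => zw t1; apply/domE.
have [->|w0] := eqVneq w 0; first by rewrite scaler0; apply/domE; exact: D_z0.
apply: lt_le_trans zw; rewrite /rhoD ltr_pM2r ?expR_gt0//.
rewrite -[ltRHS]/(block_psum w) -[w in ltRHS]scale1r; apply: psumZ_lt => //.
by rewrite ComplexField.Normc.normc1.
Qed.

(* The Schwarz lemma along the complex line through [(z, 0)] and [(z, w)],
   applied to the anisotropic gauge [rhoD] of the domain. *)
Lemma schwarz_line f g z w t : half_aut f g -> rhoD z w <= 1 -> normc t < 1 ->
  weight p mu (fun j t => submxrow (quot f (z, 0) (0, w) t) j)
   (fun t => (f ((z, 0) + t *: (0, w))).1) t <= 1.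
Proof.
move=> hfg zw t1; have [fD _ hf f0] := hfg.
have HD s := @D_line z w s zw; set u := weight _ _ _ _.
have hca := line_hol_data hf ltr01 HD.
(* Dividing by s scales the blocks with different exponents. As [q] dominates them all, the total
   loss on |s| = r < 1 is at most r^(- 2 q), which tends to 1 with r. *)
pose q := \sum_j p j.
have pq j : p j <= q by rewrite /q (bigD1 j)//= lerDl sumr_ge0// => i _; exact: ltW.
have bd r s : 0 < r < 1 -> normc s = r -> u s * (r ^+ 2) `^ q <= 1.
  move=> /andP[r0 r1] sr; have s0 : s != 0 by rewrite -normc_gt0 sr.
  have Df := fD _ (HD s _); rewrite sr in Df; have {Df} := Df r1.
  rewrite /u /weight /quot (negbTE s0) (phi_fibre_axis _ hfg) subr0.
  case: (f (_ + _)) => z' w' /= /domE /ltW; apply: le_trans.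
  rewrite /rhoD mulrAC ler_wpM2r ?expR_ge0// /block_psum mulr_suml; apply: ler_sum => j _.
  rewrite submxrowZ nsqZ powRM ?nsq_ge0 ?sqr_ge0// mulrAC ler_piMl ?powR_ge0//.
  rewrite ComplexField.Normc.normcV sr.
  apply: (@le_trans _ _ ((r^-1 ^+ 2) `^ p j * (r ^+ 2) `^ p j)).
    rewrite ler_wpM2l ?powR_ge0//; apply: ger_powR => //.
    by rewrite exprn_gt0//= exprn_ile1// ltW.
  by rewrite -powRM ?sqr_ge0// -exprMn mulVf ?gt_eqF// expr1n powR1.
rewrite leNgt; apply/negP => ut.
have e0 : 0 < 1 - (u t)^-1 by rewrite subr_gt0 invf_lt1// (lt_trans ltr01).
have : rcont (fun s => (normc s ^+ 2) `^ q) (1 : R[i]).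
  apply: rcont_powR; first by apply: sumr_ge0 => j _; exact: ltW.
    by move=> s; exact: sqr_ge0.
  under eq_fun do rewrite expr2.
  by apply: rcontM; exact: rcont_normc (ccont_id _).
move=> /rcontP /(_ _ e0) [d d0 Hd].
(* Large enough for the disc to contain [t], and so close to 1 that r^(2 q) exceeds the inverse of
   [u t]. *)
pose r := Num.max ((1 + normc t) / 2) (1 - d / 2).
have r0 : 0 < r by rewrite lt_max divr_gt0// ltr_pwDl// normc_ge0.
have r1 : r < 1.
  by rewrite gt_max ltr_pdivrMr// mul1r mulr2n ltrD2l t1 /= ltrBlDr ltrDl divr_gt0.
have tr : normc t <= r.
  by rewrite le_max ler_pdivlMr// mulr2n mulrDr mulr1 lerD2r (ltW t1).
have rd : 1 - r < d.
  rewrite ltrBlDr -ltrBlDl lt_max; apply/orP; right.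
  by rewrite ltrD2l ltrN2 ltr_pdivrMr// ltr_pMr// ltr1n.
have := Hd r%:C; rewrite -(rmorph1 (real_complex R)) -rmorphB !normc_real normr1 expr1n powR1.
rewrite distrC (ger0_norm (ltW r0)) ger0_norm ?subr_ge0 ?(ltW r1)// => /(_ rd).
rewrite ltr_norml => /andP[+ _]; rewrite opprB ltrBrDr subrK => h.
have rr : 0 < (r ^+ 2) `^ q by rewrite powR_gt0// exprn_gt0.
have : u t <= ((r ^+ 2) `^ q)^-1.
  apply: (@weight_max R l n0 n p mu p_gt0 mu_gt0 1 _ _ r _ hca) => //; first by rewrite r0.
  by move=> s sr; rewrite -[leRHS]mul1r ler_pdivlMr//; apply: bd => //; rewrite r0.
by rewrite leNgt => /negP; apply; rewrite invf_plt ?posrE// (lt_trans ltr01).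
Qed.

Lemma weight0E f z w : weight p mu (fun j t => submxrow (quot f (z, 0) (0, w) t) j)
   (fun t => (f ((z, 0) + t *: (0, w))).1) 0 = rhoD (phi f z) (fibre f z w).
Proof. by rewrite /weight /quot eqxx scale0r addr0. Qed.

Lemma schwarz f g z w : half_aut f g -> rhoD z w <= 1 ->
  rhoD (phi f z) (fibre f z w) <= 1.
Proof.
by move=> hfg zw; rewrite -weight0E; apply: schwarz_line hfg zw _; rewrite ComplexField.Normc.normc0.
Qed.

End Domain.

(** The chain rule at one point. Differentiability at [x] is phrased with the set [[set x]], the
    form in which [coord_quotient] takes it. *)
Lemma hol_comp_fdiff (R : realType) (V : normedModType R[i]) (D : set V) (f g : V -> V) (x v : V) :
  holomorphic_on D f -> holomorphic_on D g -> D x -> D (f x) ->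
  holomorphic_on [set x] (g \o f) /\ fdiff g (f x) (fdiff f x v) = fdiff (g \o f) x v.
Proof.
move=> hf hg Dx Dfx; split=> [_ ->|].
  by apply: differentiable_comp; [exact: hf | exact: hg].
exact: (esym (congr1 (fun h : V -> V => h v) (diff_comp (hf _ Dx) (hg _ Dfx)))).
Qed.

(** * The form of an automorphism and the determinant of its fibre part *)

Section Automorphism.
Context {R : realType} (l n0 : nat) (n : 'I_l -> nat) (p : 'I_l -> R) (mu : R).
Hypotheses (p_gt0 : forall j, 0 < p j) (mu_gt0 : 0 < mu).
Local Notation N := (\sum_(j < l) n j)%N.
Local Notation V := ('rV[R[i]]_n0 * 'rV[R[i]]_N)%type.
Local Notation D := (FBH_domain n0 n p mu).
Local Notation half_aut := (half_aut p mu).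
Local Notation rhoD := (rhoD p mu).
Local Notation psum := (block_psum p).
Implicit Types (z : 'rV[R[i]]_n0) (w : 'rV[R[i]]_N) (t : R[i]) (f g : V -> V).

Lemma fibre_linear f z (k : R[i]) w w' :
  fibre f z (k *: w + w') = k *: fibre f z w + fibre f z w'.
Proof.
rewrite /fibre; have -> : (0, k *: w + w') = k *: (0, w) + (0, w') :> V.
  by congr (_, _); rewrite /= scaler0 addr0.
by rewrite fdiff_linear.
Qed.

HB.instance Definition _ f z := GRing.isLinear.Build R[i] 'rV[R[i]]_N 'rV[R[i]]_N
  *:%R (@fibre R l n0 n f z) (@fibre_linear f z).

Lemma eq_le1 (x : R) : x = 1 -> x <= 1. Proof. by move=> ->. Qed.

Lemma normc_small (x : R[i]) : (forall e, 0 < e -> normc x < e) -> x = 0.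
Proof.
move=> H; apply/eqP; apply: contraT; rewrite -normc_gt0 => /H.
by rewrite ltxx.
Qed.

(** The composite is the identity only on the domain, so its derivative is read off from difference
    quotients along a short piece of line inside the domain. *)
Lemma fdiff_inv f g (x v : V) (d : R) : half_aut f g -> half_aut g f -> 0 < d ->
  (forall t, normc t < d -> D (x + t *: v)) -> fdiff g (f x) (fdiff f x v) = v.
Proof.
move=> [fD gf hf _] [_ _ hg _] d0 HD.
have Dx : D x by have := HD 0; rewrite scale0r addr0 ComplexField.Normc.normc0; exact.
pose F : V -> V := g \o f.
have [hF ->] := hol_comp_fdiff v hf hg Dx (fD _ Dx).
rewrite -/F in hF *.
suff H e : 0 < e -> (forall k, normc ((v - fdiff F x v).1 ord0 k) < e) /\
    (forall k, normc ((v - fdiff F x v).2 ord0 k) < e).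
  have E : v - fdiff F x v = 0.
    rewrite (surjective_pairing (v - _)); congr (_, _); apply/rowP => k.
      by rewrite [RHS]mxE; apply: normc_small => e /H[].
    by rewrite [RHS]mxE; apply: normc_small => e /H[].
  by apply/esym/eqP; rewrite -subr_eq0 E.
move=> e0; have [d' d'0 Hd] := coord_quotient v hF (erefl x) e0.
pose r := Num.min d d' / 2.
have r0 : 0 < r by rewrite divr_gt0// lt_min d0.
have rd : r < Num.min d d' by rewrite ltr_pdivrMr// ltr_pMr ?ltr1n// lt_min d0.
have nr : normc (r%:C : R[i]) = r by rewrite normc_real ger0_norm// ltW.
have rC : (r%:C : R[i]) != 0 by rewrite -normc_gt0 nr.
have E s : normc s < d -> F (x + s *: v) = x + s *: v by move=> /HD; exact: gf.
have F0 : F x = x by rewrite /F /= gf.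
have [|H1 H2] := Hd r%:C; first by rewrite nr r0 (lt_le_trans rd)// ge_min lexx orbT.
split=> k; [have := H1 k | have := H2 k]; rewrite E ?nr ?(lt_le_trans rd) ?ge_min ?lexx// F0.
  by rewrite /= !mxE [_ + r%:C * _]addrC addrK mulKf.
by rewrite /= !mxE [_ + r%:C * _]addrC addrK mulKf.
Qed.

Lemma phi_pair f g z : half_aut f g -> f (z, 0) = (phi f z, 0).
Proof.
by move=> h; rewrite [LHS]surjective_pairing (phi_fibre_axis p_gt0 mu_gt0 z h).
Qed.

Lemma phi_inv f g z : half_aut f g -> phi g (phi f z) = z.
Proof.
move=> h; rewrite {1}/phi -(phi_pair z h); have [_ gf _ _] := h.
by rewrite gf//; exact: D_z0.
Qed.

Lemma fdiff_axis f g z z' : half_aut f g -> (fdiff f (z, 0) (z', 0)).2 = 0.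
Proof.
move=> h; have [_ _ hf _] := h; apply/rowP => k; rewrite mxE; apply: normc_small => e e0.
have [d d0 Hd] := coord_quotient (z', 0) hf (D_z0 n mu p_gt0 z) e0.
have nd : normc ((d / 2)%:C : R[i]) = d / 2 by rewrite normc_real ger0_norm// divr_ge0// ltW.
have [|_ /(_ k)] := Hd (d / 2)%:C.
  by rewrite nd divr_gt0//= ltr_pdivrMr// ltr_pMr// ltr1n.
have -> : (z, 0) + (d / 2)%:C *: (z', 0) = (z + (d / 2)%:C *: z', 0) :> V.
  by congr (_, _); rewrite /= scaler0 addr0.
by rewrite !(phi_fibre_axis p_gt0 mu_gt0 _ h) subrr mulr0 sub0r normcN'.
Qed.

(** By [fdiff_axis] the differential of [g] on the axis sends axis directions to axis directions.
    The differentials are thus block triangular, and their w-blocks compose. *)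
Lemma fibre_inv f g z w : half_aut f g -> half_aut g f ->
  fibre g (phi f z) (fibre f z w) = w.
Proof.
move=> hf hg.
have [s s0 sE] : exists2 s : R, 0 < s & forall t, normc t < s -> D ((z, 0) + t *: (0, w)).
  have [->|w0] := eqVneq w 0.
    by exists 1 => // t _; rewrite line_fibreE scaler0; exact: D_z0.
  have [s s0 sE] := psumZ_surj p_gt0 w0 (expR_gt0 (- (mu * nsq z))).
  exists s => // t ts; rewrite line_fibreE; apply/domE; rewrite /rhoD -ltr_pdivlMr ?expR_gt0//.
  rewrite mul1r -expRN -sE; apply: psumZ_lt => //.
  by rewrite normc_real ger0_norm// ltW.
have := fdiff_inv hf hg s0 sE; rewrite (phi_pair z hf).
rewrite [fdiff f _ _]surjective_pairing -/(fibre f z w); set zt := (fdiff f _ _).1.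
have -> : (zt, fibre f z w) = 1 *: (zt, 0) + (0, fibre f z w) :> V.
  by congr (_, _); rewrite /= scale1r ?addr0 ?add0r.
rewrite fdiff_linear scale1r => /(congr1 snd) /=.
by rewrite (fdiff_axis _ _ hg) add0r.
Qed.

Lemma fibre0 f z : fibre f z 0 = 0.
Proof. exact: linear0. Qed.

Lemma fibreZ f z t w : fibre f z (t *: w) = t *: fibre f z w.
Proof. exact: linearZ. Qed.

(** If the gauge of the image were below 1, the image could be stretched by a factor s > 1 to gauge
    1; the Schwarz lemma for [g] would then bound the gauge of (z, s w) by 1, although it exceeds
    that of (z, w). *)
Lemma rhoD_eq1 f g z w : half_aut f g -> half_aut g f -> rhoD z w = 1 ->
  rhoD (phi f z) (fibre f z w) = 1.
Proof.
move=> hf hg E; have w0 : w != 0.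
  by apply: contra_eq_neq E => ->; rewrite /rhoD psum0// mul0r eq_sym oner_neq0.
have w'0 : fibre f z w != 0.
  by apply: contraNneq w0 => w'; rewrite -(fibre_inv z w hf hg) w' fibre0.
apply/eqP; rewrite eq_le (schwarz p_gt0 mu_gt0 hf) ?E//= leNgt; apply/negP => lt1.
have [s s0 sE] := psumZ_surj p_gt0 w'0 (expR_gt0 (- (mu * nsq (phi f z)))).
have rE : rhoD (phi f z) (s%:C *: fibre f z w) = 1.
  by rewrite /rhoD sE expRN mulVf// gt_eqF// expR_gt0.
have ns : normc (s%:C : R[i]) = s by rewrite normc_real ger0_norm// ltW.
have s1 : 1 < s.
  rewrite ltNge; apply/negP => s1; move: lt1; rewrite -rE /rhoD ltr_pM2r ?expR_gt0//.
  rewrite ltNge => /negP; apply; move: s1; rewrite le_eqVlt => /predU1P[->|s1].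
    by rewrite rmorph1 scale1r.
  rewrite -[leRHS]/(psum (fibre f z w)) -[fibre f z w in leRHS]scale1r ltW//.
  by apply: psumZ_lt => //; rewrite ns ComplexField.Normc.normc1.
have := schwarz p_gt0 mu_gt0 hg (eq_le1 rE).
rewrite (phi_inv z hf) fibreZ (fibre_inv z w hf hg).
apply/negP; rewrite -ltNge -[ltLHS]E /rhoD ltr_pM2r ?expR_gt0//.
rewrite -[ltLHS]/(psum w) -[w in ltLHS]scale1r.
by apply: psumZ_lt => //; rewrite ns ComplexField.Normc.normc1.
Qed.

Lemma D_scale z w : w != 0 -> exists2 s : R, 0 < s & rhoD z (s%:C *: w) = 1.
Proof.
move=> w0; have [s s0 sE] := psumZ_surj p_gt0 w0 (expR_gt0 (- (mu * nsq z))).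
by exists s => //; rewrite /rhoD sE expRN mulVf// gt_eqF// expR_gt0.
Qed.

(* Equality in the Schwarz lemma forces the map to be linear in [w]. *)
Lemma aut_form f g z w : half_aut f g -> half_aut g f -> rhoD z w < 1 ->
  f (z, w) = (phi f z, fibre f z w).
Proof.
move=> hf hg zw; have [->|w0] := eqVneq w 0; first by rewrite fibre0; exact: phi_pair hf.
have [s s0 sE] := D_scale z w0.
have ns : normc (s%:C : R[i]) = s by rewrite normc_real ger0_norm// ltW.
have s1 : 1 < s.
  rewrite ltNge; apply/negP => s1; move: zw; rewrite -sE /rhoD ltr_pM2r ?expR_gt0//.
  rewrite ltNge => /negP; apply; move: s1; rewrite le_eqVlt => /predU1P[->|s1].
    by rewrite rmorph1 scale1r.
  rewrite -[leRHS]/(psum w) -[w in leRHS]scale1r ltW//.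
  by apply: psumZ_lt => //; rewrite ns ComplexField.Normc.normc1.
have [fD gf hfol f0] := hf.
have HD t := D_line (p := p) (mu := mu) p_gt0 (t := t) (eq_le1 sE).
have hca := line_hol_data hfol ltr01 HD.
have w1 := weight0E p mu f z (s%:C *: w).
rewrite (rhoD_eq1 hf hg sE) in w1.
have nt : normc (s^-1%:C : R[i]) < 1.
  by rewrite normc_real ger0_norm ?invr_ge0 ?(ltW s0)// invf_lt1.
have [||aE cE] := weight_const p_gt0 mu_gt0 hca _ _ nt.
- by move=> t t1; rewrite w1; exact: schwarz_line hf (eq_le1 sE) t1.
- by rewrite w1 ltr01.
have sC : (s%:C : R[i]) != 0 by rewrite -normc_gt0 ns.
have sV : (s^-1%:C : R[i]) = s%:C^-1 by rewrite fmorphV.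
move: aE; rewrite /= line_fibreE scale0r addr0 scalerA sV mulVf// scale1r => aE.
have : quot f (z, 0) (0, s%:C *: w) s^-1%:C = fibre f z (s%:C *: w).
  by apply: submxrow_eq => j; rewrite cE /quot eqxx.
rewrite /quot sV invr_eq0 (negbTE sC) line_fibreE scalerA mulVf// scale1r invrK.
rewrite (phi_fibre_axis p_gt0 mu_gt0 z hf) subr0 fibreZ => /(scalerI sC) bE.
by rewrite [LHS]surjective_pairing aE bE.
Qed.

Lemma nsqD_le k (u v : 'rV[R[i]]_k) : nsq (u + v) <= 2 * nsq u + 2 * nsq v.
Proof.
rewrite nsqD; have := nsq_ge0 (u - v); rewrite nsqB => h.
by rewrite -subr_ge0; apply: le_trans h _; rewrite le_eqVlt; apply/orP; left; apply/eqP; ring.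
Qed.

Lemma phi_cdiff f g z v t k : half_aut f g ->
  cdiff (fun t => phi f (z + t *: v) ord0 k) t.
Proof.
move=> hf; have [_ _ hfol _] := hf.
have E s : (z, 0) + s *: (v, 0) = (z + s *: v, 0) :> V.
  by congr (_, _); rewrite /= scaler0 addr0.
have -> : (fun t => phi f (z + t *: v) ord0 k) = (fun t => (f ((z, 0) + t *: (v, 0))).1 ord0 k).
  by apply/funext => s; rewrite E.
by apply: (line_cdiff1 _ hfol); rewrite E; exact: D_z0.
Qed.

(** Holomorphy of a derivative in the base point would usually come from Cauchy's formula. Here
    [aut_form] makes s B(z) w a value of [f], for s so small that (z + u v, s w) stays in the domain
    for u near t. *)
Lemma fibre_cdiff f g z v w t k : half_aut f g -> half_aut g f ->
  cdiff (fun t => fibre f (z + t *: v) w ord0 k) t.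
Proof.
move=> hf hg; have [_ _ hfol _] := hf.
have [->|w0] := eqVneq w 0.
  have -> : (fun t => fibre f (z + t *: v) 0 ord0 k) = fun=> 0.
    by apply/funext => s; rewrite fibre0 mxE.
  exact: cdiff_cst.
(* An upper bound of nsq (z + u v) for |u - t| < 1. *)
pose Q := 2 * nsq (z + t *: v) + 2 * nsq v.
have e0 : 0 < expR (- (mu * Q)) / 2 by rewrite divr_gt0// expR_gt0.
have [s s0 sE] := psumZ_surj p_gt0 w0 e0.
have E u : (z, s%:C *: w) + u *: (v, 0) = (z + u *: v, s%:C *: w) :> V.
  by congr (_, _); rewrite /= scaler0 addr0.
have zQ u : normc (u - t) < 1 -> rhoD (z + u *: v) (s%:C *: w) < 1.
  move=> ut; rewrite /rhoD sE.
  have : nsq (z + u *: v) <= Q.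
    have -> : z + u *: v = (z + t *: v) + (u - t) *: v by rewrite -addrA -scalerDl [t + _]addrC subrK.
    apply: le_trans (nsqD_le _ _) _; rewrite /Q lerD2l ler_pM2l// nsqZ.
    by rewrite ler_piMl ?nsq_ge0// expr_le1 ?normc_ge0// ltW.
  rewrite -(ler_pM2l mu_gt0) -ler_expR => h.
  apply: le_lt_trans (ler_wpM2l (ltW e0) h) _.
  by rewrite mulrAC expRN mulVf ?gt_eqF ?expR_gt0// mul1r invf_lt1// ltr1n.
have sC : (s%:C : R[i]) != 0 by rewrite -normc_gt0 normc_real normr_gt0 gt_eqF.
have dF : cdiff (fun u => s%:C^-1 * (f ((z, s%:C *: w) + u *: (v, 0))).2 ord0 k) t.
  apply: cdiffM; first exact: cdiff_cst.
  by apply: (line_cdiff2 _ hfol); rewrite E; apply/domE/zQ; rewrite subrr ComplexField.Normc.normc0.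
apply: (cdiff_near dF ltr01).
move=> u ut; rewrite E (aut_form hf hg (zQ _ ut)) /= fibreZ mxE mulrA mulVf// mul1r.
by [].
Qed.

Definition fibre_mx f z : 'M[R[i]]_N := lin1_mx (fibre f z).

Lemma mul_fibre_mx f z w : w *m fibre_mx f z = fibre f z w.
Proof. by rewrite mul_rV_lin1. Qed.

Lemma fibre_mx_inv f g z : half_aut f g -> half_aut g f ->
  fibre_mx f z *m fibre_mx g (phi f z) = 1%:M.
Proof.
move=> hf hg; apply/row_matrixP => i.
by rewrite row_mul !rowE mul_fibre_mx mul_fibre_mx (fibre_inv _ _ hf hg) mulmx1.
Qed.

(** The anisotropic dilation that multiplies [block_psum] by e^x. *)
Definition scale_mx (x : R) : 'M[R[i]]_N :=
  diag_mx (\row_a (expR (x / (2 * p (tagnat.sig1 a))))%:C).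

(** The determinant of [scale_mx x] is e^(kappa x). The constant k of the overview is kappa * mu. *)
Definition kappa : R := \sum_(a < N) (2 * p (tagnat.sig1 a))^-1.

Lemma det_scale_mx x : \det (scale_mx x) = (expR (x * kappa))%:C.
Proof.
rewrite det_diag mulr_sumr expR_sum rmorph_prod.
by apply: eq_bigr => a _; rewrite mxE.
Qed.

Lemma psum_scale_mx x w : psum (w *m scale_mx x) = expR x * psum w.
Proof.
rewrite /block_psum mulr_sumr; apply: eq_bigr => j _.
have -> : submxrow (w *m scale_mx x) j = (expR (x / (2 * p j)))%:C *: submxrow w j.
  by apply/rowP => k; rewrite /scale_mx mul_mx_diag !mxE tagnat.Rank1K mulrC.
rewrite nsqZ normc_real (ger0_norm (expR_ge0 _)) powRM ?sqr_ge0 ?nsq_ge0//; congr (_ * _).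
rewrite -[expR _ ^+ 2]powR_mulrn ?expR_ge0// -powRrM -expRM.
by congr (expR _); field; rewrite gt_eqF.
Qed.

Lemma psum_coord_le w a : psum w = 1 -> normc (w ord0 a) <= 1.
Proof.
move=> w1; rewrite -[a]tagnat.sig2K; set j := tagnat.sig1 a; set k := tagnat.sig2 a.
have h : nsq (submxrow w j) `^ p j <= 1 `^ p j.
  rewrite powR1 -w1 /block_psum [leRHS](bigD1 j)//= lerDl sumr_ge0// => i _; exact: powR_ge0.
have nj : nsq (submxrow w j) <= 1.
  rewrite leNgt; apply/negP => lt; move: h; rewrite leNgt => /negP; apply.
  by apply: gt0_ltr_powR; rewrite ?nnegrE ?nsq_ge0.
rewrite -(ler_pXn2r (n := 2))// ?nnegrE ?normc_ge0// expr1n; apply: le_trans nj.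
rewrite /nsq [leRHS](bigD1 k)//= !mxE lerDl sumr_ge0// => i _; exact: sqr_ge0.
Qed.

Lemma psum_delta (a : 'I_N) : psum (delta_mx ord0 a : 'rV[R[i]]_N) = 1.
Proof.
rewrite /block_psum [LHS](bigD1 (tagnat.sig1 a))//= [X in _ + X]big1 ?addr0; last first.
  move=> j ja; have -> : submxrow (delta_mx ord0 a : 'rV[R[i]]_N) j = 0.
    apply/rowP => k; rewrite !mxE eqxx /=; case: eqP => // E.
    by move: ja; rewrite -E tagnat.Rank1K eqxx.
  by rewrite nsq0 powR0 ?gt_eqF.
have -> : nsq (submxrow (delta_mx ord0 a : 'rV[R[i]]_N) (tagnat.sig1 a)) = 1.
  rewrite /nsq [LHS](bigD1 (tagnat.sig2 a))//= !mxE tagnat.sig2K !eqxx /= expr1n expr0n addr0 sqrtr1 expr1n.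
  rewrite [X in _ + X]big1 ?addr0// => k ka; rewrite !mxE eqxx /=; case: eqP => [E|_]; last first.
    by rewrite ComplexField.Normc.normc0 expr0n.
  move: ka; have := tagnat.rank_inj (etrans E (esym (tagnat.sig2K a))).
  by move=> /eqP; rewrite eq_Tagged /= => ->.
by rewrite powR1.
Qed.

(** All powers of [T] preserve the sphere, so their entries have modulus at most 1 and Leibniz'
    formula bounds their determinants by the number of permutations; the powers of a number of
    modulus above 1 are unbounded. *)
Lemma det_sphere_le1 (T : 'M[R[i]]_N) : (forall w, psum w = 1 -> psum (w *m T) = 1) ->
  normc (\det T) <= 1.
Proof.
move=> HT.
have bd (M : 'M[R[i]]_N) : (forall w, psum w = 1 -> psum (w *m M) = 1) ->
    normc (\det M) <= #|{: 'S_N}|%:R.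
  move=> HM; rewrite /determinant.
  have le (I : finType) (F : I -> R[i]) : normc (\sum_i F i) <= \sum_i normc (F i).
    elim/big_ind2: _ => [|x1 x2 y1 y2 h1 h2|//]; first by rewrite ComplexField.Normc.normc0.
    exact: le_trans (normcD _ _) (lerD h1 h2).
  apply: le_trans (le _ _) _; rewrite -sum1_card natr_sum; apply: ler_sum => s _.
  rewrite ComplexField.Normc.normcM normcX normcN' ComplexField.Normc.normc1 expr1n mul1r normc_prod.
  apply: prodr_ile1 => i _; rewrite normc_ge0 /=.
  have := psum_coord_le (s i) (HM _ (psum_delta i)).
  by rewrite -rowE mxE.
have pw k : exists2 M : 'M[R[i]]_N, \det M = \det T ^+ k &
    forall w, psum w = 1 -> psum (w *m M) = 1.
  elim: k => [|k [M dM HM]]; first by exists 1%:M; [rewrite det1 | move=> w; rewrite mulmx1].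
  by exists (M *m T); [rewrite det_mulmx dM exprSr | move=> w w1; rewrite mulmxA; apply/HT/HM].
rewrite leNgt; apply/negP => d1.
set x := normc _ in d1; set C := #|{: 'S_N}|%:R in bd.
pose k := (Num.truncn (C / (x - 1))).+1.
have [M dM /bd] := pw k; rewrite dM normcX -/x; apply/negP; rewrite -ltNge.
have kC : C < k%:R * (x - 1) by rewrite -ltr_pdivrMr ?subr_gt0//; exact: truncnS_gt.
apply: lt_le_trans kC _.
(* Bernoulli's inequality k (x - 1) <= x^k. *)
elim: (k) => [|m IH]; first by rewrite mul0r expr0.
rewrite exprS -natr1 mulrDl mul1r.
have x0 : 1 <= x ^+ m by rewrite exprn_ege1// ltW.
apply: le_trans (lerD IH (lexx _)) _.
rewrite -subr_ge0; have -> : x * x ^+ m - (x ^+ m + (x - 1)) = (x - 1) * (x ^+ m - 1) by ring.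
by rewrite mulr_ge0// subr_ge0// ltW.
Qed.

(** Dilations carry the sphere [psum = 1] to the level set [rhoD = 1] over [z], and the one over
    [phi f z] back to the sphere. Between them B(z) acts, so the composite [T] preserves the
    sphere. *)
Lemma det_fibre_le f g z : half_aut f g -> half_aut g f ->
  normc (\det (fibre_mx f z)) <= expR (kappa * mu * (nsq z - nsq (phi f z))).
Proof.
move=> hf hg; pose T := scale_mx (- (mu * nsq z)) *m fibre_mx f z *m scale_mx (mu * nsq (phi f z)).
have : normc (\det T) <= 1.
  apply: det_sphere_le1 => w w1; rewrite /T !mulmxA psum_scale_mx mul_fibre_mx mulrC.
  apply: (rhoD_eq1 hf hg); rewrite /rhoD psum_scale_mx w1 mulr1 expRN mulVf//.
  by rewrite gt_eqF// expR_gt0.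
rewrite /T !det_mulmx !det_scale_mx !ComplexField.Normc.normcM !normc_real !(ger0_norm (expR_ge0 _)).
rewrite mulrAC -expRD mulrC -ler_pdivlMr ?expR_gt0// div1r -expRN.
by congr (_ <= expR _); ring.
Qed.

Lemma expR_le_of_mul_eq1 (a b x y : R) : 0 <= b -> a * b = 1 -> b <= expR y -> x = - y ->
  expR x <= a.
Proof.
move=> b0' ab bE ->; have b0 : 0 < b.
  rewrite lt_def b0' andbT; apply: contra_eq_neq ab => ->.
  by rewrite mulr0 eq_sym oner_neq0.
have -> : a = b^-1 by rewrite -[LHS](mulfK (lt0r_neq0 b0)) ab mul1r.
by rewrite expRN lef_pV2// posrE expR_gt0.
Qed.

Lemma det_fibre f g z : half_aut f g -> half_aut g f ->
  normc (\det (fibre_mx f z)) = expR (kappa * mu * (nsq z - nsq (phi f z))).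
Proof.
move=> hf hg; apply/le_anti/andP; split; first exact: det_fibre_le hf hg.
have le := det_fibre_le (phi f z) hg hf; rewrite (phi_inv z hf) in le.
apply: (expR_le_of_mul_eq1 (normc_ge0 _) _ le); last by ring.
by rewrite -ComplexField.Normc.normcM -det_mulmx fibre_mx_inv// det1 ComplexField.Normc.normc1.
Qed.

End Automorphism.

Lemma is_derive_dist (R : realType) (f : R -> R) (x c : R) :
  (forall e, 0 < e -> exists2 d, 0 < d & forall h, 0 < `|h| < d ->
     `|h^-1 * (f (x + h) - f x) - c| <= e) -> is_derive x 1 f c.
Proof.
move=> H.
have cv : (fun h : R => h^-1 *: ((f \o shift x) (h *: 1) - f x)) @ 0^' --> c.
  apply/cvgrPdist_le => e e0; have [d d0 Hd] := H _ e0.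
  apply/nbhs_ballP; exists d => // h; rewrite /ball/= sub0r normrN => hd h0.
  by rewrite distrC /GRing.scale /= mulr1 addrC [h + x]addrC addrC; apply: Hd; rewrite normr_gt0 h0.
by apply: DeriveDef; [exact: cvgP cv | exact: cvg_lim cv].
Qed.

(** * Linearity of the base component *)

Section BasePart.
Context {R : realType} (l n0 : nat) (n : 'I_l -> nat) (p : 'I_l -> R) (mu : R).
Hypotheses (p_gt0 : forall j, 0 < p j) (mu_gt0 : 0 < mu).
Hypothesis N_gt0 : (0 < \sum_(j < l) n j)%N.
Local Notation N := (\sum_(j < l) n j)%N.
Local Notation V := ('rV[R[i]]_n0 * 'rV[R[i]]_N)%type.
Local Notation half_aut := (half_aut p mu).
Implicit Types (z v : 'rV[R[i]]_n0) (w : 'rV[R[i]]_N) (t : R[i]) (f g : V -> V).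

Definition dphi f z v := (fdiff f (z, 0) (v, 0)).1.

Definition phi_quot f z v t :=
  if t == 0 then dphi f z v else t^-1 *: (phi f (z + t *: v) - phi f z).

Lemma phi_quotient f g z v (e : R) : half_aut f g -> 0 < e -> exists2 d, 0 < d &
  forall t k, 0 < normc t < d ->
  normc (t^-1 * (phi f (z + t *: v) ord0 k - phi f z ord0 k) - dphi f z v ord0 k) < e.
Proof.
move=> [_ _ hf _] e0; have [d d0 Hd] := coord_quotient (v, 0) hf (D_z0 n mu p_gt0 z) e0.
exists d => // t k /Hd[/(_ k)].
have -> : (z, 0) + t *: (v, 0) = (z + t *: v, 0) :> V by congr (_, _); rewrite /= scaler0 addr0.
by [].
Qed.

Lemma phi_quot_hol f g z v (rho : R) k : half_aut f g ->
  hol_punctured rho (fun t => phi_quot f z v t ord0 k).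
Proof.
move=> hf; split.
  apply/ccontP => e e0; have [d d0 Hd] := phi_quotient z v hf e0; exists d => // t.
  rewrite subr0 /phi_quot eqxx; case: eqP => [_ _|/eqP t0 td].
    by rewrite subrr ComplexField.Normc.normc0.
  by have := Hd t k; rewrite normc_gt0 t0 => /(_ td); rewrite !mxE.
move=> t /andP[t0 _].
have dq : cdiff (fun s => s^-1 * (phi f (z + s *: v) ord0 k + - phi f z ord0 k)) t.
  apply: cdiffM.
    by apply: cdiffV; [rewrite -normc_gt0 | exact: cdiff_id].
  by apply: cdiffD; [exact: phi_cdiff hf | exact: cdiff_cst].
apply: (cdiff_near dq t0) => s st; rewrite /phi_quot.
case: eqP => [s0|_]; last by rewrite !mxE.
by move: st; rewrite s0 sub0r normcN' ltxx.
Qed.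

Lemma nsq_phi_quot f z v t : t != 0 ->
  nsq (phi f (z + t *: v) - phi f z) = normc t ^+ 2 * nsq (phi_quot f z v t).
Proof.
move=> t0; rewrite /phi_quot (negbTE t0) nsqZ mulrA -exprMn -ComplexField.Normc.normcM.
by rewrite mulfV// ComplexField.Normc.normc1 expr1n mul1r.
Qed.

Lemma kappa_gt0 : 0 < kappa n p.
Proof.
rewrite /kappa; move: N_gt0 => h; pose a := Ordinal h.
rewrite [ltRHS](bigD1 a)//=; apply: ltr_pwDl; first by rewrite invr_gt0 mulr_gt0.
by apply: sumr_ge0 => i _; rewrite invr_ge0 mulr_ge0// ltW.
Qed.

Lemma det_cdiff f g z v t : half_aut f g -> half_aut g f ->
  cdiff (fun t => \det (fibre_mx f (z + t *: v))) t.
Proof.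
move=> hf hg; apply: cdiff_big_sum => s; apply: cdiffM; first exact: cdiff_cst.
apply: cdiff_big_prod => i.
have -> : (fun t => fibre_mx f (z + t *: v) i (s i)) =
  (fun t => fibre f (z + t *: v) (delta_mx ord0 i) ord0 (s i)).
  by apply/funext => u; rewrite !mxE.
exact: fibre_cdiff hf hg.
Qed.

(** These two properties of det B are all that [dphi_le] uses; the existential hides the determinant
    itself. *)
Lemma jacobian_exists f g : half_aut f g -> half_aut g f -> exists J : 'rV[R[i]]_n0 -> R[i],
  (forall z, normc (J z) = expR (kappa n p * mu * (nsq z - nsq (phi f z)))) /\
  (forall z v t, cdiff (fun t => J (z + t *: v)) t).
Proof.
move=> hf hg; exists (fun z => \det (fibre_mx f z)); split=> [z|z v t].
  exact (det_fibre p_gt0 mu_gt0 z hf hg).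
exact: det_cdiff hf hg.
Qed.

(* If [phi] expanded some direction at [z], then [|det B|] times the modulus of
   a holomorphic exponential would have a strict local maximum. *)
Lemma dphi_le f g z v : half_aut f g -> half_aut g f -> nsq (dphi f z v) <= nsq v.
Proof.
move=> hf hg; rewrite leNgt; apply/negP => lt.
have q0 : nsq (phi_quot f z v 0) = nsq (dphi f z v) by rewrite /phi_quot eqxx.
have cq : rcont (fun t => nsq (phi_quot f z v t)) 0.
  by apply: rcont_nsq => k; have [] := phi_quot_hol z v 1 k hf.
have e0 : 0 < nsq (dphi f z v) - nsq v by rewrite subr_gt0.
have [d d0 Hd] := (rcontP _ _).1 cq _ e0.
have k0 := kappa_gt0.
pose c := kappa n p * mu; have c0 : 0 < c by rewrite mulr_gt0.
have [J [JE cJ]] := jacobian_exists hf hg.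
have det0 y : J y != 0 by rewrite -normc_gt0 JE expR_gt0.
pose h t := J (z + t *: v) * (J z)^-1.
(* Re L cancels the terms of nsq (z + t v) - nsq (phi f (z + t v)) that are real parts of
   holomorphic functions; what remains is the purely quadratic exponent of [gE]. *)
pose L t := (2 * c)%:C * (hdot (phi f (z + t *: v) + - phi f z) (phi f z) + - (t * hdot v z)).
have hh : hol_punctured d h.
  apply: holM; last exact: hol_cst.
  by apply: hol_entire => t; exact: cJ.
have hL : hol_punctured d L.
  apply: hol_entire => t; apply: cdiffM; first exact: cdiff_cst.
  apply: cdiffD.
    apply: cdiff_big_sum => k; apply: cdiffM; last exact: cdiff_cst.
    have -> : (fun t => (phi f (z + t *: v) + - phi f z) ord0 k) =
      (fun t => phi f (z + t *: v) ord0 k + - phi f z ord0 k) by apply/funext => u; rewrite !mxE.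
    by apply: cdiffD; [exact: phi_cdiff hf | exact: cdiff_cst].
  have -> : (fun t => - (t * hdot v z)) = (fun t => t * - hdot v z).
    by apply/funext => u; rewrite mulrN.
  by apply: cdiffM; [exact: cdiff_id | exact: cdiff_cst].
have h0 : h 0 = 1 by rewrite /h scale0r addr0 mulfV.
have L0 : L 0 = 0 by rewrite /L scale0r addr0 subrr hdot0l mul0r subr0 mulr0.
have gE t : t != 0 -> log_weight (fun _ : unit => h) L (fun=> 1) t =
    expR (c * normc t ^+ 2 * (nsq v - nsq (phi_quot f z v t))).
  move=> t0; rewrite /log_weight (big_pred1 tt) => [|[]//].
  rewrite powRr1 ?normc_ge0// /h ComplexField.Normc.normcM ComplexField.Normc.normcV.
  rewrite !JE -expRN -!expRD; congr (expR _).
  have E1 : nsq (z + t *: v) = normc t ^+ 2 * nsq v + nsq z + 2 * Re (t * hdot v z).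
    by rewrite addrC nsqD nsqZ hdotZl.
  have E2 : nsq (phi f (z + t *: v)) = normc t ^+ 2 * nsq (phi_quot f z v t) + nsq (phi f z) +
     2 * Re (hdot (phi f (z + t *: v) + - phi f z) (phi f z)).
    by rewrite -{1}[phi f (z + t *: v)](subrK (phi f z)) nsqD nsq_phi_quot.
  have E3 : Re (L t) = 2 * c * (Re (hdot (phi f (z + t *: v) + - phi f z) (phi f z))
      - Re (t * hdot v z)).
    rewrite /L; case: (hdot (_ + _) _) (t * _) => [a b] [a' b'] /=.
    by rewrite mul0r subr0.
  rewrite E1 E2 E3 -/c; ring.
pose r := d / 2; have r0 : 0 < r by rewrite divr_gt0.
have rd : 0 < r < d by rewrite r0/= ltr_pdivrMr// ltr_pMr// ltr1n.
have lt1 t : normc t = r -> log_weight (fun _ : unit => h) L (fun=> 1) t < 1.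
  move=> tr; have t0 : t != 0 by rewrite -normc_gt0 tr.
  rewrite gE// -[ltRHS]expR0 ltr_expR tr pmulr_rlt0 ?mulr_gt0 ?exprn_gt0//.
  rewrite subr_lt0; have := Hd t; rewrite subr0 tr; case/andP: rd => _ rd /(_ rd).
  rewrite q0 ltr_norml => /andP[+ _].
  by rewrite opprB ltrBrDr subrK.
have nr : normc (r%:C : R[i]) = r by rewrite normc_real ger0_norm// ltW.
have S := @log_weight_strict R unit (fun=> h) L (fun=> 1) d r (fun=> hh) hL rd
  (fun=> ler01) (fun=> h0) L0 (fun t tr => ltW (lt1 t tr)) _ nr.
by have := lt1 _ nr; rewrite S ltxx.
Qed.

Lemma phi00 f g : half_aut f g -> phi f 0 = 0.
Proof. by move=> [_ _ _ f0]; rewrite /phi f0. Qed.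

(** The mean value theorem on [0, 1] for the real function s |-> Re <phi(s z), e> with e = phi z: it
    gives |e|^2 = Re <d, e> with d = dphi(c z) z, and |d - e|^2 >= 0 turns this into |e|^2 <= |d|^2
    <= |z|^2. *)
Lemma nsq_phi_le f g z : half_aut f g -> half_aut g f -> nsq (phi f z) <= nsq z.
Proof.
move=> hf hg; set e := phi f z.
pose m (s : R) := Re (hdot (phi f (s%:C *: z)) e).
pose dm (s : R) := Re (hdot (dphi f (s%:C *: z) z) e).
have dmE (s : R) : is_derive s 1 m (dm s).
  apply: is_derive_dist => ep ep0.
  pose S := 1 + \sum_k normc (e ord0 k).
  have S0 : 0 < S by rewrite ltr_pwDl// sumr_ge0// => k _; exact: normc_ge0.
  have eS : 0 < ep / S by rewrite divr_gt0.
  have [d d0 Hd] := phi_quotient (s%:C *: z) z hf eS.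
  exists d => // h /andP[h0 hd].
  have nh : 0 < normc (h%:C : R[i]) < d by rewrite normc_real h0.
  have hC : (h%:C : R[i])^-1 = (h^-1)%:C by rewrite fmorphV.
  have -> : h^-1 * (m (s + h) - m s) - dm s =
    Re (\sum_k ((h%:C)^-1 * (phi f (s%:C *: z + h%:C *: z) ord0 k - phi f (s%:C *: z) ord0 k)
         - dphi f (s%:C *: z) z ord0 k) * (e ord0 k)^*).
    have -> : \sum_k ((h%:C)^-1 * (phi f (s%:C *: z + h%:C *: z) ord0 k - phi f (s%:C *: z) ord0 k)
         - dphi f (s%:C *: z) z ord0 k) * (e ord0 k)^* =
      (h^-1)%:C * (hdot (phi f (s%:C *: z + h%:C *: z)) e - hdot (phi f (s%:C *: z)) e)
         - hdot (dphi f (s%:C *: z) z) e.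
      rewrite -hC /hdot -!sumrB mulr_sumr -sumrB; apply: eq_bigr => k _.
      by rewrite mulrBl -mulrA mulrBl.
    rewrite -scalerDl -rmorphD /m /dm raddfB /=; congr (_ - _).
    by case: (hdot _ _) (hdot _ _) => [a b] [a' b'] /=; rewrite mul0r subr0.
  apply: le_trans (normc_Re _) _.
  have le (I : finType) (F : I -> R[i]) : normc (\sum_i F i) <= \sum_i normc (F i).
    elim/big_ind2: _ => [|x1 x2 y1 y2 h1 h2|//]; first by rewrite ComplexField.Normc.normc0.
    exact: le_trans (normcD _ _) (lerD h1 h2).
  apply: le_trans (le _ _) _.
  apply: (@le_trans _ _ (\sum_k (ep / S) * normc (e ord0 k))).
    apply: ler_sum => k _; rewrite ComplexField.Normc.normcM.
    have -> : normc (e ord0 k)^* = normc (e ord0 k) by case: (e ord0 k) => a b /=; rewrite sqrrN.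
    by rewrite ler_wpM2r ?normc_ge0// ltW// Hd.
  rewrite -mulr_sumr mulrAC ler_pdivrMr// ler_pM2l//.
  by rewrite lerDr ler01.
have [|c _ E] := @MVT_segment R m dm 0 1 ler01 (fun x _ => dmE x).
  apply: continuous_subspaceT => x; apply: differentiable_continuous.
  by apply/derivable1_diffP; have [] := dmE x.
move: E; rewrite subr0 mulr1 /m rmorph1 rmorph0 scale1r scale0r (phi00 hf) hdot0l subr0.
rewrite -/e hdotvv /= => E.
have h1 := dphi_le (c%:C *: z) z hf hg.
have := nsq_ge0 (dphi f (c%:C *: z) z - e); rewrite nsqB -/(dm c) -E => h2.
rewrite -subr_ge0; apply: le_trans h2 _.
have -> : nsq (dphi f (c%:C *: z) z) + nsq e - 2 * nsq e = nsq (dphi f (c%:C *: z) z) - nsq e by ring.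
by rewrite lerD2r.
Qed.

Lemma nsq_phi f g z : half_aut f g -> half_aut g f -> nsq (phi f z) = nsq z.
Proof.
move=> hf hg; apply/eqP; rewrite eq_le (nsq_phi_le z hf hg) /=.
by have := nsq_phi_le (phi f z) hg hf; rewrite (phi_inv p_gt0 mu_gt0 z hf).
Qed.

Lemma phiE f g z : half_aut f g -> half_aut g f -> phi f z = dphi f 0 z.
Proof.
move=> hf hg; have [->|z0] := eqVneq z 0.
  rewrite (phi00 hf) /dphi; have -> : (0, 0) = 0 :> V by [].
  by rewrite /fdiff linear0.
have nq t : t != 0 -> nsq (phi_quot f 0 z t) = nsq z.
  move=> t0; rewrite /phi_quot (negbTE t0) add0r (phi00 hf) subr0 nsqZ (nsq_phi _ hf hg) nsqZ.
  by rewrite mulrA -exprMn -ComplexField.Normc.normcM mulVf// ComplexField.Normc.normc1 expr1n mul1r.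
have hq rho k := phi_quot_hol 0 z rho k hf.
have nq0 : nsq (phi_quot f 0 z 0) = nsq z.
  (* The disc of radius 1 about 1 avoids 0 but has it on its boundary. *)
  apply: (@rcont_reach R (fun t => nsq (phi_quot f 0 z t)) 1 0 1) => //.
  - by rewrite sub0r normcN' ComplexField.Normc.normc1.
  - by apply: rcont_nsq => k; have [] := hq 1 k.
  move=> s s1; apply: nq; apply: contraTneq s1 => /eqP; rewrite addrC addr_eq0 => /eqP ->.
  by rewrite normcN' ComplexField.Normc.normc1 ltxx.
(* The squared norm read as a [weight]: one block of size [n0] and exponent 1 over a trivial base
   part. *)
have wE t : weight (l := 1) (fun=> 1) mu (fun _ t => phi_quot f 0 z t) (fun=> (0 : 'rV[R[i]]_n0)) t = nsq z.
  rewrite /weight big_ord1 nsq0 mulr0 expR0 mulr1 powRr1 ?nsq_ge0//.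
  by have [->|/nq] := eqVneq t 0.
have hd : hol_data (l := 1) 2 (fun _ t => phi_quot f 0 z t) (fun=> (0 : 'rV[R[i]]_n0)).
  split=> [_ k|k]; first exact: hq.
  have -> : (fun _ : R[i] => (0 : 'rV[R[i]]_n0) ord0 k) = fun=> 0 by apply/funext => t; rewrite mxE.
  exact: hol_cst.
have [||||_ /(_ ord0)] := @weight_const R 1 n0 (fun=> n0) (fun=> 1) mu _ mu_gt0 2 _ _ hd _ _ 1.
- by move=> i; exact: ltr01.
- by move=> t _; rewrite !wE.
- by rewrite wE nsq_gt0.
- by rewrite ComplexField.Normc.normc1 ltr1n.
by rewrite /phi_quot eqxx oner_eq0 invr1 !scale1r add0r (phi00 hf) subr0.
Qed.

Definition phi_mx f : 'M[R[i]]_n0 := \matrix_(i, k) phi f (delta_mx ord0 i) ord0 k.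

Lemma phi_mxE f g z : half_aut f g -> half_aut g f -> phi f z = z *m phi_mx f.
Proof.
move=> hf hg.
have lin (k : R[i]) u v : phi f (k *: u + v) = k *: phi f u + phi f v.
  rewrite !(phiE _ hf hg) /dphi.
  have -> : (k *: u + v, 0) = k *: (u, 0) + (v, 0) :> V by congr (_, _); rewrite /= scaler0 addr0.
  by rewrite fdiff_linear.
pose F := HB.pack_for {linear 'rV[R[i]]_n0 -> 'rV[R[i]]_n0} (phi f)
  (GRing.isLinear.Build R[i] 'rV[R[i]]_n0 'rV[R[i]]_n0 *:%R (phi f) lin).
have -> : phi_mx f = lin1_mx F by apply/matrixP => i k; rewrite !mxE.
by rewrite mul_rV_lin1.
Qed.

End BasePart.

(** * Linear isometries are unitary *)

Section Unitary.
Context {R : realType}.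

(** Polarisation yields the real part of the Hermitian product; replacing u by iu yields the
    imaginary part. *)
Lemma isometry_unitary n (A : 'M[R[i]]_n) : (forall v, nsq (v *m A) = nsq v) -> A \is unitarymx.
Proof.
move=> iso.
have re u v : Re (hdot (u *m A) (v *m A)) = Re (hdot u v).
  have := iso (u + v); rewrite mulmxDl !nsqD !iso => /addrI.
  by apply: mulfI; rewrite pnatr_eq0.
have hd u v : hdot (u *m A) (v *m A) = hdot u v.
  have := re ('i *: u) v; rewrite -scalemxAl !hdotZl.
  have := re u v; case: (hdot _ _) (hdot u v) => [a b] [a' b'] /= ->.
  by rewrite !mul0r !mul1r !sub0r => /oppr_inj ->.
apply/unitarymxP/matrixP => i j.
have := hd (delta_mx ord0 i) (delta_mx ord0 j).
have E (B : 'M[R[i]]_n) : hdot (delta_mx ord0 i *m B) (delta_mx ord0 j *m B) = (B *m map_mx Num.conj_op B^T) i j.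
  by rewrite -!rowE /hdot mxE; apply: eq_bigr => k _; rewrite !mxE.
rewrite E -[delta_mx ord0 i]mulmx1 -[delta_mx ord0 j]mulmx1 E => ->.
by rewrite trmx1 map_mx1 mulmx1.
Qed.

End Unitary.

(** * The fibre component *)

Section FibrePart.
Context {R : realType} (l n0 : nat) (n : 'I_l -> nat) (p : 'I_l -> R) (mu : R).
Hypotheses (p_gt0 : forall j, 0 < p j) (mu_gt0 : 0 < mu) (n0_gt0 : (0 < n0)%N).
Hypothesis N_gt0 : (0 < \sum_(j < l) n j)%N.
Local Notation N := (\sum_(j < l) n j)%N.
Local Notation V := ('rV[R[i]]_n0 * 'rV[R[i]]_N)%type.
Local Notation half_aut := (half_aut p mu).
Local Notation psum := (block_psum p).
Implicit Types (z v : 'rV[R[i]]_n0) (w u : 'rV[R[i]]_N) (t : R[i]) (f g : V -> V).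
Implicit Types (q s : R) (j k : 'I_l).

(** Vectors supported on the blocks of exponent [q]; on them [block_psum] is homogeneous, which it
    is not in general. *)
Definition in_group q w := forall j, p j != q -> submxrow w j = 0.

Definition keep (P : pred 'I_l) w : 'rV[R[i]]_N :=
  \mxrow_j (if P j then submxrow w j else 0).

Lemma submxrow_keep P w j : submxrow (keep P w) j = if P j then submxrow w j else 0.
Proof. by rewrite /keep mxrowK. Qed.

Lemma submxrowD w u j : submxrow (w + u) j = submxrow w j + submxrow u j.
Proof. by apply/rowP => k; rewrite !mxE. Qed.

Lemma submxrowN w j : submxrow (- w) j = - submxrow w j.
Proof. by apply/rowP => k; rewrite !mxE. Qed.

Lemma submxrow_sum (F : 'I_l -> 'rV[R[i]]_N) j :
  submxrow (\sum_k F k) j = \sum_k submxrow (F k) j.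
Proof.
elim/big_ind2: _ => [|x1 x2 y1 y2 <- <-|//]; first exact: submxrow0.
exact: submxrowD.
Qed.

Lemma keep_sum w : w = \sum_k keep (pred1 k) w.
Proof.
apply: submxrow_eq => j; rewrite submxrow_sum [RHS](bigD1 j)//= submxrow_keep /= eqxx.
rewrite [X in _ + X]big1 ?addr0// => k kj; rewrite submxrow_keep /=.
by rewrite eq_sym (negbTE kj).
Qed.

Lemma keep1_group k w : in_group (p k) (keep (pred1 k) w).
Proof. by move=> j; rewrite submxrow_keep /=; have [->|//] := eqVneq j k; rewrite eqxx. Qed.

Lemma in_groupZ q (c : R[i]) w : in_group q w -> in_group q (c *: w).
Proof. by move=> H j /H; rewrite submxrowZ => ->; rewrite scaler0. Qed.

Lemma psum_groupZ q s w : 0 < s -> in_group q w ->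
  psum (s%:C *: w) = (s ^+ 2) `^ q * psum w.
Proof.
move=> s0 H; rewrite psumZ /block_psum mulr_sumr; apply: eq_bigr => j _.
rewrite normc_real ger0_norm ?(ltW s0)//; have [pj|/H ->] := eqVneq (p j) q.
  by rewrite -pj.
by rewrite nsq0 powR0 ?gt_eqF// !mulr0.
Qed.

(** The gauge identity over [z] for w rescaled to gauge 1, together with |phi z| = |z|. The
    rescaling weights the blocks of the image by e^(mu |z|^2 (1 - p_j/q)), which grows with z when
    p_j < q. *)
Lemma group_balance f g z w q : half_aut f g -> half_aut g f -> 0 < q -> in_group q w ->
  psum w = 1 ->
  \sum_j nsq (submxrow (fibre f z w) j) `^ p j * expR (mu * nsq z * (1 - p j / q)) = 1.
Proof.
move=> hf hg q0 wq w1.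
pose s := expR (- (mu * nsq z) / (2 * q)); have s0 : 0 < s by exact: expR_gt0.
have s2 : s ^+ 2 = expR (- (mu * nsq z) / q).
  rewrite -[s ^+ 2]powR_mulrn ?(ltW s0)// /s -expRM.
  by congr expR; field; rewrite gt_eqF.
have r1 : rhoD p mu z (s%:C *: w) = 1.
  rewrite /rhoD (psum_groupZ s0 wq) w1 mulr1 s2 -expRM divfK ?gt_eqF//.
  by rewrite expRN mulVf// gt_eqF// expR_gt0.
have := rhoD_eq1 p_gt0 mu_gt0 hf hg r1.
rewrite /rhoD (nsq_phi p_gt0 mu_gt0 N_gt0 z hf hg) fibreZ psumZ mulr_suml => E.
rewrite -[RHS]E; apply: eq_bigr => j _; rewrite normc_real ger0_norm ?(ltW s0)// s2 -expRM.
rewrite [RHS]mulrAC -expRD [RHS]mulrC; congr (_ * expR _).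
by field; rewrite gt_eqF.
Qed.

(** By [group_balance] an entry [b] of block [j] satisfies |b|^(2 p_j) <= e^(- c |z|^2) with c > 0.
    Along a complex line it is an entire function decaying on large circles, against the mean value
    inequality unless it is 0 at the centre. *)
Lemma fibre_low1 f g z w q j : half_aut f g -> half_aut g f -> 0 < q -> in_group q w ->
  psum w = 1 -> p j < q -> submxrow (fibre f z w) j = 0.
Proof.
move=> hf hg q0 wq w1 pq; apply/rowP => k; rewrite [RHS]mxE [LHS]mxE.
set a := tagnat.Rank j k.
pose v : 'rV[R[i]]_n0 := delta_mx ord0 (Ordinal n0_gt0).
have v1 : nsq v = 1.
  rewrite /nsq [LHS](bigD1 (Ordinal n0_gt0))//= [X in _ + X]big1 ?addr0.
    by rewrite !mxE !eqxx /= expr1n expr0n addr0 sqrtr1 expr1n.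
  by move=> i ij; rewrite !mxE (negbTE ij) andbF ComplexField.Normc.normc0 expr0n.
have [b bE] : exists b : R[i] -> R[i], b = fun t => fibre f (z + t *: v) w ord0 a.
  by exists (fun t => fibre f (z + t *: v) w ord0 a).
have b0 : fibre f z w ord0 a = b 0 by rewrite bE scale0r addr0.
have cb t : cdiff b t by rewrite bE; exact: fibre_cdiff hf hg.
rewrite b0; apply/eqP; apply: contraT => bn0; exfalso.
pose y := normc (b 0) `^ (2 * p j).
have y0 : 0 < y by apply: powR_gt0; rewrite normc_gt0.
pose c := mu * (1 - p j / q).
have c0 : 0 < c by rewrite mulr_gt0// subr_gt0 ltr_pdivrMr// mul1r.
(* From r^2 <= 2 |z + t v|^2 + 2 |z|^2 on |t| = r one gets c |z + t v|^2 >= 1 - ln y, hence |b t|^(2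
   p_j) <= y / e. *)
pose r := Num.sqrt (2 * (nsq z + `|1 - ln y| / c) + 1).
have r2p : 0 < 2 * (nsq z + `|1 - ln y| / c) + 1.
  by rewrite ltr_wpDl// mulr_ge0// addr_ge0 ?nsq_ge0// divr_ge0// ltW.
have r0 : 0 < r by rewrite sqrtr_gt0.
have r2 : r ^+ 2 = 2 * (nsq z + `|1 - ln y| / c) + 1 by rewrite sqr_sqrtr// ltW.
pose h t := b t * (b 0)^-1.
have hh : hol_punctured (r + 1) h.
  apply: holM; last exact: hol_cst.
  by apply: hol_entire => t; exact: cb.
have rr : 0 < r < r + 1 by rewrite r0 ltrDl ltr01.
apply: (@log_weight_mean R unit (fun=> h) (fun=> 0) (fun=> 2 * p j) (r + 1) r 1
  (fun=> hh) (hol_cst _ 0) rr (fun=> _) (fun=> _) erefl ltr01).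
- by rewrite mulr_ge0// ltW.
- by rewrite /h mulfV.
move=> t tr; rewrite /log_weight (big_pred1 tt) => [|[]//]; rewrite expR0 mulr1.
rewrite -(ler_pM2r y0) /y -powRM ?normc_ge0// -ComplexField.Normc.normcM /h divfK//.
have nb : normc (b t) `^ (2 * p j) <= nsq (submxrow (fibre f (z + t *: v) w) j) `^ p j.
  rewrite powRrM powR_mulrn ?normc_ge0//; apply: ge0_ler_powR; first exact: ltW.
  - by rewrite nnegrE sqr_ge0.
  - by rewrite nnegrE nsq_ge0.
  rewrite /nsq [leRHS](bigD1 k)//= [X in X ^+ 2 + _](_ : _ = normc (b t)).
    by rewrite lerDl sumr_ge0// => i _; exact: sqr_ge0.
  by rewrite mxE bE.
apply: le_trans nb _; rewrite -/y -{1}(lnK (y0 : y \is Num.pos)) -expRD.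
have := group_balance (z + t *: v) hf hg q0 wq w1; rewrite [LHS](bigD1 j)//= => E.
have : nsq (submxrow (fibre f (z + t *: v) w) j) `^ p j *
     expR (mu * nsq (z + t *: v) * (1 - p j / q)) <= 1.
  rewrite -[leRHS]E lerDl sumr_ge0// => i _; rewrite mulr_ge0 ?powR_ge0 ?expR_ge0//.
rewrite -ler_pdivlMr ?expR_gt0// div1r -expRN => /le_trans; apply; rewrite ler_expR.
have tv : r ^+ 2 <= 2 * nsq (z + t *: v) + 2 * nsq z.
  have := nsqD_le (z + t *: v) (- z); rewrite addrC addKr nsqN nsqZ v1 mulr1 tr.
  by [].
have ge : `|1 - ln y| / c <= nsq (z + t *: v).
  by move: tv; rewrite r2 -(ler_pM2l (ltr0Sn R 1)); lra.
have -> : mu * nsq (z + t *: v) * (1 - p j / q) = nsq (z + t *: v) * c by rewrite /c; ring.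
rewrite ler_pdivrMr// in ge; rewrite lerNl opprD opprK.
by apply: le_trans ge; apply: le_trans (ler_norm _).
Qed.

Lemma fibre_low f g z w q j : half_aut f g -> half_aut g f -> 0 < q -> in_group q w ->
  p j < q -> submxrow (fibre f z w) j = 0.
Proof.
move=> hf hg q0 wq pq; have [->|w0] := eqVneq w 0; first by rewrite fibre0 submxrow0.
have [s s0 s1] := psumZ_surj p_gt0 w0 ltr01.
have := fibre_low1 z hf hg q0 (in_groupZ s%:C wq) s1 pq.
rewrite fibreZ submxrowZ => /eqP; rewrite scaler_eq0 => /orP[|/eqP//].
by rewrite -normc_eq0 normc_real normr_eq0 gt_eqF.
Qed.

Lemma fibreD f z u w : fibre f z (u + w) = fibre f z u + fibre f z w.
Proof. exact: linearD. Qed.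

Lemma fibre_keep f z u : fibre f z u = \sum_j fibre f z (keep (pred1 j) u).
Proof. by rewrite {1}[u]keep_sum; exact: linear_sum. Qed.

(** The triangularity of [fibre_low] seen from the target: blocks of exponent above [p k] contribute
    nothing to block [k]. *)
Lemma fibre_high f g z u k : half_aut f g -> half_aut g f ->
  (forall j, submxrow u j != 0 -> p k < p j) -> submxrow (fibre f z u) k = 0.
Proof.
move=> hf hg H; rewrite fibre_keep submxrow_sum; apply: big1 => j _.
have [u0|u0] := eqVneq (submxrow u j) 0.
  have -> : keep (pred1 j) u = 0; last by rewrite fibre0 submxrow0.
  by apply: submxrow_eq => i; rewrite submxrow_keep submxrow0 /=; case: eqP => [->|].
exact: fibre_low hf hg (p_gt0 j) (@keep1_group j u) (H _ u0).
Qed.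

(* The diagonal part of [fibre f] on the blocks of exponent [q] is a contraction,
   and so is its inverse, the diagonal part of [fibre g]; hence both preserve
   [block_psum], which leaves no mass for the other blocks. *)
Lemma fibre_group1 f g z w q : half_aut f g -> half_aut g f -> 0 < q -> in_group q w ->
  psum w = 1 -> in_group q (fibre f z w) /\ psum (fibre f z w) = 1.
Proof.
move=> hf hg q0 wq w1; set b := fibre f z w.
pose u := keep (fun j => p j == q) b.
have uq : in_group q u by move=> j pj; rewrite submxrow_keep (negbTE pj).
have psumu : psum u = \sum_(j | p j == q) nsq (submxrow b j) `^ p j.
  rewrite /block_psum [RHS]big_mkcond; apply: eq_bigr => j _; rewrite submxrow_keep.
  by case: eqP => // _; rewrite nsq0 powR0 ?gt_eqF.
have bal := group_balance z hf hg q0 wq w1; rewrite -/b in bal.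
have balq : \sum_j nsq (submxrow b j) `^ p j * expR (mu * nsq z * (1 - p j / q)) =
   psum u + \sum_(j | p j != q) nsq (submxrow b j) `^ p j * expR (mu * nsq z * (1 - p j / q)).
  rewrite [LHS](bigID (fun j => p j == q)) /= psumu; congr (_ + _).
  apply: eq_bigr => j /eqP ->.
  by rewrite divff ?gt_eqF// subrr mulr0 expR0 mulr1.
have rest0 j : p j != q -> 0 <= nsq (submxrow b j) `^ p j * expR (mu * nsq z * (1 - p j / q)).
  by move=> _; rewrite mulr_ge0 ?powR_ge0 ?expR_ge0.
have u1 : psum u <= 1 by rewrite -bal balq lerDl sumr_ge0.
(* In b - u the blocks of exponent [q] are removed and those of smaller exponent vanish by
   [fibre_low]; the rest does not reach block [k], by [fibre_high]. *)
have Cu k : p k = q -> submxrow (fibre g (phi f z) u) k = submxrow w k.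
  move=> pk; have <- : fibre g (phi f z) u + fibre g (phi f z) (b - u) = w.
    by rewrite -fibreD [u + _]addrC subrK (fibre_inv p_gt0 mu_gt0 z w hf hg).
  rewrite submxrowD [X in _ = _ + X](_ : _ = 0) ?addr0//.
  apply: (fibre_high _ hg hf) => j; rewrite submxrowD submxrowN submxrow_keep pk.
  have [_|pj] := eqVneq (p j) q; first by rewrite subrr eqxx.
  rewrite subr0; apply: contraR; rewrite -leNgt le_eqVlt (negbTE pj) /= => lt.
  by apply/eqP; exact: (fibre_low _ hf hg q0 wq lt).
have u_neq0 : u != 0.
  apply: contra_eq_neq w1 => u0; rewrite [w](_ : _ = 0) ?psum0 ?(eq_sym 0) ?oner_neq0//.
  apply: submxrow_eq => k; rewrite submxrow0; have [pk|/wq//] := eqVneq (p k) q.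
  by rewrite -Cu// u0 fibre0 submxrow0.
have [s s0 s1] := psumZ_surj p_gt0 u_neq0 ltr01.
have sg : 0 < (s ^+ 2) `^ q by rewrite powR_gt0// exprn_gt0.
(* On the blocks of exponent [q], s w is the diagonal part of the image under [g] of the sphere
   vector s u, so the balance for [g] bounds its mass by 1. Hence psum u >= 1. *)
have le1 : (s ^+ 2) `^ q <= 1.
  have -> : (s ^+ 2) `^ q = psum (s%:C *: w) by rewrite (psum_groupZ s0 wq) w1 mulr1.
  rewrite -[leRHS](group_balance (phi f z) hg hf q0 (in_groupZ s%:C uq) s1) /block_psum.
  apply: ler_sum => j _; have [pj|/wq E] := eqVneq (p j) q; last first.
    by rewrite submxrowZ E scaler0 nsq0 powR0 ?gt_eqF// mulr_ge0 ?powR_ge0 ?expR_ge0.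
  by rewrite fibreZ !submxrowZ Cu// pj divff ?gt_eqF// subrr mulr0 expR0 mulr1.
have psu : psum u = 1.
  apply/eqP; rewrite eq_le u1 /=; move: s1; rewrite (psum_groupZ s0 uq) => <-.
  by rewrite ler_piMl ?psum_ge0.
have bq : in_group q b.
  move=> j pj; move: bal; rewrite balq psu -[X in _ = X]addr0 => /addrI E.
  have := psumr_eq0P rest0 E pj => /eqP; rewrite mulf_eq0 (gt_eqF (expR_gt0 _)) orbF.
  by move=> /eqP/powR_eq0_eq0/eqP; rewrite nsq_eq0 => /eqP.
split; first exact: bq.
rewrite -[RHS]psu; congr block_psum; apply: submxrow_eq => j.
by rewrite submxrow_keep; have [//|/bq] := eqVneq (p j) q.
Qed.

Lemma group_scale (P : 'rV[R[i]]_N -> Prop) q : P 0 ->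
  (forall s w, 0 < s -> P (s%:C *: w) -> P w) ->
  (forall w, in_group q w -> psum w = 1 -> P w) -> forall w, in_group q w -> P w.
Proof.
move=> P0 PZ P1 w wq; have [->//|w0] := eqVneq w 0.
have [s s0 s1] := psumZ_surj p_gt0 w0 ltr01.
by apply: (PZ _ _ s0); apply: P1 => //; exact: in_groupZ.
Qed.

Lemma fibre_group f g z w q : half_aut f g -> half_aut g f -> 0 < q -> in_group q w ->
  in_group q (fibre f z w) /\ psum (fibre f z w) = psum w.
Proof.
move=> hf hg q0 wq0.
(* The premise is doubled on purpose: one copy is consumed by [group_scale], the other belongs to
   the property to which it is applied. *)
suff H : forall w, in_group q w -> in_group q w -> in_group q (fibre f z w) /\
  psum (fibre f z w) = psum w by exact: H.
move=> {wq0}w; move: w; apply: (group_scale (q := q)) => [_|s w s0 H wq|w wq w1 _].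
- by rewrite fibre0; split=> // j _; rewrite submxrow0.
- have sC : (s%:C : R[i]) != 0 by rewrite -normc_eq0 normc_real normr_eq0 gt_eqF.
  have [] := H (in_groupZ _ wq); rewrite fibreZ => sq; have fq : in_group q (fibre f z w).
    by rewrite -[fibre f z w](scalerK sC); exact: in_groupZ.
  rewrite (psum_groupZ s0 fq) (psum_groupZ s0 wq) => /mulfI E; split => //; apply: E.
  by rewrite gt_eqF// powR_gt0// exprn_gt0.
by rewrite w1; exact: fibre_group1 hf hg q0 wq w1.
Qed.

(** For u on the sphere and of one exponent, t |-> B(t z) u is a holomorphic curve on which the
    gauge is constantly 1, so [weight_const] makes it constant. *)
Lemma fibre_const f g z w : half_aut f g -> half_aut g f -> fibre f z w = fibre f 0 w.
Proof.
move=> hf hg; suff H q u : 0 < q -> in_group q u -> fibre f z u = fibre f 0 u.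
  rewrite (fibre_keep f z) (fibre_keep f 0); apply: eq_bigr => j _.
  exact: H (p_gt0 j) (@keep1_group j w).
move=> q0; move: u; apply: (group_scale (q := q)) => [|s u s0|u uq u1].
- by rewrite !fibre0.
- rewrite !fibreZ; apply: scalerI.
  by rewrite -normc_eq0 normc_real normr_eq0 gt_eqF.
pose c j t := submxrow (fibre f (0 + t *: z) u) j.
have hd : hol_data 2 c (fun=> (0 : 'rV[R[i]]_n0)).
  split=> [j k|k].
    have -> : (fun t => c j t ord0 k) = (fun t => fibre f (0 + t *: z) u ord0 (tagnat.Rank j k)).
      by apply/funext => t; rewrite !mxE.
    by apply: hol_entire => t; exact: fibre_cdiff hf hg.
  have -> : (fun _ : R[i] => (0 : 'rV[R[i]]_n0) ord0 k) = fun=> 0 by apply/funext => t; rewrite mxE.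
  exact: hol_cst.
have wE t : weight p mu c (fun=> (0 : 'rV[R[i]]_n0)) t = 1.
  rewrite /weight nsq0 mulr0 expR0 mulr1 -u1.
  exact: (fibre_group (0 + t *: z) hf hg q0 uq).2.
have n1 : normc (1 : R[i]) < 2 by rewrite ComplexField.Normc.normc1 ltr1n.
have [||_ cE] := weight_const p_gt0 mu_gt0 hd _ _ n1.
- by move=> t _; rewrite !wE.
- by rewrite wE ltr01.
apply: submxrow_eq => j; have := cE j; rewrite /c scale1r scale0r add0r addr0.
by [].
Qed.

End FibrePart.

(** * Permutation of the blocks *)

Section PowerInequalities.
Context {R : realType}.
Implicit Types (q x y A B : R).

(** Young's inequality for x and 1 with the conjugate exponents q and q/(q - 1). *)
Lemma powR_bernoulli q x : 1 < q -> 0 <= x -> 1 + q * (x - 1) <= x `^ q.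
Proof.
move=> q1 x0; have q0 : 0 < q by exact: lt_trans q1.
have q10 : 0 < q - 1 by rewrite subr_gt0.
have r0 : 0 < q / (q - 1) by rewrite divr_gt0.
have E : q^-1 + (q / (q - 1))^-1 = 1 by field; rewrite (gt_eqF q0) (gt_eqF q10).
have := conjugate_powR x0 ler01 q0 r0 E; rewrite powR1 !mulr1 mul1r => h.
have -> : 1 + q * (x - 1) = q * (x - (q / (q - 1))^-1).
  by field; rewrite (gt_eqF q0) (gt_eqF q10).
by rewrite mulrC -ler_pdivlMr// lerBlDr.
Qed.

(** Bernoulli's inequality at x/m and y/m for the midpoint m; the two deviations from 1 cancel. *)
Lemma powR_midconvex q x y : 1 < q -> 0 <= x -> 0 <= y ->
  2 * ((x + y) / 2) `^ q <= x `^ q + y `^ q.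
Proof.
move=> q1 x0 y0; set m := (x + y) / 2.
have m0 : 0 <= m by rewrite divr_ge0// addr_ge0.
have [mE|mn0] := eqVneq m 0.
  rewrite mE powR0; first by rewrite mulr0 addr_ge0 ?powR_ge0.
  by rewrite gt_eqF// (lt_trans ltr01).
have mp : 0 < m by rewrite lt_def mn0.
have sc u : 0 <= u -> u `^ q = m `^ q * (u / m) `^ q.
  move=> u0; rewrite -(powRM q m0 (divr_ge0 u0 m0)); congr (_ `^ q).
  by rewrite mulrC divfK.
rewrite (sc x)// (sc y)// -mulrDr mulrC ler_wpM2l ?powR_ge0//.
have h1 := powR_bernoulli q1 (divr_ge0 x0 m0); have h2 := powR_bernoulli q1 (divr_ge0 y0 m0).
apply: le_trans (lerD h1 h2).
have -> : 1 + q * (x / m - 1) + (1 + q * (y / m - 1)) = 2 + q * ((x + y) / m - 2) by ring.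
have -> : (x + y) / m = 2 by rewrite /m; field; move: mn0; rewrite /m mulf_eq0 negb_or => /andP[].
by rewrite subrr mulr0 addr0.
Qed.

(** The convex case with exponent 1/q, applied to x^q and y^q. *)
Lemma powR_midconcave q x y : 0 < q < 1 -> 0 <= x -> 0 <= y ->
  x `^ q + y `^ q <= 2 * ((x + y) / 2) `^ q.
Proof.
move=> /andP[q0 q1] x0 y0; have r1 : 1 < q^-1 by rewrite invf_gt1.
have E u : 0 <= u -> (u `^ q) `^ q^-1 = u.
  by move=> u0; rewrite -powRrM mulfV ?(gt_eqF q0)// powRr1.
have := powR_midconvex r1 (powR_ge0 x q) (powR_ge0 y q).
rewrite (E x x0) (E y y0) mulrC -ler_pdivlMr// => h.
have s0 : 0 <= (x `^ q + y `^ q) / 2 by rewrite divr_ge0// addr_ge0// powR_ge0.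
have t0 : 0 <= (x + y) / 2 by rewrite divr_ge0// addr_ge0.
have := ge0_ler_powR (ltW q0) _ _ h; rewrite !nnegrE powR_ge0 t0 => /(_ isT isT).
by rewrite -powRrM mulVf ?(gt_eqF q0)// powRr1// ler_pdivrMr// mulrC.
Qed.

Lemma powR_superadd q A B : 1 < q -> 0 < A -> 0 < B -> A `^ q + B `^ q < (A + B) `^ q.
Proof.
move=> q1 A0 B0; have q0 : 0 < q by exact: lt_trans q1.
have q10 : 0 < q - 1 by rewrite subr_gt0.
rewrite -!(mulr_powRB1 _ q0) ?addr_ge0 ?ltW// mulrDl; apply: ltrD.
  by rewrite ltr_pM2l// gt0_ltr_powR ?nnegrE ?addr_ge0 ?(ltW A0) ?(ltW B0)// ltrDl.
by rewrite ltr_pM2l// gt0_ltr_powR ?nnegrE ?addr_ge0 ?(ltW A0) ?(ltW B0)// ltrDr.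
Qed.

Lemma powR_subadd q A B : 0 < q < 1 -> 0 < A -> 0 < B -> (A + B) `^ q < A `^ q + B `^ q.
Proof.
move=> /andP[q0 q1] A0 B0; have q10 : 0 < 1 - q by rewrite subr_gt0.
have H u v : 0 < u -> 0 < v -> (u + v) `^ (q - 1) < u `^ (q - 1).
  move=> u0 v0; rewrite -opprB !powRN ltf_pV2 ?posrE ?powR_gt0 ?addr_gt0//.
  by rewrite gt0_ltr_powR ?nnegrE ?addr_ge0 ?(ltW u0) ?(ltW v0)// ltrDl.
rewrite -!(mulr_powRB1 _ q0) ?addr_ge0 ?ltW// mulrDl; apply: ltrD.
  by rewrite ltr_pM2l// H.
by rewrite ltr_pM2l// addrC H.
Qed.

(** The defect of the parallelogram identity with squared norms raised to the power [q]. It is 0 for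
    q = 1 or when a vector vanishes, and otherwise has the sign of q - 1. *)
Definition clarkson q k (a b : 'rV[R[i]]_k) : R :=
  nsq (a + b) `^ q + nsq (a - b) `^ q - 2 * (nsq a `^ q + nsq b `^ q).

Lemma nsq_mid k (a b : 'rV[R[i]]_k) : (nsq (a + b) + nsq (a - b)) / 2 = nsq a + nsq b.
Proof. by rewrite nsqB nsqD; field. Qed.

Lemma clarkson0l q k (b : 'rV[R[i]]_k) : 0 < q -> clarkson q 0 b = 0.
Proof.
by move=> q0; rewrite /clarkson !add0r nsqN nsq0 powR0 ?gt_eqF// add0r; ring.
Qed.

Lemma clarkson0r q k (a : 'rV[R[i]]_k) : 0 < q -> clarkson q a 0 = 0.
Proof.
by move=> q0; rewrite /clarkson subr0 addr0 nsq0 powR0 ?gt_eqF// addr0; ring.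
Qed.

Lemma clarkson_gt0 q k (a b : 'rV[R[i]]_k) : 1 < q -> a != 0 -> b != 0 -> 0 < clarkson q a b.
Proof.
move=> q1 a0 b0; rewrite subr_gt0.
apply: lt_le_trans (powR_midconvex q1 (nsq_ge0 _) (nsq_ge0 _)).
by rewrite nsq_mid ltr_pM2l// powR_superadd ?nsq_gt0.
Qed.

Lemma clarkson_lt0 q k (a b : 'rV[R[i]]_k) : 0 < q < 1 -> a != 0 -> b != 0 -> clarkson q a b < 0.
Proof.
move=> q1 a0 b0; rewrite subr_lt0.
apply: le_lt_trans (powR_midconcave q1 (nsq_ge0 _) (nsq_ge0 _)) _.
by rewrite nsq_mid ltr_pM2l// powR_subadd ?nsq_gt0.
Qed.

(** For fixed [q] all the terms have the same sign, so each of them is 0, and a term with two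
    nonzero vectors is not. *)
Lemma clarkson_sum_eq0 (I : finType) (d : I -> nat) q (a b : forall i, 'rV[R[i]]_(d i)) :
  0 < q -> q != 1 -> \sum_i clarkson q (a i) (b i) = 0 -> forall i, a i = 0 \/ b i = 0.
Proof.
move=> q0 q1 S0 i; have [->|ai] := eqVneq (a i) 0; first by left.
have [->|bi] := eqVneq (b i) 0; first by right.
exfalso; case: (ltgtP q 1) => q1'; last by rewrite q1' eqxx in q1.
  have q01 : 0 < q < 1 by rewrite q0.
  have le j : true -> 0 <= - clarkson q (a j) (b j).
    move=> _; have [->|aj] := eqVneq (a j) 0; first by rewrite clarkson0l// oppr0.
    have [->|bj] := eqVneq (b j) 0; first by rewrite clarkson0r// oppr0.
    by rewrite oppr_ge0 ltW// clarkson_lt0.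
  have S1 : \sum_j - clarkson q (a j) (b j) = 0 by rewrite sumrN S0 oppr0.
  have := psumr_eq0P le S1 (erefl true : true) => /(_ i) /eqP.
  by rewrite oppr_eq0 lt_eqF// clarkson_lt0.
have le j : true -> 0 <= clarkson q (a j) (b j).
  move=> _; have [->|aj] := eqVneq (a j) 0; first by rewrite clarkson0l.
  have [->|bj] := eqVneq (b j) 0; first by rewrite clarkson0r.
  by rewrite ltW// clarkson_gt0.
have := psumr_eq0P le S0 (erefl true : true) => /(_ i) /eqP.
by rewrite gt_eqF// clarkson_gt0.
Qed.

End PowerInequalities.

(** * The fibre map as a matrix of blocks *)

Section Blocks.
Context {R : realType} (l n0 : nat) (n : 'I_l -> nat) (p : 'I_l -> R) (mu : R).
Hypotheses (p_gt0 : forall j, 0 < p j) (mu_gt0 : 0 < mu) (n0_gt0 : (0 < n0)%N).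
Hypothesis N_gt0 : (0 < \sum_(j < l) n j)%N.
Hypothesis p_neq1 : forall j : 'I_l, (0 < j)%N -> p j <> 1.
Hypothesis n_gt0 : forall j : 'I_l, (0 < n j)%N.
Local Notation N := (\sum_(j < l) n j)%N.
Local Notation V := ('rV[R[i]]_n0 * 'rV[R[i]]_N)%type.
Local Notation psum := (block_psum p).
Variables (f g : V -> V).
Hypotheses (hf : half_aut p mu f g) (hg : half_aut p mu g f).
Implicit Types (w u : 'rV[R[i]]_N) (j k : 'I_l).

Lemma psumD_disjoint w u : (forall j, submxrow w j = 0 \/ submxrow u j = 0) ->
  psum (w + u) = psum w + psum u.
Proof.
move=> H; rewrite /block_psum -big_split; apply: eq_bigr => j _ /=; rewrite submxrowD.
by case: (H j) => ->; rewrite nsq0 powR0 ?gt_eqF// ?add0r ?addr0.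
Qed.

Lemma psumN u : psum (- u) = psum u.
Proof. by apply: eq_bigr => j _; rewrite submxrowN nsqN. Qed.

Lemma in_groupD q w u : in_group p q w -> in_group p q u -> in_group p q (w + u).
Proof. by move=> hw hu j pj; rewrite submxrowD hw// hu// addr0. Qed.

Lemma in_groupN q u : in_group p q u -> in_group p q (- u).
Proof. by move=> hu j pj; rewrite submxrowN hu// oppr0. Qed.

Lemma fibreN z u : fibre f z (- u) = - fibre f z u.
Proof. exact: linearN. Qed.

(* The parallelogram trick: for [q <> 1] equality in Clarkson's inequality
   forces disjoint supports. *)
Lemma fibre_disjoint q w u : 0 < q -> q != 1 -> in_group p q w -> in_group p q u ->
  (forall j, submxrow w j = 0 \/ submxrow u j = 0) ->
  forall j, submxrow (fibre f 0 w) j = 0 \/ submxrow (fibre f 0 u) j = 0.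
Proof.
move=> q0 q1 wq uq H.
have uq' := in_groupN uq.
have grp v (vq : in_group p q v) := fibre_group p_gt0 mu_gt0 n0_gt0 N_gt0 0 hf hg q0 vq.
have [aq aE] := grp w wq; have [bq bE] := grp u uq.
have [_ sE] := grp (w + u) (in_groupD wq uq).
have [_ dE] := grp (w - u) (in_groupD wq uq').
have H' j : submxrow w j = 0 \/ submxrow (- u) j = 0.
  by case: (H j) => h; [left | right; rewrite submxrowN h oppr0].
rewrite psumD_disjoint// in sE; rewrite psumD_disjoint// psumN in dE.
rewrite !fibreD ?fibreN -aE -bE in sE dE.
move: aq bq sE dE; move: (fibre f 0 w) (fibre f 0 u) => a b aq bq sE dE.
apply: (clarkson_sum_eq0 q0 q1 (a := fun j => submxrow a j) (b := fun j => submxrow b j)).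
have -> : \sum_j clarkson q (submxrow a j) (submxrow b j) =
   psum (a + b) + psum (a - b) - 2 * (psum a + psum b).
  rewrite /block_psum -!big_split mulr_sumr -sumrB; apply: eq_bigr => j _ /=.
  have [->|pj] := eqVneq (p j) q; first by rewrite !submxrowD submxrowN.
  rewrite !submxrowD submxrowN (aq _ pj) (bq _ pj) clarkson0l// subr0 addr0 nsq0.
  by rewrite powR0 ?gt_eqF// !addr0 mulr0 subr0.
by rewrite sE dE; ring.
Qed.

Definition emb j : 'M[R[i]]_(n j, N) := \matrix_(k, a) (a == tagnat.Rank j k)%:R.

Lemma emb_entry j (x : 'rV[R[i]]_(n j)) (k : 'I_(n j)) : submxrow (x *m emb j) j ord0 k = x ord0 k.
Proof.
rewrite !mxE [LHS](bigD1 k)//= !mxE eqxx mulr1 [X in _ + X]big1 ?addr0// => i ik.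
rewrite !mxE; case: eqP => [E|_]; last by rewrite mulr0.
by have /eqP := tagnat.rank_inj E; rewrite eq_Tagged /= eq_sym (negbTE ik).
Qed.

Lemma submxrow_emb j (x : 'rV[R[i]]_(n j)) : submxrow (x *m emb j) j = x.
Proof. by apply/rowP => k; rewrite emb_entry. Qed.

Lemma submxrow_emb_neq i j (x : 'rV[R[i]]_(n i)) : j != i -> submxrow (x *m emb i) j = 0.
Proof.
move=> ji; apply/rowP => k; rewrite !mxE big1// => h _; rewrite !mxE.
case: eqP => [E|_]; last by rewrite mulr0.
have := congr1 (@tagnat.sig1 _ _) E; rewrite !tagnat.Rank1K => ij.
by rewrite ij eqxx in ji.
Qed.

Lemma keep_emb j w : keep (pred1 j) w = submxrow w j *m emb j.
Proof.
apply: submxrow_eq => k; rewrite submxrow_keep /=.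
by have [->|kj] := eqVneq k j; [rewrite submxrow_emb | rewrite submxrow_emb_neq].
Qed.

Lemma mul_emb_tr w j : w *m (emb j)^T = submxrow w j.
Proof.
apply/rowP => k; rewrite !mxE [LHS](bigD1 (tagnat.Rank j k))//= !mxE eqxx mulr1.
rewrite [X in _ + X]big1 ?addr0// => a aj.
by rewrite !mxE (negbTE aj) mulr0.
Qed.

Lemma emb_group j (x : 'rV[R[i]]_(n j)) : in_group p (p j) (x *m emb j).
Proof. by move=> k pk; apply: submxrow_emb_neq; apply: contraNneq pk => ->. Qed.

Lemma psum_emb j (x : 'rV[R[i]]_(n j)) : psum (x *m emb j) = nsq x `^ p j.
Proof.
rewrite /block_psum [LHS](bigD1 j)//= submxrow_emb [X in _ + X]big1 ?addr0// => k kj.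
by rewrite submxrow_emb_neq// nsq0 powR0 ?gt_eqF.
Qed.

Definition block_mx i j : 'M[R[i]]_(n i, n j) := emb i *m fibre_mx f 0 *m (emb j)^T.

Lemma mul_block_mx i j (x : 'rV[R[i]]_(n i)) :
  x *m block_mx i j = submxrow (fibre f 0 (x *m emb i)) j.
Proof. by rewrite /block_mx !mulmxA mul_emb_tr mul_fibre_mx. Qed.

Lemma fibre_blocks w j : submxrow (fibre f 0 w) j = \sum_i submxrow w i *m block_mx i j.
Proof.
rewrite fibre_keep submxrow_sum; apply: eq_bigr => i _.
by rewrite mul_block_mx keep_emb.
Qed.

Lemma fibre_emb_group i (x : 'rV[R[i]]_(n i)) :
  in_group p (p i) (fibre f 0 (x *m emb i)) /\ psum (fibre f 0 (x *m emb i)) = nsq x `^ p i.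
Proof.
have := fibre_group p_gt0 mu_gt0 n0_gt0 N_gt0 0 hf hg (p_gt0 i) (@emb_group i x).
by rewrite psum_emb.
Qed.

(** Blocks of different exponents have images in different groups. Two distinct blocks of equal
    exponent cannot have exponent 1, since only index 0 may carry it, so the Clarkson argument
    applies. *)
Lemma block_mx_disjoint i k j (x : 'rV[R[i]]_(n i)) (y : 'rV[R[i]]_(n k)) : i != k ->
  x *m block_mx i j = 0 \/ y *m block_mx k j = 0.
Proof.
move=> ik; rewrite !mul_block_mx.
have [gx _] := fibre_emb_group x; have [gy _] := fibre_emb_group y.
have [pik|pik] := eqVneq (p i) (p k); last first.
  have [pj|/gx] := eqVneq (p j) (p i); last by left.
  by right; apply: gy; rewrite pj.
have p1 : p i != 1.
  apply/eqP => pi1; case: (posnP i) => [i0|/p_neq1//].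
  case: (posnP k) => [k0|/p_neq1]; last by rewrite -pik.
  by move/eqP: ik; apply; apply: val_inj; rewrite /= i0 k0.
apply: (fibre_disjoint (p_gt0 i) p1); first exact: emb_group.
  by rewrite pik; exact: emb_group.
move=> h; have [->|hi] := eqVneq h i; last by left; exact: submxrow_emb_neq.
by right; exact: submxrow_emb_neq.
Qed.

(** Each source block has a nonzero image in some target block [tau i]. By disjointness no two
    sources share a target, so [tau] is injective on a finite set, hence a permutation. *)
Lemma block_permutation : exists tau : 'S_l,
  [/\ forall i, p (tau i) = p i, forall i, n (tau i) = n i,
      forall i j, j != tau i -> block_mx i j = 0 &
      forall i j (x : 'rV[R[i]]_(n i)), j = tau i -> nsq (x *m block_mx i j) = nsq x].
Proof.
have ex i : exists jx : 'I_l * 'rV[R[i]]_(n i), jx.2 *m block_mx i jx.1 != 0.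
  pose x : 'rV[R[i]]_(n i) := delta_mx ord0 (Ordinal (n_gt0 i)).
  have x0 : x != 0.
    apply/eqP => /rowP /(_ (Ordinal (n_gt0 i))) /eqP.
    by rewrite !mxE !eqxx oner_eq0.
  have [_ xE] := fibre_emb_group x.
  have b0 : fibre f 0 (x *m emb i) != 0.
    apply/eqP => b0; move: xE; rewrite b0 psum0// => /esym/powR_eq0_eq0/eqP.
    by rewrite nsq_eq0 (negbTE x0).
  apply: contrapT => H; move/eqP: b0; apply; apply: submxrow_eq => j.
  rewrite submxrow0 -mul_block_mx; apply/eqP; apply: contraT => ne.
  by case: H; exists (j, x).
pose tau0 i := (projT1 (cid (ex i))).1.
have wit i : exists x : 'rV[R[i]]_(n i), x *m block_mx i (tau0 i) != 0.
  by exists (projT1 (cid (ex i))).2; exact: (projT2 (cid (ex i))).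
have tinj : injective tau0.
  move=> i k E; apply/eqP; apply: contraT => ik.
  have [x hx] := wit i; have [y] := wit k; rewrite -E => hy.
  by case: (block_mx_disjoint (tau0 i) x y ik) => /eqP h; [move: hx|move: hy]; rewrite h.
pose tau := perm tinj.
have tauE i : tau i = tau0 i by rewrite permE.
(* Every target [j] is [tau k] for some k, already reached from block [k]; disjointness excludes any
   other source. *)
have van i j : j != tau i -> block_mx i j = 0.
  move=> ji; apply/row_matrixP => h; rewrite row0 rowE.
  have [k kE] : exists k, j = tau k by exists (tau^-1%g j); rewrite permKV.
  have ik : i != k by apply: contra_neq ji => ->.
  have [y hy] := wit k; rewrite -tauE -kE in hy.
  by case: (block_mx_disjoint j (delta_mx 0 h) y ik) => // /eqP hy'; rewrite hy' in hy.
have pt i : p (tau i) = p i.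
  have [x] := wit i; rewrite -tauE mul_block_mx; have [gx _] := fibre_emb_group x.
  by move=> h; apply/eqP; apply: contraNT h => /gx ->.
have iso i j (x : 'rV[R[i]]_(n i)) : j = tau i -> nsq (x *m block_mx i j) = nsq x.
  move=> ->; have [gx xE] := fibre_emb_group x; move: xE.
  rewrite /block_psum [LHS](bigD1 (tau i))//= [X in _ + X]big1 ?addr0; last first.
    by move=> j' ji; rewrite -mul_block_mx van// mulmx0 nsq0 powR0 ?gt_eqF.
  by rewrite -mul_block_mx pt => /powR_injective; apply; rewrite ?nnegrE ?nsq_ge0.
(* A norm-preserving block has trivial kernel, so its rank is [n i]. *)
have le i : (n i <= n (tau i))%N.
  have /eqP <- : row_free (block_mx i (tau i)).
    apply: inj_row_free => v v0; apply/eqP; rewrite -nsq_eq0 -(iso i (tau i))//.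
    by rewrite v0 nsq0.
  exact: rank_leq_col.
(* A permutation does not change the sum of the sizes, so none of the inequalities is strict. *)
have nt i : n (tau i) = n i.
  apply/eqP; rewrite eqn_leq le andbT leqNgt; apply/negP => lt.
  have : (\sum_i n i < \sum_i n (tau i))%N.
    rewrite (bigD1 i)//= [ltnRHS](bigD1 i)//= -addSn; apply: leq_add => //.
    by apply: leq_sum => k _.
  by rewrite -[ltnRHS](reindex_inj (h := tau) (P := predT) (F := n) perm_inj) ltnn.
by exists tau; split.
Qed.

End Blocks.

(** * Casts between blocks of equal size, and the theorem *)

Lemma mul_cast_vec (C : pzRingType) (m m' k : nat) (e : m = m') (u : 'rV[C]_m) (M : 'M[C]_(m, k)) :
  castmx (erefl 1%N, e) u *m castmx (e, erefl k) M = u *m M.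
Proof. by case: m' / e; rewrite !castmx_id. Qed.

Lemma nsq_cast (R : realType) (m m' k : nat) (e : m = m') (v : 'rV[R[i]]_m') (M : 'M[R[i]]_(m, k)) :
  (forall u : 'rV[R[i]]_m, nsq (u *m M) = nsq u) ->
  nsq (v *m castmx (e, erefl k) M) = nsq v.
Proof. by case: m' / e v => v H; rewrite castmx_id. Qed.

Theorem corollary1p5 (R : realType) (n0 l : nat) (n : 'I_l -> nat)
    (p : 'I_l -> R) (mu : R)
    (n0_gt0 : (0 < n0)%N) (l_gt0 : (0 < l)%N)
    (n_gt0 : forall j : 'I_l, (0 < n j)%N)
    (p_gt0 : forall j : 'I_l, 0 < p j)
    (mu_gt0 : 0 < mu)
    (p_neq1 : forall j : 'I_l, (0 < j)%N -> p j <> 1)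
    (f : 'rV[R[i]]_n0 * 'rV[R[i]]_(\sum_(j < l) n j) ->
         'rV[R[i]]_n0 * 'rV[R[i]]_(\sum_(j < l) n j))
    (f_bihol : biholomorphic (FBH_domain n0 n p mu) (FBH_domain n0 n p mu) f)
    (f0 : f (0, 0) = (0, 0)) :
  exists (sigma : 'S_l) (n_sigma : forall j : 'I_l, n (sigma j) = n j)
         (A : 'M[R[i]]_n0) (Gamma : forall j : 'I_l, 'M[R[i]]_(n j)),
    [/\ forall j : 'I_l, p (sigma j) = p j,
        A \is unitarymx,
        forall j : 'I_l, Gamma j \is unitarymx
      & forall (z : 'rV[R[i]]_n0) (w : 'rV[R[i]]_(\sum_(j < l) n j)),
          FBH_domain n0 n p mu (z, w) ->
          f (z, w) =
            (z *m A,
             \mxrow_(j < l)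
               (castmx (erefl 1%N, n_sigma j) (submxrow w (sigma j))
                  *m Gamma j))].
Proof.
have [[fD _ fsurj] hol_f [g gf hol_g]] := f_bihol.
have hf : half_aut p mu f g by split => // x Dx; exact: fD.
have hg : half_aut p mu g f.
  split => //.
  - by move=> x /fsurj[y Dy <-]; rewrite gf.
  - by move=> x /fsurj[y Dy <-]; rewrite gf.
  - by rewrite -f0 gf//; exact: D_z0.
have N_gt0 : (0 < \sum_(j < l) n j)%N.
  by rewrite (bigD1 (Ordinal l_gt0))//= addn_gt0 n_gt0.
have [tau [pt nt van iso]] := block_permutation p_gt0 mu_gt0 n0_gt0 N_gt0 p_neq1 n_gt0 hf hg.
(* [tau] leads from source to target blocks, whereas [sigma j] has to name the source of target
   [j]. *)
pose sigma := (tau^-1)%g.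
have ts j : tau (sigma j) = j by rewrite permKV.
have ns j : n (sigma j) = n j by rewrite -{2}(ts j) nt.
(* The block from [sigma j] to [j] has [n (sigma j)] rows; the cast along [ns j] makes it square. *)
exists sigma, ns, (phi_mx f), (fun j => castmx (ns j, erefl (n j)) (block_mx f (sigma j) j)).
split.
- by move=> j; rewrite -{2}(ts j) pt.
- apply: isometry_unitary => v.
  by rewrite -(phi_mxE p_gt0 mu_gt0 N_gt0 v hf hg) (nsq_phi p_gt0 mu_gt0 N_gt0 v hf hg).
- move=> j; apply: isometry_unitary => v; apply: nsq_cast => u.
  by apply: iso; rewrite ts.
move=> z w /domE zw; rewrite (aut_form p_gt0 mu_gt0 hf hg zw); congr (_, _).
  exact: (phi_mxE p_gt0 mu_gt0 N_gt0 z hf hg).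
apply: submxrow_eq => j; rewrite mxrowK mul_cast_vec.
rewrite (fibre_const p_gt0 mu_gt0 n0_gt0 N_gt0 z w hf hg) fibre_blocks.
rewrite [LHS](bigD1 (sigma j))//= [X in _ + X]big1 ?addr0// => i ij.
rewrite van ?mulmx0//; apply: contra ij => /eqP ->; by rewrite /sigma permK.
Qed.
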